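(* Let $N>2$. For almost every choice of the lengths $(\ell_1,\dots,\ell_N)$ of the links, the $N$-link swimmer is fiber controllable: for any initial $(g_0,s_0)\in SE(3)\times(\mathbb{R}\times\mathbb{T})^{N-1}$ and any final $g_1\in SE(3)$ there exist a time $T>0$ and control inputs $u=(u_1^{(i)},u_2^{(i)})_{i=2}^N\colon[0,T]\to\mathbb{R}^{2N-2}$ such that the unique solution $(g(t),s(t))$ of the $N$-link control system with $(g(0),s(0))=(g_0,s_0)$ satisfies $g(T)=g_1$.
   Context: The $N$-link swimmer. Fix constants $0<C_\parallel<C_\perp$ and $C_\tau>0$ (parallel, perpendicular and torsional drag coefficients). The links have lengths $\ell_i\ge 0$, $i=1,\dots,N$, at least two of which are positive; ''almost every'' refers to Lebesgue measure on $[0,+\infty)^N$. Let $\mathbb{T}=\mathbb{R}/2\pi\mathbb{Z}$. The shape is $s=(\vartheta^{(i)},\varphi^{(i)})_{i=2}^N\in(\mathbb{R}\times\mathbb{T})^{N-1}$. Put $\tilde e^{(1)}=(0,0,1)^\top$ and $\tilde e^{(i)}=(\cos\vartheta^{(i)}\sin\varphi^{(i)},\sin\vartheta^{(i)}\sin\varphi^{(i)},\cos\varphi^{(i)})^\top$ for $i=2,\dots,N$ (link directions in the co-moving frame). In the co-moving frame link 1 is $\{r\tilde e^{(1)}:0\le r\le\ell_1\}$ and, for $i\ge2$, link $i$ is $\{\sum_{j=2}^{i-1}\ell_j\tilde e^{(j)}+r\tilde e^{(i)}:0\le r\le\ell_i\}$. Let $\tilde E^{(i)}$ be the matrix with $\tilde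 E^{(i)}v=\tilde e^{(i)}\times v$, $(a\otimes b)_{kl}=a_kb_l$, and $$D_i=(C_\parallel-C_\perp)\tilde e^{(i)}\otimes\tilde e^{(i)}+C_\perp I,\qquad A_i=\sum_{j=2}^{i-1}\ell_j\tilde E^{(j)},\qquad \dot a_i=\sum_{j=2}^{i-1}\ell_j\dot{\tilde e}^{(j)}$$ (empty sums are zero). Define $\tilde K=\sum_{i=1}^N\ell_iD_i$, $\tilde C=\sum_{i=1}^N\big(\ell_iA_iD_i+\tfrac{\ell_i^2}{2}C_\perp\tilde E^{(i)}\big)$, $\tilde J=\sum_{i=1}^N\tilde J^{(i)}$ with $$\tilde J^{(1)}=\tfrac{\ell_1^3}{3}C_\perp[I-\tilde e^{(1)}\otimes\tilde e^{(1)}]+\ell_1C_\tau\,\tilde e^{(1)}\otimes\tilde e^{(1)},$$ $$\tilde J^{(i)}=-\ell_i(C_\parallel-C_\perp)A_i(\tilde e^{(i)}\otimes\tilde e^{(i)})A_i-\ell_iC_\perp A_i^2-\tfrac{\ell_i^2}{2}C_\perp\big(\tilde E^{(i)}A_i+A_i\tilde E^{(i)}\big)+\tfrac{\ell_i^3}{3}C_\perp[I-\tilde e^{(i)}\otimes\tilde e^{(i)}]\quad(i\ge2),$$ and the grand resistance matrix $\tilde{\mathcal M}(s)=\begin{pmatrix}\tilde K&\tilde C^\top\\\tilde C&\tilde J\end{pmatrix}$, which is taken to be positive definite, hence invertible. The force and torque due to shape change are $$\tilde{\mathbf F}^{\mathrm{sh}}=\sum_{i=2}^N\Big[\ell_iD_i\dot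 a_i+\tfrac{\ell_i^2}{2}C_\perp\dot{\tilde e}^{(i)}\Big],$$ $$\tilde{\mathbf T}^{\mathrm{sh}}=\sum_{i=2}^N\Big[\ell_iA_iD_i\dot a_i+\tfrac{\ell_i^2}{2}C_\perp\tilde E^{(i)}\dot a_i+\tfrac{\ell_i^2}{2}C_\perp A_i\dot{\tilde e}^{(i)}+\tfrac{\ell_i^3}{3}C_\perp\tilde E^{(i)}\dot{\tilde e}^{(i)}\Big].$$ These are linear in $(\dot\varphi^{(i)},\dot\vartheta^{(i)})_{i=2}^N$. An element $g\in SE(3)$ is $g=\begin{pmatrix}R&\mathbf x\\0&1\end{pmatrix}$, where $\mathbf x\in\mathbb{R}^3$ is the position of the joint between links 1 and 2 and $R\in SO(3)$ the orientation; $\boldsymbol\omega$ is the angular velocity, $\dot RR^{-1}v=\boldsymbol\omega\times v$. The $N$-link control system, with controls $u_1^{(i)},u_2^{(i)}\in L^\infty(0,T)$ and absolutely continuous solutions, is, for a.e. $t$, $$\begin{pmatrix}R^{-1}\dot{\mathbf x}\\R^{-1}\boldsymbol\omega\end{pmatrix}=-\tilde{\mathcal M}(s)^{-1}\begin{pmatrix}\tilde{\mathbf F}^{\mathrm{sh}}\\\tilde{\mathbf T}^{\mathrm{sh}}\end{pmatrix},\qquad\dot\varphi^{(i)}=u_1^{(i)},\quad\dot\vartheta^{(i)}=u_2^{(i)},\quad i=2,\dots,N.$$ *)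

(* Defs.v *)
From HB Require Import structures.
From mathcomp Require Import all_boot all_order all_algebra.
From mathcomp Require Import all_classical all_reals all_analysis.

Set Implicit Arguments.
Unset Strict Implicit.
Unset Printing Implicit Defensive.

Import Order.TTheory GRing.Theory Num.Theory.
Import numFieldNormedType.Exports.

Local Open Scope classical_set_scope.
Local Open Scope ring_scope.
Local Open Scope quotient_scope.

(** * The circle R / 2 pi Z *)

Definition two_pi_int (R : realType) : {pred R} :=
  fun x => `[< exists k : int, x = 2 * pi * k%:~R >].

Lemma two_pi_int_zmod_closed (R : realType) : zmod_closed (@two_pi_int R).
Proof.
split=> [|_ _ /asboolP[k ->] /asboolP[l ->]]; apply/asboolP.
  by exists 0; rewrite mulr0.
by exists (k - l); rewrite rmorphB mulrBr.
Qed.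

HB.instance Definition _ (R : realType) :=
  GRing.isZmodClosed.Build R (@two_pi_int R) (@two_pi_int_zmod_closed R).

Notation circle R := (Quotient.quot (@two_pi_int R : zmodClosed R)).

Section Circle.
Context {R : realType}.

Definition to_circle (x : R) : circle R := \pi_(circle R) x.

(* Independent of the representative: see [circle_cosE] and [circle_sinE]. *)
Definition circle_cos (z : circle R) : R := cos (repr z).
Definition circle_sin (z : circle R) : R := sin (repr z).

Lemma to_circleP (x y : R) :
  to_circle x = to_circle y <-> exists k : int, x - y = 2 * pi * k%:~R.
Proof.
split=> [/eqP|h]; last apply/eqP.
  by rewrite /to_circle -Quotient.idealrBE => /asboolP.
by rewrite /to_circle -Quotient.idealrBE; apply/asboolP.
Qed.

Lemma periodicz (f : R -> R) (x : R) (k : int) :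
  periodic f (pi *+ 2) -> f (x + 2 * pi * k%:~R) = f x.
Proof.
move=> pf; have pfn y (n : nat) : f (y + 2 * pi * n%:R) = f y.
  by rewrite mulr_natr mulr_natl periodicn.
case: k => n; first exact: pfn.
by rewrite NegzE rmorphN mulrN -[in RHS](subrK (2 * pi * n.+1%:R) x) pfn.
Qed.

Lemma repr_to_circle (x : R) :
  exists k : int, repr (to_circle x) = x + 2 * pi * k%:~R.
Proof.
have /to_circleP[k hk] : to_circle (repr (to_circle x)) = to_circle x.
  by rewrite {1}/to_circle reprK.
by exists k; rewrite -hk addrC subrK.
Qed.

Lemma circle_cosE (x : R) : circle_cos (to_circle x) = cos x.
Proof.
by rewrite /circle_cos; have [k ->] := repr_to_circle x;
  apply: periodicz; exact: cosD2pi.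
Qed.

Lemma circle_sinE (x : R) : circle_sin (to_circle x) = sin x.
Proof.
by rewrite /circle_sin; have [k ->] := repr_to_circle x;
  apply: periodicz; exact: sinD2pi.
Qed.

End Circle.

(** * Lebesgue measure on R^n *)

Fixpoint lebesgue_tuple (R : realType) (n : nat) :
    set (n.-tuple (measurableTypeR R)) -> \bar R :=
  match n with
  | 0 => \d_([tuple])
  | m.+1 => pushforward (lebesgue_measure \x @lebesgue_tuple R m)%E
              (fun p => [tuple of p.1 :: p.2])
  end.

(** * Absolutely continuous curves and controls *)

Section Curves.
Context {R : realType}.

Definition absolutely_continuous (V : normedModType R) (a b : R) (f : R -> V) :=
  forall e : R, 0 < e -> exists2 d : R, 0 < d &
    forall (n : nat) (x y : 'I_n -> R),
      (forall i, a <= x i /\ x i <= y i /\ y i <= b) ->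
      trivIset setT (fun i => `]x i, y i[%classic) ->
      \sum_(i < n) (y i - x i) < d ->
      \sum_(i < n) `|f (y i) - f (x i)| < e.

Definition has_velocity (a b : R) (f v : R -> R) :=
  absolutely_continuous a b f /\
  {ae lebesgue_measure, forall t : measurableTypeR R,
     `]a, b[%classic t -> is_derive (t : R) 1 f (v t)}.

(* An absolutely continuous curve in the circle is one that lifts to an
   absolutely continuous real-valued curve; the lift is unique up to a constant
   multiple of 2 pi, so its velocity does not depend on the choice made. *)
Definition has_circle_velocity (a b : R) (f : R -> circle R) (v : R -> R) :=
  exists2 F : R -> R,
    forall t, a <= t <= b -> f t = to_circle (F t) & has_velocity a b F v.

Definition Linfty (a b : R) (v : R -> R) :=
  (v \_ `[a, b] : measurableTypeR R -> R) \in Lfun lebesgue_measure +oo%E.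

End Curves.

(** * Linear algebra in dimension 3 and SE(3) *)

Section Space.
Context {R : realType}.

Definition vec3 (x y z : R) : 'cV[R]_3 := \col_(k < 3) [:: x; y; z]`_k.

(* Index arithmetic in 'I_3 is modulo 3. *)
Definition cross (a b : 'cV[R]_3) : 'cV[R]_3 :=
  \col_k (a (k + 1) 0 * b (k + 2) 0 - a (k + 2) 0 * b (k + 1) 0).

Definition cross_mx (a : 'cV[R]_3) : 'M[R]_3 :=
  \matrix_(k, l) cross a (delta_mx l 0) k 0.

Lemma cross_mxE (a v : 'cV[R]_3) : cross_mx a *m v = cross a v.
Proof.
apply/colP => k; rewrite !mxE.
under eq_bigr do rewrite !mxE !andbT.
under eq_bigr do rewrite mulrBl -!mulrA.
rewrite sumrB -!mulr_sumr; congr (_ * _ - _ * _).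
  by rewrite (bigD1 (k + 2)) //= eqxx mul1r big1 ?addr0// => i /negPf;
     rewrite eq_sym => ->; rewrite mul0r.
by rewrite (bigD1 (k + 1)) //= eqxx mul1r big1 ?addr0// => i /negPf;
   rewrite eq_sym => ->; rewrite mul0r.
Qed.

Definition tensor (a b : 'cV[R]_3) : 'M[R]_3 := a *m b^T.

Definition positive_definite (n : nat) (M : 'M[R]_n) :=
  M^T = M /\ forall v : 'cV[R]_n, v != 0 -> 0 < (v^T *m M *m v) 0 0.

Definition SE3 (g : 'M[R]_(3 + 1)) :=
  exists (P : 'M[R]_3) (x : 'cV[R]_3),
    [/\ P^T *m P = 1%:M, \det P = 1 & g = block_mx P x 0 1%:M].

End Space.

(** * The N-link swimmer *)

(* Links are numbered from 0. The co-moving frame is attached to link 0, whose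
   direction is constant, and the joint of links 0 and 1 is its origin; the
   links with angles of their own are those with 0 < i. *)
Definition mobile (N : nat) := {i : 'I_N | (0 < i)%N}.

(* [(s i).1] is the angle theta, in R, and [(s i).2] is phi, in R / 2 pi Z. *)
Definition swimmer_shape (R : realType) (N : nat) := mobile N -> R * circle R.

Section Swimmer.
Context {R : realType} (Cpar Cperp Ctau : R) {N : nat} (ell : N.-tuple R).

Local Notation "'l_ i" := (tnth ell i) (at level 8, i at level 2).

Definition link_dir (s : swimmer_shape R N) (i : 'I_N) : 'cV[R]_3 :=
  match insub i : option (mobile N) with
  | Some j => let: (theta, phi) := s j in
      vec3 (cos theta * circle_sin phi) (sin theta * circle_sin phi)
           (circle_cos phi)
  | None => vec3 0 0 1
  end.

Section Resistance.
Context (s : swimmer_shape R N).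

Local Notation e := (link_dir s).
Local Notation E i := (cross_mx (link_dir s i)).

Definition drag_mx (i : 'I_N) : 'M[R]_3 :=
  (Cpar - Cperp) *: tensor (e i) (e i) + Cperp *: 1%:M.

Definition arm_mx (i : 'I_N) : 'M[R]_3 :=
  \sum_(j < N | (0 < j < i)%N) 'l_j *: E j.

Definition K_mx : 'M[R]_3 := \sum_(i < N) 'l_i *: drag_mx i.

Definition C_mx : 'M[R]_3 :=
  \sum_(i < N) ('l_i *: (arm_mx i *m drag_mx i)
                + ('l_i ^+ 2 / 2 * Cperp) *: E i).

Definition J_link (i : 'I_N) : 'M[R]_3 :=
  if (i == 0 :> nat) then
    ('l_i ^+ 3 / 3 * Cperp) *: (1%:M - tensor (e i) (e i))
    + ('l_i * Ctau) *: tensor (e i) (e i)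
  else
    - (('l_i * (Cpar - Cperp)) *: (arm_mx i *m tensor (e i) (e i) *m arm_mx i))
    - ('l_i * Cperp) *: (arm_mx i *m arm_mx i)
    - ('l_i ^+ 2 / 2 * Cperp) *: (E i *m arm_mx i + arm_mx i *m E i)
    + ('l_i ^+ 3 / 3 * Cperp) *: (1%:M - tensor (e i) (e i)).

Definition J_mx : 'M[R]_3 := \sum_(i < N) J_link i.

Definition resistance_mx : 'M[R]_(3 + 3) := block_mx K_mx C_mx^T C_mx J_mx.

(* [de i] stands for the time derivative of [link_dir s i]. *)
Definition arm_velocity (de : 'I_N -> 'cV[R]_3) (i : 'I_N) : 'cV[R]_3 :=
  \sum_(j < N | (0 < j < i)%N) 'l_j *: de j.

Definition shape_force (de : 'I_N -> 'cV[R]_3) : 'cV[R]_3 :=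
  \sum_(i < N | (0 < i)%N)
    ('l_i *: (drag_mx i *m arm_velocity de i)
     + ('l_i ^+ 2 / 2 * Cperp) *: de i).

Definition shape_torque (de : 'I_N -> 'cV[R]_3) : 'cV[R]_3 :=
  \sum_(i < N | (0 < i)%N)
    ('l_i *: (arm_mx i *m drag_mx i *m arm_velocity de i)
     + ('l_i ^+ 2 / 2 * Cperp) *: (E i *m arm_velocity de i)
     + ('l_i ^+ 2 / 2 * Cperp) *: (arm_mx i *m de i)
     + ('l_i ^+ 3 / 3 * Cperp) *: (E i *m de i)).

End Resistance.

Definition motion_equation (g : R -> 'M[R]_(3 + 1)) (s : R -> swimmer_shape R N)
    (t : R) :=
  let P := ulsubmx (g t) in
  let dP := ulsubmx (derive1 g t) in
  let dx := ursubmx (derive1 g t) in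
  let de := fun i : 'I_N => derive1 (fun r : R => link_dir (s r) i) t in
  derivable g t 1 /\
  exists2 omega : 'cV[R]_3,
    forall v : 'cV[R]_3, dP *m invmx P *m v = cross omega v &
    col_mx (invmx P *m dx) (invmx P *m omega) =
      - (invmx (resistance_mx (s t)) *m
         col_mx (shape_force (s t) de) (shape_torque (s t) de)).

(* [u1] controls phi and [u2] controls theta. *)
Definition swimmer_solution (T : R) (u1 u2 : mobile N -> R -> R)
    (g : R -> 'M[R]_(3 + 1)) (s : R -> swimmer_shape R N) :=
  [/\ forall t, 0 <= t <= T -> SE3 (g t),
      absolutely_continuous 0 T g,
      forall i, has_circle_velocity 0 T (fun t => (s t i).2) (u1 i),
      forall i, has_velocity 0 T (fun t => (s t i).1) (u2 i) &
      {ae lebesgue_measure, forall t : measurableTypeR R,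
         `]0, T[%classic t -> motion_equation g s t}].

Definition unique_solution_from (T : R) (u1 u2 : mobile N -> R -> R)
    (g0 : 'M[R]_(3 + 1)) (s0 : swimmer_shape R N)
    (g : R -> 'M[R]_(3 + 1)) (s : R -> swimmer_shape R N) :=
  [/\ swimmer_solution T u1 u2 g s, g 0 = g0, s 0 = s0 &
      forall (g' : R -> 'M[R]_(3 + 1)) (s' : R -> swimmer_shape R N),
        swimmer_solution T u1 u2 g' s' -> g' 0 = g0 -> s' 0 = s0 ->
        forall t, 0 <= t <= T -> g' t = g t /\ s' t = s t].

Definition fiber_controllable :=
  forall (g0 : 'M[R]_(3 + 1)) (s0 : swimmer_shape R N) (g1 : 'M[R]_(3 + 1)),
    SE3 g0 -> SE3 g1 ->
    exists (T : R) (u1 u2 : mobile N -> R -> R),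
      [/\ 0 < T, forall i, Linfty 0 T (u1 i), forall i, Linfty 0 T (u2 i) &
          exists (g : R -> 'M[R]_(3 + 1)) (s : R -> swimmer_shape R N),
            unique_solution_from T u1 u2 g0 s0 g s /\ g T = g1].

Definition link_lengths :=
  (forall i, 0 <= 'l_i) /\ (1 < #|[pred i : 'I_N | (0 < 'l_i)%R]|)%N.

End Swimmer.

(* Main.v *)
(* All links but link 0 turning together about the axis of link 0 is a shape change which
   is, up to the choice of the co-moving frame, no change at all. In a co-moving frame the
   body velocity is then constant: the swimmer performs a screw motion along an axis that
   depends on the remaining shape parameters, with the pitch given by the resistance
   matrix. Running this spin from two shapes joined by a path produces rotations about two
   axes; if these are not parallel and the pitch is not zero, their products fill SE(3),
   which is reached at a fixed final shape, hence from any initial shape.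

   Both conditions are the nonvanishing of polynomials in the lengths: for the second one,
   link 1 is orthogonal to link 0 and the other links rotate about it, and the polynomial
   measures the derivative of the spin axis. A polynomial that does not vanish at one
   explicit choice of lengths has a null set of zeros. *)
Require Import Defs.
From HB Require Import structures.
From mathcomp Require Import all_boot all_order all_algebra.
From mathcomp Require Import all_classical all_reals all_analysis.
From mathcomp Require Import measurable_realfun ess_sup_inf ring lra.

Set Implicit Arguments.
Unset Strict Implicit.
Unset Printing Implicit Defensive.

Import Order.TTheory GRing.Theory Num.Theory.
Import numFieldNormedType.Exports.

Local Open Scope classical_set_scope.
Local Open Scope ring_scope.

(** * Absolutely continuous functions *)

(** The obstacle is the closing angle. A spin restores the shape only up to [spin_shift], so loops
    form a subgroup of SE(3) x R ([hol]), and its elements of index 0 still have to fill SE(3).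
    Commutators have index 0: the translation left by one full turn gives all translations through
    differences of its rotated copies, and a rotation about [p] is a commutator with a half turn
    about an axis orthogonal to [p]. The spin twist is explicit because the resistance matrix is
    [rest_mx + base_mx]: links 1, 2, ... turning rigidly about [ez] load the body by [rest_mx]
    applied to (0; ez), while [base_mx] sends (0; ez) to the torsional drag of link 0. In the
    turning frame the twist is thus a multiple of the inverse resistance applied to (0; ez), nonzero
    only if link 0 has nonzero length. No second shape is made explicit: if the cross product of the
    initial axis with the transported one has nonzero derivative at time 0, some nearby shape has a
    nonparallel axis. Adjugates in place of inverses make the conditions polynomial in the lengths.
    They are tested with links 1 and 2 alone, where the system is solved by hand and the pitch has
    the factor [Cperp - Cpar]. *)

Section AbsoluteContinuity.
Context {R : realType}.
Local Notation mu := (@lebesgue_measure R).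

Lemma ac_sub (V : normedModType R) (a b c d : R) (f : R -> V) :
  a <= c -> d <= b -> absolutely_continuous a b f -> absolutely_continuous c d f.
Proof.
move=> ac db acf e e0; have [r r0 fr] := acf e e0; exists r => // n x y xy.
apply: fr => i; have [cx [xyi yd]] := xy i.
by split; [exact: le_trans cx|split => //; exact: le_trans db].
Qed.

(** Continuous induction: let [c] be the supremum of the good points. The step at [c] carries [P]
    from a good point just left of [c] to a point beyond it, which is absurd unless [c = b]. *)
Lemma real_induction (a b : R) (P : R -> Prop) : a <= b -> P a ->
  (forall c, a <= c <= b -> exists2 d, 0 < d & forall x y,
     c - d < x -> x <= c -> c <= y -> y < c + d -> a <= x -> y <= b ->
     P x -> P y) ->
  P b.
Proof.
move=> ab Pa step; pose S := [set x | a <= x <= b /\ P x].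
have Sa : S a by split => //; rewrite lexx.
have ubS : ubound S b by move=> x [/andP[]].
have hS : has_sup S by split; [exists a|exists b].
have ac : a <= sup S by exact: (sup_upper_bound hS).
have cb : sup S <= b by apply: ge_sup => //; exists a.
have acb : a <= sup S <= b by rewrite ac cb.
have [d d0 stepc] := step _ acb.
have [x [/andP[ax xb] Px] cdx] := sup_adherent d0 hS.
have xc : x <= sup S by apply: (sup_upper_bound hS); split => //; rewrite ax xb.
have [cb'|bc] := ltP (sup S) b; last first.
  by apply: (stepc x b); rewrite // (le_lt_trans bc)// ltrDl.
pose y := Num.min b (sup S + d / 2).
have cy : sup S < y by rewrite lt_min cb' ltrDl divr_gt0.
have yb : y <= b by rewrite ge_min lexx.
have Py : P y.
  apply: (stepc x y) => //; first exact: ltW.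
  by rewrite gt_min ltrD2l ltr_pdivrMr// ltr_pMr// ltr1n orbT.
have : y <= sup S.
  by apply: (sup_upper_bound hS); split => //; rewrite yb (le_trans ac (ltW cy)).
by rewrite leNgt cy.
Qed.

(** Lists ordered from right to left replace indexed families, so that an induction moving
    rightwards can add each new interval at the head. *)
Lemma ac_sum_seq (V : normedModType R) (a b e : R) (f : R -> V) :
  absolutely_continuous a b f -> 0 < e -> exists2 d : R, 0 < d &
    forall s : seq (R * R),
      (forall p, p \in s -> a <= p.1 /\ p.1 <= p.2 /\ p.2 <= b) ->
      pairwise (fun p q => q.2 <= p.1) s ->
      \sum_(p <- s) (p.2 - p.1) < d ->
      \sum_(p <- s) `|f p.2 - f p.1| < e.
Proof.
move=> acf e0; have [d d0 fd] := acf e e0; exists d => // s sab ps sd.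
have nthE (F : R * R -> R) : \sum_(p <- s) F p = \sum_(i < size s) F (nth 0 s i).
  by rewrite (big_nth 0) big_mkord.
rewrite nthE in sd; rewrite nthE; apply: fd => // [i|].
  by apply: sab; exact: mem_nth.
have disj (i j : 'I_(size s)) : (i < j)%N -> forall z,
    `](nth 0 s i).1, (nth 0 s i).2[%classic z ->
    `](nth 0 s j).1, (nth 0 s j).2[%classic z -> False.
  move=> ij z /=; rewrite !in_itv/= => /andP[iz _] /andP[_ zj].
  have /(pairwiseP 0)/(_ i j) := ps.
  rewrite !inE !ltn_ord => /(_ isT isT ij) /= ji.
  by have := lt_le_trans zj ji; rewrite ltNge (ltW iz).
move=> i j _ _ [z [iz jz]]; apply: val_inj; case: (ltngtP i j) => // h.
  by case: (disj i j h z).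
by case: (disj j i h z).
Qed.

(* The null set of bad points is covered by an open set [U] of small measure; [P x]
   says that the increment of [f] over [a, x] splits into one of slope at most [e] and
   increments over disjoint intervals contained in [U]. *)
Lemma ac_derive0_le (a b e : R) (f : R -> R) : a <= b -> 0 < e ->
  absolutely_continuous a b f ->
  {ae mu, forall t : measurableTypeR R,
     `]a, b[%classic t -> is_derive (t : R) 1 f 0} ->
  `|f b - f a| <= e * (b - a) + e.
Proof.
move=> ab e0 acf [A [mA A0 bad]].
have [d d0 fd] := ac_sum_seq acf e0.
(* The derivative is only known inside the interval, so the endpoints count as bad points; this
   costs no measure. *)
pose B := A `|` [set a; b].
have mB : measurable B.
  by apply: measurableU => //; apply: measurableU; exact: measurable_set1.
have B0 : mu B = 0%E.
  have mab : measurable ([set a; b] : set R).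
    by apply: measurableU; exact: measurable_set1.
  have ab0 : mu [set a; b] = 0%E.
    rewrite countable_lebesgue_measure0//.
    by apply: finite_set_countable; exact: finite_set2.
  apply/eqP; rewrite eq_le measure_ge0 andbT.
  apply: (@le_trans _ _ (mu A + mu [set a; b])%E); first exact: measureU2.
  by rewrite ab0 adde0; have -> : mu A = 0%E by exact: A0.
have [U [oU BU Ud]] : exists U : set R, [/\ open U, B `<=` U & (mu U < d%:E)%E].
  have Bfin : (mu B < +oo)%E by rewrite B0 ltry.
  have [U [oU BU Ud]] := lebesgue_regularity_outer mB Bfin d0.
  exists U; split => //; apply: le_lt_trans Ud.
  have mU : measurable U by exact: open_measurable.
  rewrite -{1}(setDUK BU); apply: (@le_trans _ _ (mu B + mu (U `\` B))%E).
    by apply: measureU2 => //; exact: measurableD.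
  by rewrite B0 add0e.
have mU : measurable U by exact: open_measurable.
(* Containment in [U] is recorded only through the total length of the intervals, with [m x] as the
   budget spent up to [x]. *)
pose m x := mu (U `&` `[a, x[).
have mfin x : m x \is a fin_num.
  rewrite ge0_fin_numE ?measure_ge0//.
  apply: le_lt_trans (lt_trans Ud (ltry _)).
  by apply: le_measure; rewrite ?inE//; exact: measurableI.
have mle x y : x <= y -> fine (m x) <= fine (m y).
  move=> xy; apply: fine_le => //; apply: le_measure; rewrite ?inE//;
    try exact: measurableI.
  by apply: setIS => z /=; rewrite !in_itv/= => /andP[-> /lt_le_trans -> //].
have mD x y : a <= x -> x <= y -> `[x, y[ `<=` U ->
    y - x + fine (m x) <= fine (m y).
  move=> ax xy xyU; rewrite -lee_fin EFinD !fineK//.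
  have -> : (y - x)%:E = mu `[x, y[.
    rewrite lebesgue_measure_itv/= lte_fin; case: ltP => // yx.
    by rewrite (@le_anti _ _ x y) ?xy ?yx// subrr.
  rewrite -measureU//; last 2 first.
  - exact: measurableI.
  - apply/seteqP; split => // z [/=]; rewrite !in_itv/= => /andP[xz _].
    by move=> [_ /andP[_]]; rewrite ltNge xz.
  apply: le_measure; rewrite ?inE; [|exact: measurableI|].
    by apply: measurableU => //; exact: measurableI.
  move=> z [xz|[Uz]] /=; rewrite ?in_itv/=.
    split; first exact: xyU.
    by move: xz; rewrite /= in_itv/= => /andP[/(le_trans ax) -> ->].
  by move=> /andP[-> /lt_le_trans ->].
pose P x := exists s : seq (R * R),
  [/\ forall p, p \in s -> a <= p.1 /\ p.1 <= p.2 /\ p.2 <= x,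
      pairwise (fun p q => q.2 <= p.1) s,
      \sum_(p <- s) (p.2 - p.1) <= fine (m x) &
      `|f x - f a| <= e * (x - a) + \sum_(p <- s) `|f p.2 - f p.1|].
suff [s [sab ps sd fs]] : P b.
  apply: (le_trans fs); rewrite lerD2l; apply/ltW/fd => //.
  apply: (le_lt_trans sd); rewrite -lte_fin fineK//.
  by apply: le_lt_trans Ud; apply: le_measure; rewrite ?inE//; exact: measurableI.
apply: (real_induction ab); first exists [::].
  by split => //; rewrite !big_nil ?fine_ge0// !subrr normr0 mulr0 addr0.
move=> c /andP[ac cb]; have [Bc|nBc] := pselect (B c).
  have /open_subball := oU; have Uc : U c by exact: BU.
  have /nbhs_ballP[r /= r0 rU] : nbhs c U by exact: open_nbhs_nbhs.
  exists r => // x y cx xc cy yc ax yb [s [sab ps sd fs]].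
  have xy : x <= y by exact: le_trans cy.
  exists ((x, y) :: s); split.
  - move=> p; rewrite inE => /predU1P[->//|/sab[? [? px]]].
    by do 2 split => //; exact: le_trans xy.
  - by rewrite /= ps andbT; apply/allP => p /sab[_ []].
  - rewrite big_cons /=; apply: le_trans (mD _ _ ax xy _); first by rewrite lerD2l.
    move=> z /=; rewrite in_itv/= => /andP[xz zy]; apply: rU.
    rewrite /ball /= ltr_norml; apply/andP; split; lra.
  - rewrite big_cons /= (_ : f y - f a = (f y - f x) + (f x - f a)); last by lra.
    apply: (le_trans (ler_normD _ _)).
    have : e * (x - a) <= e * (y - a) by rewrite ler_pM2l//; lra.
    by lra.
have cab : `]a, b[%classic c.
  rewrite /= in_itv/= !lt_neqAle ac cb !andbT; apply/andP; split.
    by apply: contra_notN nBc => /eqP <-; right; left.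
  by apply: contra_notN nBc => /eqP ->; right; right.
have dfc : is_derive c 1 f 0.
  apply: contrapT => h; apply: nBc; left; apply: bad => /= /(_ cab); exact: h.
have : h^-1 *: (f (h *: 1 + c) - f c) @[h --> 0^'] --> (0 : R).
  have [dc dE] := dfc; rewrite -[X in _ --> X]dE.
  exact: dc.
move=> /cvgrPdist_le /(_ _ e0)[r /= r0 fr].
have fcr z : `|z - c| < r -> `|f z - f c| <= e * `|z - c|.
  have [->|zc] := eqVneq z c; first by rewrite !subrr normr0 mulr0.
  move=> zr; have zc0 : z - c != 0 by rewrite subr_eq0.
  have /= := fr (z - c); rewrite !sub0r !normrN => /(_ zr zc0).
  rewrite [_%:A]mulr1 subrK normrM normfV.
  by rewrite ler_pdivrMl ?normr_gt0// mulrC.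
exists r => // x y cx xc cy yc ax yb [s [sab ps sd fs]].
have xy : x <= y by exact: le_trans cy.
exists s; split => //.
- move=> p /sab[? [? px]]; do 2 split => //; exact: le_trans xy.
- by apply: le_trans sd _; exact: mle.
- have : `|f y - f c| <= e * (y - c).
    by rewrite -[y - c]ger0_norm ?subr_ge0//; apply: fcr; rewrite ger0_norm; lra.
  have : `|f x - f c| <= e * (c - x).
    rewrite -[c - x]ger0_norm ?subr_ge0// [X in _ * X]distrC; apply: fcr.
    by rewrite distrC ger0_norm; lra.
  rewrite (_ : f y - f a = (f y - f c) - (f x - f c) + (f x - f a)); last by lra.
  have := ler_normD ((f y - f c) - (f x - f c)) (f x - f a).
  have := ler_normB (f y - f c) (f x - f c).
  by lra.
Qed.

Lemma ac_derive0_cst (a b : R) (f : R -> R) :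
  absolutely_continuous a b f ->
  {ae mu, forall t : measurableTypeR R,
     `]a, b[%classic t -> is_derive (t : R) 1 f 0} ->
  forall t, a <= t <= b -> f t = f a.
Proof.
move=> acf f0 t /andP[at_ tb]; apply/eqP; rewrite -subr_eq0 -normr_le0.
apply/ler_addgt0Pl => e e0; rewrite addr0.
have k0 : 0 < t - a + 1 by lra.
(* With this slope the bound, slope times [t - a] plus slope, is exactly [e]. *)
have := @ac_derive0_le a t (e / (t - a + 1)) f at_ (divr_gt0 e0 k0).
rewrite -[X in _ * _ + X]mulr1 -mulrDr divfK ?gt_eqF//; apply.
  exact: ac_sub acf.
apply: filterS f0 => x fx xat; apply: fx; move: xat => /=.
by rewrite !in_itv/= => /andP[-> /lt_le_trans ->].
Qed.

Definition lipschitz_itv (V : normedModType R) (a b : R) (f : R -> V) :=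
  exists2 L, 0 < L & forall x y, a <= x <= b -> a <= y <= b ->
    `|f y - f x| <= L * `|y - x|.

Lemma lipschitz_ac (V : normedModType R) (a b : R) (f : R -> V) :
  lipschitz_itv a b f -> absolutely_continuous a b f.
Proof.
move=> [L L0 fL] e e0; exists (e / L); first exact: divr_gt0.
move=> n x y xy _; rewrite ltr_pdivlMr// mulrC; apply: le_lt_trans.
rewrite mulr_sumr; apply: ler_sum => i _; have [ax [xyi yb]] := xy i.
rewrite -[y i - x i]ger0_norm ?subr_ge0//; apply: fL.
  by rewrite ax (le_trans xyi).
by rewrite yb (le_trans ax).
Qed.

End AbsoluteContinuity.

(** * Primitives, mean values and derivatives of uniform limits *)

Section Primitive.
Context {R : realType}.
Local Notation mu := (@lebesgue_measure R).

Lemma near_dist_lt (t e : R) : 0 < e -> \forall y \near t, `|y - t| < e.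
Proof.
by move=> e0; apply/nbhs_ballP; exists e => //= y; rewrite /ball /= distrC.
Qed.

(** The fundamental theorem is applied on segments, so [F t] integrates from a base point left of
    both [t] and [0]. By [GE] the value does not depend on that point, and near a given [t] one
    fixed base point serves. *)
Lemma continuous_primitive (f : R -> R) : (forall t, {for t, continuous f}) ->
  exists2 F : R -> R, F 0 = 0 & forall t, is_derive t (1 : R) F (f t).
Proof.
move=> cf; have intf a b : mu.-integrable `[a, b] (EFin \o f).
  apply: continuous_compact_integrable; first exact: segment_compact.
  exact: continuous_subspaceT.
pose G a t := \int[mu]_(x in `[a, t]) f x - \int[mu]_(x in `[a, 0]) f x.
pose F t := G (- (`|t| + 1)) t.
have GE a b t : a <= b -> b <= t -> b <= 0 -> G a t = G b t.
  move=> ab bt b0.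
  have split_itv (x : R) : b <= x -> \int[mu]_(x in `[a, x]) f x =
      \int[mu]_(x in `[a, b]) f x + \int[mu]_(x in `]b, x]) f x.
    by move=> bx; rewrite -(@Rintegral_itvB _ f (BLeft a) (BRight x) b)//; lra.
  have oc x : \int[mu]_(x in `]b, x]) f x = \int[mu]_(x in `[b, x]) f x.
    apply: Rintegral_itv_obnd_cbnd; apply: integrableS (intf b x) => //.
    exact: subset_itv_oc_cc.
  rewrite /G (split_itv t)// (split_itv 0)// !oc; set u := Rintegral _ _ _.
  by rewrite opprD addrACA subrr add0r.
exists F => [|t]; first by rewrite /F /G subrr.
have tn := ler_norm t; have tn' := ler_norm (- t); rewrite normrN in tn'.
pose a := - (`|t| + 2).
have at_ : a < t by rewrite /a; lra.
have tt1 : t < t + 1 by lra.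
have [dG dGE] := continuous_FTC1_closed tt1 (intf a (t + 1)) at_ (cf t).
apply: (@near_eq_is_derive _ _ _ (G a)).
  near=> y; have yt : `|y - t| < 1.
    by near: y; exact: near_dist_lt.
  have := ler_norm y; have := ler_norm (- y); rewrite normrN => h1 h2.
  have := ler_normD (y - t) t; rewrite subrK => h3.
  by rewrite /F; apply: GE; rewrite /a; lra.
have -> : f t = f t - 0 by rewrite subr0.
apply: is_deriveB.
by apply: DeriveDef; [exact: dG|rewrite -derive1E; exact: dGE].
Unshelve. all: by end_near. Qed.

Lemma mean_value (f df : R -> R) (x y : R) : x <= y ->
  (forall z, x <= z <= y -> is_derive z (1 : R) f (df z)) ->
  exists2 c, x <= c <= y & f y - f x = df c * (y - x).
Proof.
move=> xy fd; have [||c cxy e] := @MVT_segment _ f df x y xy.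
- by move=> z; rewrite in_itv/= => /andP[/ltW xz /ltW zy]; apply: fd; rewrite xz.
- apply: derivable_within_continuous => z; rewrite in_itv/= => zxy.
  by have [] := fd z zxy.
by exists c => //; rewrite in_itv/= in cxy.
Qed.

(** Both [h + f] and [h - f] have nonnegative derivative and start from [h 0]. *)
Lemma norm_le_derive (f df h dh : R -> R) (t : R) : 0 <= t -> f 0 = 0 -> 0 <= h 0 ->
  (forall z, 0 <= z <= t -> is_derive z (1 : R) f (df z)) ->
  (forall z, 0 <= z <= t -> is_derive z (1 : R) h (dh z)) ->
  (forall z, 0 <= z <= t -> `|df z| <= dh z) -> `|f t| <= h t.
Proof.
move=> t0 f0 h0 fd hd dfh; rewrite ler_norml; apply/andP; split.
  have [z zt] := @mean_value (h + f) (fun z => dh z + df z) _ _ t0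
    (fun z zt => is_deriveD (hd z zt) (fd z zt)).
  have := dfh z zt; rewrite ler_norml => /andP[h1 h2].
  rewrite /= !fctE f0 !subr0 => e.
  have : 0 <= (dh z + df z) * t by apply: mulr_ge0 => //; lra.
  lra.
have [z zt] := @mean_value (h - f) (fun z => dh z - df z) _ _ t0
  (fun z zt => is_deriveB (hd z zt) (fd z zt)).
have := dfh z zt; rewrite ler_norml => /andP[h1 h2].
rewrite /= !fctE f0 !subr0 => e.
have : 0 <= (dh z - df z) * t by apply: mulr_ge0 => //; lra.
lra.
Qed.

(** By the mean value theorem the increment of [F m] between [t] and [y] is [G m z * (y - t)] for
    some intermediate [z], hence within [e * |y - t|] of [g t * (y - t)] for all large [m]. This
    bound survives the limit in [m]. *)
Lemma is_derive_uniform_limit (F G : nat -> R -> R) (f g : R -> R) (a b t : R) :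
  a < t < b ->
  (forall m x, a <= x <= b -> is_derive x (1 : R) (F m) (G m x)) ->
  (forall x, a <= x <= b -> F ^~ x @ \oo --> f x) ->
  (forall e, 0 < e -> exists m0, forall m x, (m0 <= m)%N -> a <= x <= b ->
     `|G m x - g x| <= e) ->
  {for t, continuous g} -> is_derive t (1 : R) f (g t).
Proof.
move=> /andP[at_ tb] dF cF uG cg.
have key e : 0 < e -> \forall y \near t, `|f y - f t - g t * (y - t)| <= e * `|y - t|.
  move=> e0; have e20 : 0 < e / 2 by rewrite divr_gt0.
  have [m0 Gm0] := uG _ e20.
  have /cvgrPdist_le /(_ _ e20) /nbhs_ballP[r /= r0 gr] := cg.
  near=> y.
  have yta : `|y - t| < t - a by near: y; apply: near_dist_lt; rewrite subr_gt0.
  have ytb : `|y - t| < b - t by near: y; apply: near_dist_lt; rewrite subr_gt0.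
  have ay : a < y by move: yta; rewrite ltr_norml => /andP[]; lra.
  have yb : y < b by move: ytb; rewrite ltr_norml => /andP[]; lra.
  have yr : `|y - t| < r by near: y; exact: near_dist_lt.
  have tab : a <= t <= b by rewrite !ltW.
  have yab : a <= y <= b by rewrite !ltW.
  apply/ler_addgt0Pr => h h0; have h20 : 0 < h / 2 by rewrite divr_gt0.
  have /cvgrPdist_le /(_ _ h20) Fyn := cF y yab.
  have /cvgrPdist_le /(_ _ h20) Ftn := cF t tab.
  near \oo => m.
  have Fy : `|f y - F m y| <= h / 2.
    by near: m; exact: Fyn.
  have Ft : `|f t - F m t| <= h / 2.
    by near: m; exact: Ftn.
  have Gm x : a <= x <= b -> `|G m x - g x| <= e / 2.
    by apply: Gm0; near: m; exact: nbhs_infty_ge.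
  have Fm : `|F m y - F m t - g t * (y - t)| <= e * `|y - t|.
    have step x1 x2 : x1 <= x2 -> a <= x1 -> x2 <= b -> `|x1 - t| < r ->
        `|x2 - t| < r -> `|F m x2 - F m x1 - g t * (x2 - x1)| <= e * `|x2 - x1|.
      move=> x12 ax1 x2b; rewrite !ltr_norml => /andP[r1 r2] /andP[r3 r4].
      have ab z : x1 <= z <= x2 -> a <= z <= b.
        by move=> /andP[? ?]; apply/andP; split; lra.
      have [z xz ->] := mean_value x12 (fun z xz => dF m z (ab z xz)).
      rewrite -mulrBl normrM; apply: ler_wpM2r => //.
      have Gz := Gm z (ab z xz); have := gr z; rewrite /ball /= => gz.
      have {}gz : `|g t - g z| <= e / 2.
        by apply: gz; rewrite ltr_norml; move/andP: xz => [? ?]; apply/andP; split; lra.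
      have := ler_normB (G m z - g z) (g t - g z).
      by rewrite opprB addrA subrK; lra.
    have tt : `|t - t| < r by rewrite subrr normr0.
    have [ty|yt] := leP t y; first by apply: step => //; exact: ltW.
    have := step y t (ltW yt) (ltW ay) (ltW tb) yr tt.
    rewrite (_ : F m y - F m t - _ = - (F m t - F m y - g t * (t - y))).
      by rewrite normrN (distrC y t).
    by ring.
  have := ler_normD (f y - F m y - (f t - F m t)) (F m y - F m t - g t * (y - t)).
  have := ler_normB (f y - F m y) (f t - F m t).
  rewrite (_ : _ + (F m y - F m t - _) = f y - f t - g t * (y - t)); last by ring.
  by lra.
have lim : h^-1 *: (f (h *: 1 + t) - f t) @[h --> 0^'] --> g t.
  apply/cvgrPdist_le => e e0; have := key e e0.
  move=> /nbhs_ballP[r /= r0 kr].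
  near=> h; have h0 : h != 0 by near: h; exact: nbhs_dnbhs_neq.
  have hr : `|h| < r by near: h; exact: dnbhs0_lt.
  have := kr (h + t); rewrite /ball /= distrC addrK => /(_ hr).
  rewrite [h%:A]mulr1; set D := f (h + t) - f t => hD.
  rewrite (_ : _ - _ = h^-1 * (g t * h - D)); last first.
    by rewrite mulrBr mulrCA mulVf// mulr1.
  by rewrite normrM normfV ler_pdivrMl ?normr_gt0// distrC [leRHS]mulrC.
apply: DeriveDef; first by apply/cvg_ex; exists (g t).
exact/cvg_lim.
Unshelve. all: by end_near. Qed.

End Primitive.

(** * Zero sets of polynomials *)

Section SigmaFinitePack.
Context d (T : measurableType d) (R : realType) (m : {measure set T -> \bar R}).
Hypothesis sf : sigma_finite setT m.

Let nu : set T -> \bar R := m.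
HB.instance Definition _ := Measure.on nu.
HB.instance Definition _ := Measure_isSigmaFinite.Build _ _ _ nu sf.

(** Turns a proof of sigma-finiteness into a structure, so that product measures can be formed over
    [lebesgue_tuple], a bare set function defined by recursion. *)
Lemma sigma_finite_measureW :
  exists m' : {sigma_finite_measure set T -> \bar R}, m' = m :> (set T -> \bar R).
Proof. by exists nu. Qed.

End SigmaFinitePack.

Section PolynomialZeroSets.
Context {R : realType}.
Local Notation Rm := (measurableTypeR R).

(** Closure under ring operations stands in for a ring of multivariate polynomials: matrix products,
    determinants and adjugates stay inside by construction, and only [polyfun_head] needs actual
    polynomials, in one variable. *)
Inductive polyfun (n : nat) : (n.-tuple Rm -> R) -> Prop :=
| polyfun_cst (c : R) : polyfun (fun=> c)
| polyfun_coord (i : 'I_n) : polyfun (fun t => tnth t i)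
| polyfunD f g : polyfun f -> polyfun g -> polyfun (fun t => f t + g t)
| polyfunM f g : polyfun f -> polyfun g -> polyfun (fun t => f t * g t).

Lemma polyfun_eq n (f g : n.-tuple Rm -> R) : f =1 g -> polyfun f -> polyfun g.
Proof. by move=> /funext ->. Qed.

Lemma polyfunN n (f : n.-tuple Rm -> R) : polyfun f -> polyfun (fun t => - f t).
Proof.
move=> pf; apply: (@polyfun_eq _ (fun t => -1 * f t)).
  by move=> t; rewrite mulN1r.
by apply: polyfunM => //; exact: polyfun_cst.
Qed.

Lemma polyfunB n (f g : n.-tuple Rm -> R) :
  polyfun f -> polyfun g -> polyfun (fun t => f t - g t).
Proof. by move=> pf pg; apply: polyfunD => //; exact: polyfunN. Qed.

Lemma polyfun_sum n (I : Type) (r : seq I) (P : pred I)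
    (F : I -> n.-tuple Rm -> R) :
  (forall i, P i -> polyfun (F i)) -> polyfun (fun t => \sum_(i <- r | P i) F i t).
Proof.
move=> pF; elim: r => [|i r ih].
  by apply: (polyfun_eq _ (polyfun_cst n 0)) => t; rewrite big_nil.
case: (boolP (P i)) => Pi; last first.
  by apply: polyfun_eq ih => t; rewrite big_cons (negPf Pi).
by apply: polyfun_eq (polyfunD (pF i Pi) ih) => t; rewrite big_cons Pi.
Qed.

Lemma polyfun_prod n (I : Type) (r : seq I) (P : pred I)
    (F : I -> n.-tuple Rm -> R) :
  (forall i, P i -> polyfun (F i)) -> polyfun (fun t => \prod_(i <- r | P i) F i t).
Proof.
move=> pF; elim: r => [|i r ih].
  by apply: (polyfun_eq _ (polyfun_cst n 1)) => t; rewrite big_nil.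
case: (boolP (P i)) => Pi; last first.
  by apply: polyfun_eq ih => t; rewrite big_cons (negPf Pi).
by apply: polyfun_eq (polyfunM (pF i Pi) ih) => t; rewrite big_cons Pi.
Qed.

Lemma polyfunX n (f : n.-tuple Rm -> R) k :
  polyfun f -> polyfun (fun t => f t ^+ k).
Proof.
move=> pf; elim: k => [|k ih].
  by apply: (polyfun_eq _ (polyfun_cst n 1)) => t; rewrite expr0.
by apply: polyfun_eq (polyfunM pf ih) => t; rewrite exprS.
Qed.

Lemma measurable_polyfun n (f : n.-tuple Rm -> R) :
  polyfun f -> measurable_fun setT (f : n.-tuple Rm -> Rm).
Proof.
elim=> {f} [c|i|f g _ mf _ mg|f g _ mf _ mg].
- exact: measurable_cst.
- exact: measurable_tnth.
- exact: measurable_funD.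
- exact: measurable_funM.
Qed.

(** Isolates the first variable for the induction in [null_polyfun]; the coefficients remain
    polynomial in the others because those of a product are convolutions. *)
Lemma polyfun_head n (f : n.+1.-tuple Rm -> R) : polyfun f ->
  exists P : n.-tuple Rm -> {poly R},
    (forall k, polyfun (fun t => (P t)`_k)) /\
    forall (x : Rm) (t : n.-tuple Rm), f [tuple of x :: t] = (P t).[x].
Proof.
elim=> {f} [c|i|f g _ + _ +|f g _ + _ +]; last 2 first.
- move=> [P [cP eP]] [Q [cQ eQ]].
  exists (fun t => P t + Q t); split=> [k|x t]; last by rewrite hornerD eP eQ.
  by apply: polyfun_eq (polyfunD (cP k) (cQ k)) => t; rewrite coefD.
- move=> [P [cP eP]] [Q [cQ eQ]].
  exists (fun t => P t * Q t); split=> [k|x t]; last by rewrite hornerM eP eQ.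
  apply: (@polyfun_eq _ (fun t => \sum_(j < k.+1) (P t)`_j * (Q t)`_(k - j))).
    by move=> t; rewrite coefM.
  by apply: polyfun_sum => i _; exact: polyfunM.
- exists (fun=> c%:P); split=> [k|x t]; last by rewrite hornerC.
  exact: polyfun_cst.
- case: (unliftP ord0 i) => [j ->|->].
    exists (fun t => (tnth t j)%:P); split=> [k|x t].
      have [->|k0] := eqVneq k 0%N.
        by apply: (polyfun_eq _ (polyfun_coord j)) => t; rewrite coefC.
      by apply: (polyfun_eq _ (polyfun_cst n 0)) => t; rewrite coefC (negPf k0).
    by rewrite hornerC tnthS.
  exists (fun=> 'X); split=> [k|x t]; first exact: polyfun_cst.
  by rewrite hornerX tnth0.
Qed.

(** The exhausting sets in dimension [n.+1] are products of those of the factors, pulled back along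
    the inverse [g] of consing. *)
Lemma lebesgue_tuple_sigma_finite n :
  exists m : {sigma_finite_measure set (n.-tuple Rm) -> \bar R},
    @lebesgue_tuple R n = m :> (set _ -> \bar R).
Proof.
elim: n => [|n [m em]].
  by exists (\d_([tuple] : 0.-tuple Rm)).
pose f (p : Rm * n.-tuple Rm) : n.+1.-tuple Rm := [tuple of p.1 :: p.2].
have mf : measurable_fun setT f by exact: measurable_cons.
pose nu : {measure set (n.+1.-tuple Rm) -> \bar R} :=
  measure_function_pushforward__canonical__measure_function_Measure
    (@lebesgue_measure R \x m)%E mf.
have sf : sigma_finite setT nu.
  have /sigma_finiteP[F [FT ndF mF]] := sigma_finiteT (@lebesgue_measure R).
  have /sigma_finiteP[G [GT ndG mG]] := sigma_finiteT m.
  pose g (t : n.+1.-tuple Rm) : Rm * n.-tuple Rm := (thead t, [tuple of behead t]).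
  have mg : measurable_fun setT g.
    apply/measurable_fun_pairP; split; last exact: measurable_behead.
    exact: (@measurable_tnth _ Rm n.+1 ord0).
  have fgK p : g (f p) = p.
    by case: p => x t; rewrite /g /f /= theadE; congr pair; apply: val_inj.
  exists (fun k => g @^-1` (F k `*` G k)).
    apply/esym; rewrite -preimage_bigcup -[RHS](preimage_setT g); congr (_ @^-1` _).
    rewrite -subTset => -[x t] _.
    have [i _ Fi] : (\bigcup_i F i) x by rewrite -FT.
    have [j _ Gj] : (\bigcup_i G i) t by rewrite -GT.
    exists (maxn i j) => //; split.
      by move: (x) Fi; exact/subsetPset/ndF/leq_maxl.
    by move: (t) Gj; exact/subsetPset/ndG/leq_maxr.
  move=> k; have [mFk Fk] := mF k; have [mGk Gk] := mG k; split.
    by rewrite -[X in measurable X]setTI; apply: mg => //; exact: measurableX.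
  rewrite /nu /= /pushforward -comp_preimage.
  rewrite (_ : g \o f = id); last by apply/funext.
  by rewrite preimage_id product_measure1E// lte_mul_pinfty// ge0_fin_numE.
have [nu' nuE] := sigma_finite_measureW sf.
by exists nu'; rewrite nuE /= em.
Qed.

(* By Fubini and induction on [n]: where some coefficient of the univariate polynomial
   in the first variable is nonzero, the slice of the zero set is finite. *)
Lemma null_polyfun n (f : n.-tuple Rm -> R) t0 : polyfun f -> f t0 != 0 ->
  (@lebesgue_tuple R n).-negligible [set t | f t = 0].
Proof.
elim: n f t0 => [|n ih] f t0 pf f0.
  have [m ->] := lebesgue_tuple_sigma_finite 0.
  exists set0; split => //.
  move=> t /= ft; move: f0; by rewrite (tuple0 t0) -(tuple0 t) ft eqxx.
have [P [cP eP]] := polyfun_head pf.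
have [k Pk0] : exists k, (P [tuple of behead t0])`_k != 0.
  apply: contrapT => /forallNP P0; move: f0.
  rewrite (tuple_eta t0) eP (_ : P _ = 0) ?horner0 ?eqxx//.
  by apply/polyP => k; rewrite coef0; apply/eqP/negP => /negP /P0.
have [m em] := lebesgue_tuple_sigma_finite n.
have [Z [mZ Z0 PZ]] := ih _ _ (cP k) Pk0.
have mB : measurable [set t | f t = 0].
  rewrite -[X in measurable X]setTI.
  exact: (measurable_polyfun pf) measurableT _ (measurable_set1 0).
pose B := [set p : Rm * n.-tuple Rm | f [tuple of p.1 :: p.2] = 0].
have mB' : measurable B.
  have := @measurable_cons _ _ (Rm * n.-tuple Rm)%type Rm fst n snd
    measurable_fst measurable_snd measurableT _ mB.
  by rewrite setTI.
exists [set t | f t = 0]; split => //.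
rewrite /= /pushforward -/B em.
(* The slices to be shown null fix the tail and vary the first variable; this form of the product
   measure integrates exactly those. *)
have <- : (@lebesgue_measure R \x^ m)%E B = (@lebesgue_measure R \x m)%E B.
  apply: esym; apply: product_measure_unique => //= A1 A2 mA1 mA2.
  by rewrite product_measure2E.
rewrite /product_measure2 -(@integral0 _ _ _ m setT).
apply: ge0_ae_eq_integral => //=.
  exact: measurable_fun_ysection.
exists Z; split => //; first by rewrite -em.
move=> t /= /not_implyP[_ /eqP Bt]; apply: PZ => /=.
apply: contrapT => Pt0; move/eqP : Bt; apply.
apply: countable_lebesgue_measure0; apply: finite_set_countable.
have Pt : P t != 0 by apply: contra_notN Pt0 => /eqP ->; rewrite coef0.
apply: contrapT => /(infinite_set_fset (size (P t)))[C CB].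
apply/negP; rewrite -ltnNge; apply: max_poly_roots => //; last exact: finmap.fset_uniq.
apply/allP => x /CB /=; rewrite /ysection /= inE /B /= eP => /eqP.
by rewrite rootE.
Qed.

End PolynomialZeroSets.

(** * Matrix-valued functions and linear differential equations *)

Section MatrixCalculus.
Context {R : realType}.

(** Entrywise, so that every matrix rule reduces to a rule for real functions; [is_dmxP] links it to
    the derivative in the normed space of matrices. *)
Definition is_dmx {m n} (M : R -> 'M[R]_(m, n)) (t : R) (dM : 'M[R]_(m, n)) :=
  forall i j, is_derive t (1 : R) (fun x => M x i j) (dM i j).

Lemma is_dmxP m n (M : R -> 'M[R]_(m, n)) t dM :
  is_derive t (1 : R) M dM <-> is_dmx M t dM.
Proof.
split=> [[dMt <-] i j|dMt].
  rewrite derive_mx// mxE; apply: DeriveDef => //.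
  by move/derivable_mxP : dMt; exact.
have dM' : derivable M t 1.
  by apply/derivable_mxP => i j; have [] := dMt i j.
apply: DeriveDef => //; rewrite derive_mx//; apply/matrixP => i j.
by rewrite mxE; have [] := dMt i j.
Qed.

Lemma is_derive_cst1 (c t : R) : is_derive t (1 : R) (fun=> c) 0.
Proof. exact: is_derive_cst. Qed.

Lemma is_derive_ext (f g : R -> R) (t d : R) :
  f =1 g -> is_derive t (1 : R) f d -> is_derive t (1 : R) g d.
Proof. by move=> /funext ->. Qed.

Lemma is_derive_mul (f g : R -> R) (t df dg : R) :
  is_derive t (1 : R) f df -> is_derive t (1 : R) g dg ->
  is_derive t (1 : R) (fun x => f x * g x) (df * g t + f t * dg).
Proof.
move=> hf hg; have := is_deriveM hf hg.
by rewrite -![_ *: _]/(_ * _) [g t * df]mulrC addrC.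
Qed.

Lemma is_derive_bigsum (I : Type) (r : seq I) (P : pred I) (F : I -> R -> R)
    (dF : I -> R) t : (forall i, P i -> is_derive t (1 : R) (F i) (dF i)) ->
  is_derive t (1 : R) (fun x => \sum_(i <- r | P i) F i x) (\sum_(i <- r | P i) dF i).
Proof.
move=> hF; elim: r => [|i r ih].
  rewrite big_nil; apply: (@is_derive_ext (fun=> 0)).
  by move=> x; rewrite big_nil.
rewrite big_cons; case: ifPn => Pi; last first.
  by apply: is_derive_ext ih => x; rewrite big_cons (negPf Pi).
apply: is_derive_ext (is_deriveD (hF i Pi) ih) => x.
by rewrite big_cons Pi.
Qed.

Lemma is_dmx_ext m n (M M' : R -> 'M[R]_(m, n)) t dM :
  M =1 M' -> is_dmx M t dM -> is_dmx M' t dM.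
Proof. by move=> /funext ->. Qed.

Lemma is_dmx_near m n (M M' : R -> 'M[R]_(m, n)) t dM :
  (\forall x \near t, M x = M' x) -> is_dmx M t dM -> is_dmx M' t dM.
Proof.
move=> MM' dMt i j; apply: near_eq_is_derive (dMt i j).
by apply: filterS MM' => x ->.
Qed.

Lemma is_dmx_cst m n (M : 'M[R]_(m, n)) t : is_dmx (fun=> M) t 0.
Proof. by move=> i j; rewrite mxE; exact: is_derive_cst1. Qed.

Lemma is_dmxD m n (A B : R -> 'M[R]_(m, n)) t dA dB :
  is_dmx A t dA -> is_dmx B t dB -> is_dmx (fun x => A x + B x) t (dA + dB).
Proof.
move=> hA hB i j; rewrite mxE.
by apply: is_derive_ext (is_deriveD (hA i j) (hB i j)) => x; rewrite mxE.
Qed.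

Lemma is_dmxN m n (A : R -> 'M[R]_(m, n)) t dA :
  is_dmx A t dA -> is_dmx (fun x => - A x) t (- dA).
Proof.
move=> hA i j; rewrite mxE.
by apply: is_derive_ext (is_deriveN (hA i j)) => x; rewrite mxE.
Qed.

Lemma is_dmxB m n (A B : R -> 'M[R]_(m, n)) t dA dB :
  is_dmx A t dA -> is_dmx B t dB -> is_dmx (fun x => A x - B x) t (dA - dB).
Proof. by move=> hA hB; apply: is_dmxD => //; exact: is_dmxN. Qed.

Lemma is_dmxZ m n (f : R -> R) (A : R -> 'M[R]_(m, n)) t df dA :
  is_derive t (1 : R) f df -> is_dmx A t dA ->
  is_dmx (fun x => f x *: A x) t (df *: A t + f t *: dA).
Proof.
move=> hf hA i j; rewrite !mxE.
by apply: is_derive_ext (is_derive_mul hf (hA i j)) => x; rewrite mxE.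
Qed.

Lemma is_dmxM m n p (A : R -> 'M[R]_(m, n)) (B : R -> 'M[R]_(n, p)) t dA dB :
  is_dmx A t dA -> is_dmx B t dB ->
  is_dmx (fun x => A x *m B x) t (dA *m B t + A t *m dB).
Proof.
move=> hA hB i j; rewrite !mxE -big_split/=.
have := @is_derive_bigsum _ (index_enum 'I_n) xpredT _ _ t
  (fun k _ => is_derive_mul (hA i k) (hB k j)).
by apply: is_derive_ext => x; rewrite mxE.
Qed.

Lemma is_dmxMl m n p (A : 'M[R]_(m, n)) (B : R -> 'M[R]_(n, p)) t dB :
  is_dmx B t dB -> is_dmx (fun x => A *m B x) t (A *m dB).
Proof. by move=> /(is_dmxM (is_dmx_cst A t)); rewrite mul0mx add0r. Qed.

Lemma is_dmxMr m n p (A : R -> 'M[R]_(m, n)) (B : 'M[R]_(n, p)) t dA :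
  is_dmx A t dA -> is_dmx (fun x => A x *m B) t (dA *m B).
Proof. by move=> h; have := is_dmxM h (is_dmx_cst B t); rewrite mulmx0 addr0. Qed.

Lemma is_dmx_tr m n (A : R -> 'M[R]_(m, n)) t dA :
  is_dmx A t dA -> is_dmx (fun x => (A x)^T) t dA^T.
Proof.
by move=> hA i j; rewrite mxE; apply: is_derive_ext (hA j i) => x; rewrite mxE.
Qed.

Lemma is_dmx_block m1 m2 n1 n2 (A : R -> 'M[R]_(m1, n1)) (B : R -> 'M[R]_(m1, n2))
    (C : R -> 'M[R]_(m2, n1)) (D : R -> 'M[R]_(m2, n2)) t dA dB dC dD :
  is_dmx A t dA -> is_dmx B t dB -> is_dmx C t dC -> is_dmx D t dD ->
  is_dmx (fun x => block_mx (A x) (B x) (C x) (D x)) t (block_mx dA dB dC dD).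
Proof.
move=> hA hB hC hD i j.
case: (split_ordP i) => i' ->; case: (split_ordP j) => j' ->.
- by rewrite block_mxEul; apply: is_derive_ext (hA i' j') => x; rewrite block_mxEul.
- by rewrite block_mxEur; apply: is_derive_ext (hB i' j') => x; rewrite block_mxEur.
- by rewrite block_mxEdl; apply: is_derive_ext (hC i' j') => x; rewrite block_mxEdl.
- by rewrite block_mxEdr; apply: is_derive_ext (hD i' j') => x; rewrite block_mxEdr.
Qed.

Lemma is_dmx_col m1 m2 n (A : R -> 'M[R]_(m1, n)) (B : R -> 'M[R]_(m2, n)) t dA dB :
  is_dmx A t dA -> is_dmx B t dB ->
  is_dmx (fun x => col_mx (A x) (B x)) t (col_mx dA dB).
Proof.
move=> hA hB i j; case: (split_ordP i) => i' ->.
- by rewrite col_mxEu; apply: is_derive_ext (hA i' j) => x; rewrite col_mxEu.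
- by rewrite col_mxEd; apply: is_derive_ext (hB i' j) => x; rewrite col_mxEd.
Qed.

Lemma is_dmx_ulsub m1 m2 n1 n2 (A : R -> 'M[R]_(m1 + m2, n1 + n2)) t dA :
  is_dmx A t dA -> is_dmx (fun x => ulsubmx (A x)) t (ulsubmx dA).
Proof.
by move=> hA i j; rewrite !mxE; apply: is_derive_ext (hA _ _) => x; rewrite !mxE.
Qed.

Lemma is_dmx_ursub m1 m2 n1 n2 (A : R -> 'M[R]_(m1 + m2, n1 + n2)) t dA :
  is_dmx A t dA -> is_dmx (fun x => ursubmx (A x)) t (ursubmx dA).
Proof.
by move=> hA i j; rewrite !mxE; apply: is_derive_ext (hA _ _) => x; rewrite !mxE.
Qed.

Lemma is_dmx_dsub m1 m2 n (A : R -> 'M[R]_(m1 + m2, n)) t dA :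
  is_dmx A t dA -> is_dmx (fun x => dsubmx (A x)) t (dsubmx dA).
Proof.
by move=> hA i j; rewrite !mxE; apply: is_derive_ext (hA _ _) => x; rewrite !mxE.
Qed.

Lemma is_dmx_affine m n (A : R -> 'M[R]_(m, n)) (a b t : R) dA :
  is_dmx A (a + t * b) dA -> is_dmx (fun x => A (a + x * b)) t (b *: dA).
Proof.
move=> hA i j; rewrite mxE mulrC.
apply: (@is_derive1_comp _ (fun x => A x i j) (fun x => a + x * b)).
  exact: hA.
have := is_deriveD (is_derive_cst1 a t) (is_derive_mul (is_derive_id t 1)
  (is_derive_cst1 b t)).
by rewrite mulr0 addr0 mul1r add0r.
Qed.

Lemma is_dmx_unique m n (A : R -> 'M[R]_(m, n)) t d1 d2 :
  is_dmx A t d1 -> is_dmx A t d2 -> d1 = d2.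
Proof. by move=> h1 h2; apply/matrixP => i j; have [_ <-] := h1 i j; have [_ <-] := h2 i j. Qed.

Lemma is_derive_prod (I : Type) (r : seq I) (F : I -> R -> R) t :
  (forall i, derivable (F i) t 1) -> derivable (fun x => \prod_(i <- r) F i x) t 1.
Proof.
move=> hF; elim: r => [|i r ih].
  by under [X in derivable X]funext do rewrite big_nil; exact: derivable_cst.
under [X in derivable X]funext do rewrite big_cons.
exact: derivableM.
Qed.

Lemma derivable_bigsum (I : Type) (r : seq I) (F : I -> R -> R) t :
  (forall i, derivable (F i) t 1) -> derivable (fun x => \sum_(i <- r) F i x) t 1.
Proof.
move=> hF; elim: r => [|i r ih].
  by under [X in derivable X]funext do rewrite big_nil; exact: derivable_cst.
under [X in derivable X]funext do rewrite big_cons.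
exact: derivableD.
Qed.

Lemma derivable_det n (A : R -> 'M[R]_n) t :
  (forall i j, derivable (fun x => A x i j) t 1) ->
  derivable (fun x => \det (A x)) t 1.
Proof.
move=> hA; rewrite /determinant; apply: derivable_bigsum => s.
by apply: derivableM; [exact: derivable_cst|apply: is_derive_prod].
Qed.

Lemma derivable_invmx n (A : R -> 'M[R]_n) t :
  (forall x, A x \in unitmx) -> (forall i j, derivable (fun x => A x i j) t 1) ->
  forall i j, derivable (fun x => invmx (A x) i j) t 1.
Proof.
move=> uA hA i j.
have -> : (fun x => invmx (A x) i j) =
    (fun x => (\det (A x))^-1 * cofactor (A x) j i).
  by apply/funext => x; rewrite /invmx uA !mxE.
apply: derivableM.
  apply: derivableV; last exact: derivable_det.
  by have := uA t; rewrite unitmxE unitfE.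
apply: derivableM; first exact: derivable_cst.
apply: derivable_det => k l.
by under [X in derivable X]funext do rewrite !mxE; exact: hA.
Qed.

(** Cramer's formula gives differentiability; the value then follows by differentiating
    [invmx (A x) *m A x = 1]. *)
Lemma is_dmx_inv n (A : R -> 'M[R]_n) t dA : (forall x, A x \in unitmx) ->
  is_dmx A t dA -> is_dmx (fun x => invmx (A x)) t
    (- (invmx (A t) *m dA *m invmx (A t))).
Proof.
move=> uA hA.
have dA' i j : derivable (fun x => A x i j) t 1 by have [] := hA i j.
pose dI := \matrix_(i, j) 'D_1 (fun x => invmx (A x) i j) t.
have hI : is_dmx (fun x => invmx (A x)) t dI.
  by move=> i j; rewrite mxE; apply/derivableP/derivable_invmx.
suff <- : dI = - (invmx (A t) *m dA *m invmx (A t)) by [].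
have h1 : is_dmx (fun x => invmx (A x) *m A x) t 0.
  apply: (is_dmx_ext _ (is_dmx_cst 1%:M t)) => x.
  by rewrite mulVmx.
have := is_dmx_unique (is_dmxM hI hA) h1.
move/(congr1 (fun B => B *m invmx (A t))).
rewrite mul0mx mulmxDl mulmxK//= => /eqP.
by rewrite addr_eq0 => /eqP.
Qed.

End MatrixCalculus.

(** * Linear systems by Picard iteration *)

Section LinearODE.
Context {R : realType}.

Lemma lipschitz_continuous (f : R -> R) (a b t : R) :
  lipschitz_itv a b f -> a < t < b -> {for t, continuous f}.
Proof.
move=> [L L0 fL] /andP[at_ tb]; apply/cvgrPdist_le => e e0.
have at0 : 0 < t - a by rewrite subr_gt0.
have bt0 : 0 < b - t by rewrite subr_gt0.
near=> y; have yta : `|y - t| < t - a by near: y; exact: near_dist_lt.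
have ytb : `|y - t| < b - t by near: y; exact: near_dist_lt.
have yte : `|y - t| < e / L by near: y; apply: near_dist_lt; exact: divr_gt0.
rewrite distrC; apply: (le_trans (fL t y _ _)).
- by rewrite !ltW.
- move: yta ytb; rewrite !ltr_norml => /andP[? ?] /andP[? ?].
  by apply/andP; split; lra.
- by rewrite mulrC -ler_pdivlMr// ltW.
Unshelve. all: by end_near. Qed.

Lemma continuous_bigsum (I : Type) (r : seq I) (F : I -> R -> R) t :
  (forall i, {for t, continuous (F i)}) ->
  {for t, continuous (fun x => \sum_(i <- r) F i x)}.
Proof.
move=> hF; elim: r => [|i r ih].
  by under [X in {for _, continuous X}]funext do rewrite big_nil; exact: cst_continuous.
under [X in {for _, continuous X}]funext do rewrite big_cons.
by apply: cvgD; [exact: hF|exact: ih].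
Qed.

Lemma continuous_mulmx n m p (A : R -> 'M[R]_(n, m)) (B : R -> 'M[R]_(m, p)) t :
  (forall i j, {for t, continuous (fun x => A x i j)}) ->
  (forall i j, {for t, continuous (fun x => B x i j)}) ->
  forall i j, {for t, continuous (fun x => (A x *m B x) i j)}.
Proof.
move=> cA cB i j; under [X in {for _, continuous X}]funext do rewrite mxE.
by apply: continuous_bigsum => k; apply: cvgM; [exact: cA|exact: cB].
Qed.

Lemma is_dmx_continuous n m (A : R -> 'M[R]_(n, m)) t dA : is_dmx A t dA ->
  forall i j, {for t, continuous (fun x => A x i j)}.
Proof.
move=> hA i j; apply: differentiable_continuous; apply/derivable1_diffP.
by have [] := hA i j.
Qed.

Lemma continuous_bounded01 (f : R -> R) : (forall t, {for t, continuous f}) ->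
  exists2 C, 0 < C & forall x, 0 <= x <= 1 -> `|f x| <= C.
Proof.
move=> cf; have cf' : {within `[0, 1], continuous (fun x => `|f x|)}.
  by apply: continuous_subspaceT => x; apply: cvg_norm; exact: cf.
have [c _ fc] := EVT_max (@ler01 R) cf'.
exists (`|f c| + 1) => [|x x01]; first by rewrite ltr_wpDl.
have : x \in `[0, 1] by rewrite in_itv.
by move/fc => h; rewrite (le_trans h)// lerDl.
Qed.

Lemma continuous_mx_bounded01 n m (A : R -> 'M[R]_(n, m)) :
  (forall i j t, {for t, continuous (fun x => A x i j)}) ->
  exists2 C, 0 < C & forall x i j, 0 <= x <= 1 -> `|A x i j| <= C.
Proof.
move=> cA; pose f x := \sum_i \sum_j `|A x i j|.
have cf t : {for t, continuous f}.
  apply: continuous_bigsum => i; apply: continuous_bigsum => j.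
  by apply: cvg_norm; exact: cA.
have [C C0 fC] := continuous_bounded01 cf; exists C => // x i j /fC.
rewrite ger0_norm; last by apply: sumr_ge0 => *; apply: sumr_ge0.
apply: le_trans; rewrite /f (bigD1 i)//= (bigD1 j)//= -addrA lerDl.
by rewrite addr_ge0//; apply: sumr_ge0 => // *; apply: sumr_ge0.
Qed.

Lemma mulmx_entry_le n m p (A : 'M[R]_(n, m)) (B : 'M[R]_(m, p)) a b i j :
  (forall i j, `|A i j| <= a) -> (forall i j, `|B i j| <= b) ->
  `|(A *m B) i j| <= m%:R * (a * b).
Proof.
move=> hA hB; rewrite mxE (le_trans (ler_norm_sum _ _ _))//.
rewrite (_ : m%:R * (a * b) = \sum_(k < m) (a * b)); last first.
  by rewrite sumr_const card_ord mulr_natl.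
by apply: ler_sum => k _; rewrite normrM ler_pM.
Qed.

Lemma norm_lim_le (u : R ^nat) (l v b : R) : u @ \oo --> l ->
  (\forall m \near \oo, `|u m - v| <= b) -> `|l - v| <= b.
Proof.
move=> ul uvb; apply/ler_addgt0Pr => e e0.
have /cvgrPdist_le /(_ _ e0) uln := ul.
near \oo => m.
have h1 : `|l - u m| <= e by near: m; exact: uln.
have h2 : `|u m - v| <= b by near: m; exact: uvb.
by have := ler_normD (l - u m) (u m - v); rewrite addrA subrK; lra.
Unshelve. all: by end_near. Qed.

(* The solution is the sum of the Picard series, whose general term [D k] satisfies
   [|D k t| <= 2^-k expR (L t)] with [L] twice a bound for the operator norm. *)
Theorem linear_ode n (Om : R -> 'M[R]_n) :
  (forall i j t, {for t, continuous (fun x => Om x i j)}) ->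
  exists X : R -> 'M[R]_n, [/\ X 0 = 1%:M,
    forall i j, lipschitz_itv 0 1 (fun t => X t i j) &
    forall t, 0 < t < 1 -> is_dmx X t (X t *m Om t)].
Proof.
move=> cOm; have [C C0 OmC] := continuous_mx_bounded01 cOm.
pose cont (Y : R -> 'M[R]_n) := forall i j t, {for t, continuous (fun x => Y x i j)}.
have step (Y : {Y | cont Y}) : {Z : {Z | cont Z} |
    sval Z 0 = 0 /\ forall t, is_dmx (sval Z) t (sval Y t *m Om t)}.
  apply: cid; case: Y => Y cY /=.
  have prim i j : {F : R -> R | F 0 = 0 /\
      forall t, is_derive t (1 : R) F ((Y t *m Om t) i j)}.
    apply: cid; have [|F F0 dF] := @continuous_primitive R (fun t => (Y t *m Om t) i j).
      by move=> t; apply: continuous_mulmx => k l; [exact: cY|exact: cOm].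
    by exists F.
  pose Z t := \matrix_(i, j) sval (prim i j) t.
  have dZ t : is_dmx Z t (Y t *m Om t).
    move=> i j; have [_ /(_ t)] := svalP (prim i j).
    by apply: is_derive_ext => x; rewrite mxE.
  have cZ : cont Z by move=> i j t; exact: is_dmx_continuous (dZ t) i j.
  exists (exist _ Z cZ); split => //=; apply/matrixP => i j.
  by rewrite !mxE; have [] := svalP (prim i j).
have c1 : cont (fun=> 1%:M) by move=> i j t; exact: cst_continuous.
pose P k := iter k (fun Y => sval (step Y)) (exist _ _ c1).
pose D k : R -> 'M[R]_n := sval (P k).
have D0 t : D 0%N t = 1%:M by [].
have DS0 k : D k.+1 0 = 0 by have [] := svalP (step (P k)).
have dD k t : is_dmx (D k.+1) t (D k t *m Om t).
  by have [_] := svalP (step (P k)).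
clearbody D => {P step c1 cont}.
pose L := n%:R * C * 2.
have L0 : 0 <= L by rewrite !mulr_ge0// ltW.
pose h k (t : R) := 2^-1 ^+ k * expR (L * t) : R.
have h0 k t : 0 <= h k t by rewrite mulr_ge0 ?exprn_ge0 ?expR_ge0// invr_ge0.
have dh k t : is_derive t (1 : R) (h k) (L * h k t).
  have h1 : is_derive t (1 : R) (fun x => L * x) L.
    apply: (trigger_derive (is_derive_mul (is_derive_cst1 L t) (is_derive_id t 1))).
    by rewrite mul0r add0r mulr1.
  have h2 := @is_derive1_comp _ expR (fun x => L * x) t _ _ (is_derive_expR _) h1.
  apply: (trigger_derive (is_derive_mul (is_derive_cst1 (2^-1 ^+ k) t) h2)).
  by rewrite mul0r add0r /h [expR _ * L]mulrC mulrCA.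
have Dh k : forall t i j, 0 <= t <= 1 -> `|D k t i j| <= h k t.
  elim: k => [|k ih] t i j /andP[t0 t1].
    rewrite D0 /h expr0 mul1r mxE; apply: (@le_trans _ _ 1).
      by case: (i == j); rewrite ?normr1 ?normr0.
    by rewrite -expR0 ler_expR mulr_ge0.
  apply: (@norm_le_derive _ (fun x => D k.+1 x i j) (fun x => (D k x *m Om x) i j)
    (h k.+1) (fun x => L * h k.+1 x) t t0) => //.
  - by rewrite DS0 mxE.
  - by move=> z _; exact: dD.
  - move=> z /andP[z0 zt]; have z01 : 0 <= z <= 1 by rewrite z0 (le_trans zt).
    apply: (@le_trans _ _ (n%:R * (h k z * C))).
      by apply: mulmx_entry_le => i' j'; [exact: ih|exact: OmC].
    by rewrite /h /L exprS le_eqVlt; apply/orP; left; apply/eqP; field.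
pose E := expR L; have E0 : 0 < E by exact: expR_gt0.
have hE k t : t <= 1 -> h k t <= 2^-1 ^+ k * E.
  move=> t1; rewrite ler_wpM2l ?exprn_ge0 ?invr_ge0// ler_expR.
  by rewrite -[leRHS]mulr1 ler_wpM2l.
pose S m t : 'M[R]_n := \sum_(k < m) D k t.
(* The difference of powers, rather than [2^-1 ^+ m] alone, is what closes the induction on [p]: it
   telescopes. *)
have Sdist m p t i j : 0 <= t <= 1 ->
    `|S (m + p)%N t i j - S m t i j| <= 2 * E * (2^-1 ^+ m - 2^-1 ^+ (m + p)).
  move=> t01; elim: p => [|p ih]; first by rewrite addn0 !subrr normr0 mulr0.
  rewrite addnS /S big_ord_recr /= -/(S _ _) mxE addrAC.
  apply: (le_trans (ler_normD _ _)).
  have t1 : t <= 1 by case/andP: t01.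
  have := le_trans (Dh (m + p)%N t i j t01) (hE _ _ t1).
  move: ih; rewrite exprS; set q := _ ^+ (m + p); lra.
have S0 t i j : S 0%N t i j = 0 by rewrite /S big_ord0 mxE.
have Scvg t i j : 0 <= t <= 1 -> cvgn (fun m => S m t i j).
  move=> /[dup] t01 /andP[_ t1].
  have -> : (fun m => S m t i j) = series (fun k => D k t i j).
    by apply/funext => m; rewrite /S summxE /series /= big_mkord.
  apply: normed_cvg; apply: (@series_le_cvg _ _ (geometric E 2^-1)) => [k|k|k|] //=.
  - by rewrite mulr_ge0 ?exprn_ge0 ?invr_ge0// ltW.
  - by rewrite mulrC (le_trans (Dh _ _ _ _ t01))// hE.
  - by apply: is_cvg_geometric_series; rewrite ger0_norm ?invr_ge0// invf_lt1// ltr1n.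
(* The bound [C] holds only on [0, 1]; outside, [X] takes the default value 0, which derivatives at
   interior times do not see. *)
pose X t : 'M[R]_n := \matrix_(i, j)
  if (0 <= t <= 1) then limn (fun m => S m t i j) else 0.
have SX t i j : 0 <= t <= 1 -> (fun m => S m t i j) @ \oo --> X t i j.
  by move=> t01; rewrite mxE t01; exact: Scvg.
have XS m t i j : 0 <= t <= 1 -> `|X t i j - S m t i j| <= 2 * E * 2^-1 ^+ m.
  move=> t01; apply: norm_lim_le (SX t i j t01) _.
  near=> k; have mk : (m <= k)%N by near: k; exact: nbhs_infty_ge.
  rewrite -(subnKC mk); apply: le_trans (Sdist _ _ _ _ _ t01) _.
  rewrite ler_wpM2l//; first by rewrite mulr_ge0// ltW.
  by rewrite gerBl exprn_ge0// invr_ge0.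
have dS m t : is_dmx (S m.+1) t (S m t *m Om t).
  move=> i j; rewrite /S mulmx_suml summxE.
  have dDk (k : 'I_m) (_ : true) := dD k t i j.
  have := is_deriveD (is_derive_cst1 ((1%:M : 'M[R]_n) i j) t)
    (is_derive_bigsum (index_enum 'I_m) dDk).
  move/trigger_derive => /(_ _ (add0r _)); apply: is_derive_ext => x.
  by rewrite big_ord_recl [RHS]mxE summxE D0.
have S2E m t i j : 0 <= t <= 1 -> `|S m t i j| <= 2 * E.
  move=> t01; have := Sdist 0%N m t i j t01; rewrite S0 subr0 add0n => /le_trans; apply.
  rewrite -[leRHS]mulr1 ler_wpM2l//; first by rewrite mulr_ge0// ltW.
  by rewrite expr0 gerBl exprn_ge0// invr_ge0.
have XL i j : lipschitz_itv 0 1 (fun t => X t i j).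
  pose B := n%:R * (2 * E * C) + 1.
  have B0 : 0 < B by rewrite ltr_wpDl// !mulr_ge0// ltW.
  exists B => // x y x01 y01.
  wlog xy : x y x01 y01 / x <= y.
    move=> h'; have [/h'|/ltW /h'] := leP x y; first exact.
    by rewrite distrC (distrC x); exact.
  rewrite -[X y i j]addr0 -(subrr (X x i j)) addrA -addrA.
  have SB m : `|S m.+1 y i j - S m.+1 x i j| <= B * `|y - x|.
    have [z xz ->] := mean_value xy (fun z _ => dS m z i j).
    rewrite normrM ler_wpM2r//; have z01 : 0 <= z <= 1.
      by move: x01 y01 xz => /andP[? ?] /andP[? ?] /andP[? ?]; apply/andP; split; lra.
    apply: (@le_trans _ _ (n%:R * (2 * E * C))); last by rewrite /B lerDl.
    by apply: mulmx_entry_le => k l; [exact: S2E|exact: OmC].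
  have cSS : (fun m => S m.+1 y i j - S m.+1 x i j) @ \oo --> X y i j - X x i j.
    by apply: cvgB; [have := SX y i j y01|have := SX x i j x01]; rewrite -cvg_shiftS.
  rewrite addrA addrK -[X y i j - _]subr0; apply: norm_lim_le cSS _.
  by near=> m; rewrite subr0; exact: SB.
exists X; split => //.
  apply/matrixP => i j.
  have z01 : (0 : R) <= 0 <= (1 : R) by rewrite lexx /= ler01.
  have S1 : (fun m => S m.+1 0 i j) = fun=> (1%:M : 'M[R]_n) i j.
    apply/funext => m; rewrite /S big_ord_recl [LHS]mxE summxE D0.
    by rewrite big1 ?addr0// => k _; rewrite DS0 mxE.
  have := SX 0 i j z01; rewrite -cvg_shiftS S1 => /cvg_lim <- //.
  exact: lim_cst.
move=> t t01 i j.
apply: (@is_derive_uniform_limit _ (fun m x => S m.+1 x i j)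
  (fun m x => (S m x *m Om x) i j) _ (fun x => (X x *m Om x) i j) 0 1) => //.
- by move=> m x _; exact: dS.
- move=> x x01; by have := SX x i j x01; rewrite -cvg_shiftS.
- move=> e e0; have n1 : `|2^-1 : R| < 1.
    by rewrite ger0_norm ?invr_ge0// invf_lt1// ltr1n.
  have /cvgrPdist_le /(_ _ e0) [m0 _ hm0] :=
    @cvg_geometric R (n%:R * (2 * E * C)) _ n1.
  exists m0 => m x m0m x01; have := hm0 m m0m.
  rewrite sub0r normrN /= ger0_norm; last first.
    by rewrite !mulr_ge0 ?exprn_ge0 ?invr_ge0// ltW.
  apply: le_trans; rewrite distrC.
  have -> : (X x *m Om x) i j - (S m x *m Om x) i j = ((X x - S m x) *m Om x) i j.
    by rewrite mulmxBl [RHS]mxE [X in _ = _ + X]mxE.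
  apply: (@le_trans _ _ (n%:R * (2 * E * 2^-1 ^+ m * C))).
    apply: mulmx_entry_le => k l; last exact: OmC.
    have -> : (X x - S m x) k l = X x k l - S m x k l.
      by rewrite [LHS]mxE [X in _ + X]mxE.
    exact: XS.
  by rewrite le_eqVlt; apply/orP; left; apply/eqP; ring.
- apply: continuous_mulmx => k l; last exact: cOm.
  exact: lipschitz_continuous (XL k l) t01.
Unshelve. all: by end_near. Qed.

End LinearODE.

(** * Rotations of three-dimensional space *)

Section Vec3.
Context {R : realType}.
Implicit Types (a b c u v w x y z : 'cV[R]_3) (P Q A B : 'M[R]_3).

Lemma ord3P (p : 'I_3 -> Prop) : p 0 -> p 1 -> p 2 -> forall i, p i.
Proof.
move=> p0 p1 p2 [[|[|[|//]]] hi].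
- by have -> : Ordinal hi = 0 by exact: val_inj.
- by have -> : Ordinal hi = 1 by exact: val_inj.
- by have -> : Ordinal hi = 2 by exact: val_inj.
Qed.

Lemma sum3 (V : nmodType) (F : 'I_3 -> V) : \sum_i F i = F 0 + F 1 + F 2.
Proof.
rewrite !big_ord_recl big_ord0 addr0 addrA.
have -> : lift ord0 ord0 = 1 :> 'I_3 by exact: val_inj.
by have -> : lift ord0 (lift ord0 ord0) = 2 :> 'I_3 by exact: val_inj.
Qed.

Lemma idx3 : let i0 : 'I_3 := 0 in let i1 : 'I_3 := 1 in let i2 : 'I_3 := 2 in
  ((i0 + 1 = i1)%R * (i0 + 2 = i2)%R * (i1 + 1 = i2)%R * (i1 + 2 = i0)%R *
  (i2 + 1 = i0)%R * (i2 + 2 = i1)%R)%type.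
Proof. by do !split; apply: val_inj. Qed.

Lemma eq3 : let i0 : 'I_3 := 0 in let i1 : 'I_3 := 1 in let i2 : 'I_3 := 2 in
  (((i0 == i1) = false) * ((i0 == i2) = false) * ((i1 == i0) = false) *
  ((i1 == i2) = false) * ((i2 == i0) = false) * ((i2 == i1) = false))%type.
Proof. by []. Qed.

Definition dot a b : R := a 0 0 * b 0 0 + a 1 0 * b 1 0 + a 2 0 * b 2 0.

Lemma dotE a b : (a^T *m b) 0 0 = dot a b.
Proof. by rewrite mxE sum3 !mxE. Qed.

Lemma vec3E (p q r : R) : ((vec3 p q r 0 0 = p) * (vec3 p q r 1 0 = q) *
  (vec3 p q r 2 0 = r))%type.
Proof. by rewrite !mxE. Qed.

Lemma crossE a b : ((cross a b 0 0 = a 1 0 * b 2 0 - a 2 0 * b 1 0) *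
  (cross a b 1 0 = a 2 0 * b 0 0 - a 0 0 * b 2 0) *
  (cross a b 2 0 = a 0 0 * b 1 0 - a 1 0 * b 0 0))%type.
Proof. by rewrite !mxE !idx3. Qed.

Lemma cross_mx_entry a : ((cross_mx a 0 0 = 0) * (cross_mx a 0 1 = - a 2 0) *
  (cross_mx a 0 2 = a 1 0) * (cross_mx a 1 0 = a 2 0) * (cross_mx a 1 1 = 0) *
  (cross_mx a 1 2 = - a 0 0) * (cross_mx a 2 0 = - a 1 0) *
  (cross_mx a 2 1 = a 0 0) * (cross_mx a 2 2 = 0))%type.
Proof.
by do !split; rewrite [LHS]mxE crossE !mxE !eqxx !eq3 /= ?mulr0 ?mulr1 ?subr0 ?sub0r.
Qed.

Lemma tensorE a b i j : tensor a b i j = a i 0 * b j 0.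
Proof. by rewrite mxE big_ord1 mxE. Qed.

Lemma col3P a b : a 0 0 = b 0 0 -> a 1 0 = b 1 0 -> a 2 0 = b 2 0 -> a = b.
Proof. by move=> *; apply/matrixP => i j; rewrite ord1; move: i; exact: ord3P. Qed.

Lemma mx3P A B : (forall j, [/\ A 0 j = B 0 j, A 1 j = B 1 j & A 2 j = B 2 j]) -> A = B.
Proof. by move=> h; apply/matrixP => i j; have [] := h j; move: i; exact: ord3P. Qed.

End Vec3.

Ltac vec3 := apply: col3P;
  rewrite ?(crossE, cross_mx_entry, tensorE, mxE, sum3, vec3E, eqxx, eq3); rewrite /dot /= ?mulr1n ?mulr0n; ring.
Ltac mat3 := apply: mx3P; elim/ord3P; split;
  rewrite ?(crossE, cross_mx_entry, tensorE, mxE, sum3, vec3E, eqxx, eq3); rewrite /dot /= ?mulr1n ?mulr0n; ring.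

Section Rotations.
Context {R : realType}.
Implicit Types (a b c u v w x y z : 'cV[R]_3) (P Q A B : 'M[R]_3).

Definition SO3 P := P^T *m P = 1%:M /\ \det P = 1.

Lemma det3 A : \det A = A 0 0 * (A 1 1 * A 2 2 - A 1 2 * A 2 1)
  - A 0 1 * (A 1 0 * A 2 2 - A 1 2 * A 2 0) + A 0 2 * (A 1 0 * A 2 1 - A 1 1 * A 2 0).
Proof.
rewrite (expand_det_row _ 0) sum3 /cofactor !(expand_det_row _ 0).
rewrite !big_ord_recl !big_ord0 /cofactor !det_mx11 !mxE /=.
pose F m n := A (inord m) (inord n).
have AE (i j : 'I_3) : A i j = F i j by rewrite /F !inord_val.
rewrite !AE /= /bump /=; ring.
Qed.

Lemma SO3_trmx P : SO3 P -> SO3 P^T.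
Proof. by move=> [PP dP]; split; [rewrite trmxK mulmx1C|rewrite det_tr]. Qed.

Lemma SO3_mul P Q : SO3 P -> SO3 Q -> SO3 (P *m Q).
Proof.
move=> [PP dP] [QQ dQ]; split; last by rewrite det_mulmx dP dQ mulr1.
by rewrite trmx_mul mulmxA -(mulmxA _ _ P) PP mulmx1.
Qed.

Lemma SO3_1 : SO3 (1%:M : 'M[R]_3).
Proof. by split; [rewrite trmx1 mulmx1|rewrite det1]. Qed.

(** For any matrix, [P^T] applied to the left side is [\det P *: cross u v], a polynomial identity;
    orthogonality then moves [P^T] across. *)
Lemma cross_SO3 P u v : SO3 P -> cross (P *m u) (P *m v) = P *m cross u v.
Proof.
move=> [PP dP]; have PPt : P *m P^T = 1%:M by exact: mulmx1C.
have e : P^T *m cross (P *m u) (P *m v) = \det P *: cross u v.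
  by rewrite det3; vec3.
by rewrite -[LHS]mul1mx -PPt -mulmxA e dP scale1r.
Qed.

Lemma dot_SO3 P u v : SO3 P -> dot (P *m u) (P *m v) = dot u v.
Proof.
by move=> [PP _]; rewrite -!dotE trmx_mul mulmxA -(mulmxA _ _ P) PP mulmx1.
Qed.

Lemma cross_mx_SO3 P u : SO3 P -> cross_mx (P *m u) = P *m cross_mx u *m P^T.
Proof.
move=> hP; have [PP _] := hP.
suff e : cross_mx (P *m u) *m P = P *m cross_mx u.
  by rewrite -e -mulmxA (mulmx1C PP) mulmx1.
apply/matrixP => i j.
have colE (A : 'M[R]_3) : A i j = (A *m delta_mx j 0 : 'cV[R]_3) i 0.
  by rewrite -colE mxE.
by rewrite colE [RHS]colE -!mulmxA !cross_mxE cross_SO3.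
Qed.

Lemma tensor_mul P u v : tensor (P *m u) (P *m v) = P *m tensor u v *m P^T.
Proof. by rewrite /tensor trmx_mul !mulmxA. Qed.

Lemma cross_mx_tr u : (cross_mx u)^T = - cross_mx u.
Proof. mat3. Qed.

(** This and the next three identities give, for [u = v], the multiplication table of the algebra
    spanned by the identity, [cross_mx u] and [tensor u u], in which rotations about [u] live. *)
Lemma cross_mxM u v : cross_mx u *m cross_mx v = tensor v u - dot u v *: 1%:M.
Proof. mat3. Qed.

Lemma cross_mx_tensor u v : cross_mx u *m tensor u v = 0.
Proof. mat3. Qed.

Lemma tensor_cross_mx u v : tensor v u *m cross_mx u = 0.
Proof. mat3. Qed.

Lemma tensorM u v w x : tensor u v *m tensor w x = dot v w *: tensor u x.
Proof. mat3. Qed.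

Lemma tensor_tr u v : (tensor u v)^T = tensor v u.
Proof. mat3. Qed.

(** Rodrigues' formula; it is a rotation by [t] about [u] when [u] is a unit vector. *)
Definition rot u t : 'M[R]_3 :=
  cos t *: 1%:M + sin t *: cross_mx u + (1 - cos t) *: tensor u u.

Lemma rotE u t v :
  rot u t *m v = cos t *: v + sin t *: cross u v + ((1 - cos t) * dot u v) *: u.
Proof. rewrite /rot; vec3. Qed.

Lemma rot_axis u t : dot u u = 1 -> rot u t *m u = u.
Proof.
move=> u1; rewrite rotE u1 (_ : cross u u = 0); last by vec3.
by rewrite scaler0 addr0 mulr1 -scalerDl addrC subrK scale1r.
Qed.

Lemma rotD u s t : dot u u = 1 -> rot u s *m rot u t = rot u (s + t).
Proof.
move=> u1; rewrite /rot !mulmxDl !mulmxDr -!scalemxAl -!scalemxAr.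
rewrite !mul1mx !mulmx1 cross_mxM cross_mx_tensor tensor_cross_mx tensorM u1.
rewrite sinD cosD; set U := cross_mx u; set T := tensor u u.
by apply/matrixP => i j; rewrite !mxE; ring.
Qed.

Lemma rot0 u : rot u 0 = 1%:M.
Proof. by rewrite /rot cos0 sin0 subrr !scale0r !addr0 scale1r. Qed.

Lemma rot_tr u t : (rot u t)^T = rot u (- t).
Proof.
rewrite /rot !linearD /= !linearZ /= trmx1 cross_mx_tr tensor_tr cosN sinN.
by rewrite scalerN scaleNr.
Qed.

(** The determinant is 1 because the rotation is the square of the one by [t / 2], whose determinant
    squares to 1 by orthogonality. *)
Lemma rot_SO3 u t : dot u u = 1 -> SO3 (rot u t).
Proof.
move=> u1; have orth s : (rot u s)^T *m rot u s = 1%:M.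
  by rewrite rot_tr rotD// addNr rot0.
split => //; have e : rot u t = rot u (t / 2) *m rot u (t / 2).
  by rewrite rotD// -splitr.
have := congr1 determinant (orth (t / 2)).
by rewrite det_mulmx det_tr det1 e det_mulmx.
Qed.

Lemma rot_conj P u t : SO3 P -> P *m rot u t *m P^T = rot (P *m u) t.
Proof.
move=> hP; have [PP _] := hP.
rewrite /rot !mulmxDr !mulmxDl -!scalemxAr -!scalemxAl mulmx1 (mulmx1C PP).
by rewrite cross_mx_SO3// tensor_mul.
Qed.

Lemma rotN u t : rot (- u) t = rot u (- t).
Proof. rewrite /rot cosN sinN; mat3. Qed.

End Rotations.

(** * Orthonormal frames and Euler angles *)

Section SO3Geometry.
Context {R : realType}.
Implicit Types (a b c u v w x y z : 'cV[R]_3) (P Q A B : 'M[R]_3).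

Lemma polar (p q : R) : p ^+ 2 + q ^+ 2 = 1 -> exists t, cos t = p /\ sin t = q.
Proof.
move=> pq1; have p1 : -1 <= p <= 1.
  by apply/andP; split; have := sqr_ge0 q; nra.
have cp : cos (acos p) = p by apply: acosK; rewrite in_itv.
have sp : sin (acos p) = `|q|.
  by rewrite sin_acos// -pq1 addrC addKr sqrtr_sqr.
have [q0|q0] := leP 0 q.
  by exists (acos p); rewrite cp sp ger0_norm.
by exists (- acos p); rewrite cosN sinN cp sp ltr0_norm// opprK.
Qed.

Lemma dotC u v : dot u v = dot v u.
Proof. by rewrite /dot; ring. Qed.

Lemma dot_cross_l u v : dot u (cross u v) = 0.
Proof. by rewrite /dot !crossE; ring. Qed.

Lemma dot_cross_r u v : dot v (cross u v) = 0.
Proof. by rewrite /dot !crossE; ring. Qed.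

Lemma dot_cross2 u v : dot (cross u v) (cross u v) = dot u u * dot v v - dot u v ^+ 2.
Proof. by rewrite /dot !crossE; ring. Qed.

Lemma dot_ge0 u : 0 <= dot u u.
Proof. by rewrite /dot -!expr2 !addr_ge0 ?sqr_ge0. Qed.

Lemma dot_eq0 u : dot u u = 0 -> u = 0.
Proof.
rewrite /dot -!expr2 => /eqP.
rewrite !paddr_eq0 ?addr_ge0 ?sqr_ge0// !sqrf_eq0 => /andP[/andP[/eqP u0 /eqP u1] /eqP u2].
by apply: col3P; rewrite mxE.
Qed.

Lemma dotDl u v w : dot (u + v) w = dot u w + dot v w.
Proof. by rewrite /dot !mxE; ring. Qed.

Lemma dotZl k u w : dot (k *: u) w = k * dot u w.
Proof. by rewrite /dot !mxE; ring. Qed.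

Lemma dotDr u v w : dot u (v + w) = dot u v + dot u w.
Proof. by rewrite /dot !mxE; ring. Qed.

Lemma dotZr k u w : dot u (k *: w) = k * dot u w.
Proof. by rewrite /dot !mxE; ring. Qed.

Definition orthopair u v := [/\ dot u u = 1, dot v v = 1 & dot u v = 0].

Lemma orthopair_sym u v : orthopair u v -> orthopair v u.
Proof. by move=> [u1 v1 uv]; split; rewrite // dotC. Qed.

(** The matrix [B] with columns [u], [v], [cross u v] satisfies [B^T *m B = 1]; the expansion is the
    reversed product [B *m B^T = 1] applied to [x]. *)
Lemma orthopair_frame u v x : orthopair u v ->
  x = dot x u *: u + dot x v *: v + dot x (cross u v) *: cross u v.
Proof.
move=> [u1 v1 uv].
have n1 : dot (cross u v) (cross u v) = 1 by rewrite dot_cross2 u1 v1 uv; ring.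
have un := dot_cross_l u v; have vn := dot_cross_r u v.
move: (cross u v) n1 un vn => n n1 un vn; pose B : 'M[R]_3 := \matrix_(i, j) (if j == 0 then u i 0 else if j == 1 then v i 0 else n i 0).
have BB : B^T *m B = 1%:M.
  apply/matrixP => i j; rewrite mxE sum3 [RHS]mxE.
  move: u1 v1 uv n1 un vn; rewrite /dot => u1 v1 uv n1 un vn.
  move: i j; apply: ord3P; apply: ord3P;
    rewrite !mxE ?eqxx ?eq3 /= ?mulr1n ?mulr0n; lra.
have := mulmx1C BB; move/(congr1 (fun M => M *m x)); rewrite mul1mx => {1}<-.
rewrite /B; apply: col3P; rewrite !(mxE, sum3) /= ?eqxx ?eq3 /dot; ring.
Qed.

(** [P *m v] is a unit vector orthogonal to [u], which determines the angle; the third frame vector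
    follows since [P] preserves cross products. *)
Lemma fix_axis P u v : SO3 P -> orthopair u v -> P *m u = u ->
  exists t, P = rot u t.
Proof.
move=> hP uvo Pu; have [u1 v1 uv] := uvo; pose n := cross u v.
have n1 : dot n n = 1 by rewrite /n dot_cross2 u1 v1 uv; ring.
have Pvu : dot (P *m v) u = 0 by rewrite -[X in dot _ X]Pu dot_SO3// dotC.
have Pv := orthopair_frame (P *m v) uvo.
rewrite Pvu scale0r add0r -/n in Pv.
set p := dot (P *m v) v in Pv; set q := dot (P *m v) n in Pv.
have vn : dot v n = 0 := dot_cross_r u v.
have pq : p ^+ 2 + q ^+ 2 = 1.
  have := dot_SO3 v v hP; rewrite v1 Pv !(dotDl, dotDr, dotZl, dotZr).
  by rewrite v1 n1 (dotC n v) vn => <-; ring.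
have [t [ct st]] := polar pq; exists t.
have Rv : P *m v = rot u t *m v.
  by rewrite Pv rotE uv mulr0 scale0r addr0 ct st.
have Ru : P *m u = rot u t *m u by rewrite Pu rot_axis.
have Rn : P *m n = rot u t *m n.
  by rewrite /n -!cross_SO3//; [rewrite Ru Rv|exact: rot_SO3].
apply/matrixP => i j.
have colE (A : 'M[R]_3) : A i j = (A *m delta_mx j 0 : 'cV[R]_3) i 0.
  by rewrite -colE mxE.
rewrite colE [RHS]colE (orthopair_frame (delta_mx j 0) uvo) -/n.
by rewrite !mulmxDr -!scalemxAr Ru Rv Rn.
Qed.

(** Spherical coordinates with pole [u]: the rotation about [v] sets the latitude of [b], the one
    about [u] its longitude, and [m] is the radius of the circle of latitude. *)
Lemma sphere_rot u v b : orthopair u v -> dot b b = 1 ->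
  exists s t, rot u s *m (rot v t *m u) = b.
Proof.
move=> uvo b1; have [u1 v1 uv] := uvo.
have b_frame := orthopair_frame b uvo.
set n := cross u v in b_frame; set p := dot b u in b_frame.
set q := dot b v in b_frame; set r := dot b n in b_frame.
have n1 : dot n n = 1 by rewrite /n dot_cross2 u1 v1 uv; ring.
have un : dot u n = 0 := dot_cross_l u v.
have vn : dot v n = 0 := dot_cross_r u v.
have pqr : p ^+ 2 + (q ^+ 2 + r ^+ 2) = 1.
  rewrite -b1 [in RHS]b_frame !(dotDl, dotDr, dotZl, dotZr).
  by rewrite u1 v1 n1 (dotC v u) (dotC n u) (dotC n v) uv un vn; ring.
pose m := Num.sqrt (q ^+ 2 + r ^+ 2).
have m2 : m ^+ 2 = q ^+ 2 + r ^+ 2 by rewrite sqr_sqrtr// addr_ge0 ?sqr_ge0.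
have [t [ct st]] : exists t, cos t = p /\ sin t = m by apply: polar; rewrite m2.
(* The signs come from [cross v u = - n] and [cross u n = - v]; at the poles, where [m = 0], any
   longitude works. *)
have [s [cs ss]] : exists s, m * cos s = - r /\ m * sin s = q.
  have [m0|m0] := eqVneq m 0.
    exists 0; move: m2; rewrite m0 expr0n/= => /esym /eqP.
    rewrite paddr_eq0 ?sqr_ge0// !sqrf_eq0 => /andP[/eqP -> /eqP ->].
    by rewrite !mul0r oppr0.
  have [s [cs ss]] : exists s, cos s = - r / m /\ sin s = q / m.
    by apply: polar; rewrite !expr_div_n sqrrN -mulrDl addrC -m2 divff// expf_neq0.
  by exists s; rewrite cs ss ![m * _]mulrC !divfK.
exists s, t; rewrite [rot v t *m u]rotE dotC uv mulr0 scale0r addr0 ct st.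
have cvu : cross v u = - n by rewrite /n; vec3.
have cun : cross u n = - v.
  have -> : cross u n = dot u v *: u - dot u u *: v by rewrite /n; vec3.
  by rewrite uv u1 scale0r scale1r sub0r.
rewrite cvu mulmxDr -!scalemxAr rot_axis// mulmxN rotE un mulr0 scale0r addr0 cun.
rewrite [RHS]b_frame -addrA; congr (_ + _).
rewrite opprD !scalerDr !scalerN opprK !scalerA cs ss scaleNr opprK addrC.
by [].
Qed.

(** Two rotations carry [u] to [P *m u]; what remains of [P] fixes [u] and is a rotation about
    it. *)
Lemma SO3_euler u v P : orthopair u v -> SO3 P ->
  exists s t r, P = rot u s *m rot v t *m rot u r.
Proof.
move=> uvo hP; have [u1 v1 uv] := uvo.
have b1 : dot (P *m u) (P *m u) = 1 by rewrite dot_SO3.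
have [s [t e]] := sphere_rot uvo b1.
pose Q := rot u s *m rot v t; have hQ : SO3 Q by apply: SO3_mul; exact: rot_SO3.
have [QQ _] := hQ.
have hQP : SO3 (Q^T *m P) by apply: SO3_mul => //; exact: SO3_trmx.
have [|r er] := fix_axis hQP uvo.
  by rewrite -mulmxA -e [X in _ *m X]mulmxA -/Q mulmxA QQ mul1mx.
exists s, t, r; rewrite -/Q -er mulmxA (mulmx1C QQ) mul1mx//.
Qed.

End SO3Geometry.

(** * Generating rigid motions from two rotation axes *)

Section HolonomyGroup.
Context {R : realType}.
Implicit Types (a b c u v w x y z : 'cV[R]_3) (P Q : 'M[R]_3) (r s t : R).
(* [Hol P x r]: the rigid motion [(P, x)] is reachable by a loop of shapes that closes up
   after turning the swimmer by the angle [r] about link 0. *)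
Variable Hol : 'M[R]_3 -> 'cV[R]_3 -> R -> Prop.

(** Translation and closing angle are left free at this stage; they are corrected once all
    translations of index 0 are available. *)
Definition full_axis u := dot u u = 1 /\ forall t, exists x r, Hol (rot u t) x r.

Hypothesis HolSO3 : forall P x r, Hol P x r -> SO3 P.
Hypothesis HolM : forall P x r Q y s,
  Hol P x r -> Hol Q y s -> Hol (P *m Q) (P *m y + x) (r + s).
Hypothesis HolV : forall P x r, Hol P x r -> Hol P^T (- (P^T *m x)) (- r).

Lemma Hol_conj P x r Q y s : Hol P x r -> Hol Q y s ->
  exists z, Hol (P *m Q *m P^T) z s.
Proof.
move=> hP hQ; have := HolM (HolM hP hQ) (HolV hP).
by rewrite addrAC subrr add0r; eexists; eassumption.
Qed.

Lemma full_axis_conj u P x r : Hol P x r -> full_axis u -> full_axis (P *m u).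
Proof.
move=> hP [u1 hu]; have sP := HolSO3 hP; split; first by rewrite dot_SO3.
by move=> t; have [y [s /(Hol_conj hP)[z]]] := hu t; rewrite rot_conj//; exists z, s.
Qed.

(** Turning [u] about [v] sweeps a cone of full axes. With [k = dot u v], the scalar product of [u]
    with its image is [k ^+ 2 + (1 - k ^+ 2) * cos t], and [p] is the cosine that makes it [c]. *)
Lemma full_axis_between u v (c : R) : full_axis u -> full_axis v ->
  -1 < dot u v < 1 -> 2 * dot u v ^+ 2 - 1 <= c <= 1 ->
  exists w, full_axis w /\ dot u w = c.
Proof.
move=> hu hv /andP[k1 k2] /andP[c1 c2]; have [u1 _] := hu; have [v1 hv'] := hv.
set k := dot u v in k1 k2 c1.
have k0 : 0 < 1 - k ^+ 2 by nra.
pose p := (c - k ^+ 2) / (1 - k ^+ 2).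
have p1 : p ^+ 2 + Num.sqrt (1 - p ^+ 2) ^+ 2 = 1.
  rewrite sqr_sqrtr; first by rewrite addrC subrK.
  have pl : -1 <= p by rewrite /p ler_pdivlMr//; lra.
  have pr : p <= 1 by rewrite /p ler_pdivrMr//; lra.
  by nra.
have [t [ct st]] := polar p1.
have [x [r hx]] := hv' t; exists (rot v t *m u).
split; first exact: full_axis_conj hx hu.
rewrite rotE !dotDr !dotZr dot_cross_r u1 (dotC v u) -/k ct.
by rewrite /p; field; rewrite gt_eqF.
Qed.

(** If [2 * k ^+ 2 <= 1], the cone already contains a vector orthogonal to [u]. Otherwise a half
    turn replaces [k] by [2 * k ^+ 2 - 1], doubling the angle, and [1 - k ^+ 2] at least doubles, so
    finitely many steps suffice. *)
Lemma full_axis_orthogonal u v : full_axis u -> full_axis v ->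
  -1 < dot u v < 1 -> exists w, full_axis w /\ dot u w = 0.
Proof.
move=> hu; have [u1 _] := hu.
suff dbl n w : full_axis w -> -1 < dot u w < 1 -> 1 <= 2 ^+ n * (1 - dot u w ^+ 2) ->
    exists w', full_axis w' /\ dot u w' = 0.
  move=> hv /andP[k1 k2]; have k0 : 0 < 1 - dot u v ^+ 2 by nra.
  have [n hn] : exists n : nat, (1 - dot u v ^+ 2)^-1 <= 2 ^+ n.
    exists (Num.bound (1 - dot u v ^+ 2)^-1).
    apply/ltW/(lt_trans (archi_boundP _)); first by rewrite invr_ge0 ltW.
    by rewrite -natrX ltr_nat ltn_expl.
  apply: (dbl n v hv); first by rewrite k1.
  by rewrite -ler_pdivrMr// div1r.
elim: n w => [|n ih] w hw /[dup] kb /andP[k1 k2] h.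
  exists w; split => //; apply/eqP; rewrite -sqrf_eq0 eq_le sqr_ge0 andbT.
  by move: h; rewrite expr0; lra.
have [small|big] := leP (2 * dot u w ^+ 2) 1.
  by apply: (full_axis_between hu hw kb); lra.
have kk : 2 * dot u w ^+ 2 - 1 <= 2 * dot u w ^+ 2 - 1 <= 1.
  by rewrite lexx /=; nra.
have [w' [hw' ew']] := full_axis_between hu hw kb kk.
apply: (ih w' hw'); rewrite ew'; first by apply/andP; split; nra.
apply: (le_trans h); rewrite exprSr -mulrA ler_pM2l ?exprn_gt0//.
set k := dot u w in k1 k2 big *; have : k ^+ 2 < 1 by nra.
by set q := k ^+ 2 in big *; nra.
Qed.

Section Generation.
Variables u v : 'cV[R]_3.
Hypothesis uvo : orthopair u v.
Hypothesis (hu : full_axis u) (hv : full_axis v).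

Lemma Hol_rotation P : SO3 P -> exists x r, Hol P x r.
Proof.
move=> /(SO3_euler uvo)[s [t [r ->]]].
have [x1 [r1 h1]] := hu.2 s; have [x2 [r2 h2]] := hv.2 t.
have [x3 [r3 h3]] := hu.2 r.
by have := HolM (HolM h1 h2) h3; eexists; eexists; eassumption.
Qed.

Variables (y0 : 'cV[R]_3) (r0 : R).
Hypothesis (y0_neq0 : y0 != 0) (hy0 : Hol 1%:M y0 r0).

Lemma Hol1D x r y s : Hol 1%:M x r -> Hol 1%:M y s -> Hol 1%:M (x + y) (r + s).
Proof. by move=> hx hy; have := HolM hx hy; rewrite !mul1mx addrC. Qed.

Lemma Hol1N x r : Hol 1%:M x r -> Hol 1%:M (- x) (- r).
Proof. by move/HolV; rewrite trmx1 mul1mx. Qed.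

(** Conjugating a translation by a motion with linear part [P] rotates it by [P], whatever the
    translation and the index of that motion. *)
Lemma Hol1_rot P x r : SO3 P -> Hol 1%:M x r -> Hol 1%:M (P *m x) r.
Proof.
move=> hP hx; have [y [s hy]] := Hol_rotation hP.
have := HolM (HolM hy hx) (HolV hy).
rewrite mulmx1 (mulmx1C hP.1) addrAC subrr add0r.
by rewrite mulmxN mulmxA (mulmx1C hP.1) mul1mx addrCA addNr addr0.
Qed.

Lemma Hol1_mulrn x n : Hol 1%:M x 0 -> Hol 1%:M (x *+ n) 0.
Proof.
move=> hx; elim: n => [|n ih].
  by have := Hol1D hx (Hol1N hx); rewrite !subrr mulr0n.
by rewrite mulrS; have := Hol1D hx ih; rewrite addr0.
Qed.

(* [rot e t *m w - rot e (- t) *m w = 2 * sin t *: cross e w], and the indices [r] cancel. *)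
Lemma Hol1_cross w r z : Hol 1%:M w r -> Hol 1%:M (cross z w) 0.
Proof.
move=> hw; have [->|z0] := eqVneq z 0.
  rewrite (_ : cross 0 w = w - w); last by vec3.
  by rewrite -(subrr r); exact: Hol1D hw (Hol1N hw).
have zz : 0 < dot z z.
  by rewrite lt_neqAle dot_ge0 andbT eq_sym; apply: contra_neq z0 => /dot_eq0.
pose m := Num.sqrt (dot z z); have m0 : 0 < m by rewrite sqrtr_gt0.
have m2 : m ^+ 2 = dot z z by rewrite sqr_sqrtr// ltW.
pose e := m^-1 *: z.
have e1 : dot e e = 1.
  by rewrite /e dotZl dotZr -m2; field; rewrite gt_eqF.
have small k : 0 <= k <= 2 -> Hol 1%:M (k *: cross e w) 0.
  move=> /andP[k0 k2].
  have [|t [_ st]] := @polar _ (Num.sqrt (1 - (k / 2) ^+ 2)) (k / 2).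
    by rewrite sqr_sqrtr ?subrK//; nra.
  have h1 := Hol1_rot (rot_SO3 t e1) hw.
  have h2 := Hol1N (Hol1_rot (rot_SO3 (- t) e1) hw).
  have := Hol1D h1 h2; rewrite subrr !rotE cosN sinN st.
  by congr (Hol _ _ _); apply: col3P; rewrite !(crossE, mxE); field; rewrite gt_eqF.
(* [2 * sin t] only yields factors up to 2, so the length [m] of [z] is split into [n.+1] equal
   parts. *)
have [n hn] : exists n : nat, m / 2 <= n.+1%:R.
  by exists (Num.bound (m / 2)); apply/ltW/(lt_le_trans (archi_boundP _)); rewrite ?ler_nat// divr_ge0// ltW.
have n0 : 0 < n.+1%:R :> R by rewrite ltr0n.
have mn : 0 <= m / n.+1%:R <= 2.
  apply/andP; split; first by apply: divr_ge0; exact: ltW.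
  by rewrite ler_pdivrMr// mulrC -ler_pdivrMr.
have := Hol1_mulrn n.+1 (small _ mn).
rewrite -scaler_nat scalerA [_ * (m / _)]mulrC divfK ?gt_eqF//.
suff -> : m *: cross e w = cross z w by [].
by rewrite /e; apply: col3P; rewrite !(crossE, mxE); field; rewrite gt_eqF.
Qed.

(** Double cross products span: summing [cross (e i) (cross (e i) y0)] over the basis gives
    [-2 *: y0], and [cross y0 (cross x y0)] divided by [dot y0 y0] is the part of [x] orthogonal to
    [y0]. The constant [k] makes the first supply the part along [y0]. *)
Lemma Hol1 x : Hol 1%:M x 0.
Proof.
have yy : 0 < dot y0 y0.
  by rewrite lt_neqAle dot_ge0 andbT eq_sym; apply: contra_neq y0_neq0 => /dot_eq0.
have hc z : Hol 1%:M (cross z y0) 0 := Hol1_cross z hy0.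
have hcc z z' : Hol 1%:M (cross z (cross z' y0)) 0 := Hol1_cross z (hc z').
pose e i : 'cV[R]_3 := delta_mx i 0.
pose k := - (dot y0 x / dot y0 y0) / 2.
have := Hol1D (Hol1D (hcc (k *: e 0) (e 0)) (hcc (k *: e 1) (e 1))) (hcc (k *: e 2) (e 2)).
move/Hol1D => /(_ _ _ (hcc y0 ((dot y0 y0)^-1 *: x))).
rewrite !addr0; congr (Hol _ _ _).
have yy0 : dot y0 y0 != 0 by rewrite gt_eqF.
have E p : cross (p *: e 0) (cross (e 0) y0) + cross (p *: e 1) (cross (e 1) y0) +
    cross (p *: e 2) (cross (e 2) y0) = (-2 * p) *: y0.
  by rewrite /e; vec3.
rewrite E (_ : cross y0 _ = x - (dot y0 x / dot y0 y0) *: y0).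
  have -> : -2 * k = dot y0 x / dot y0 y0 by rewrite /k; field.
  by rewrite addrC subrK.
by apply: col3P; rewrite !(crossE, mxE); move: yy0; rewrite /dot => yy0; field.
Qed.

Lemma Hol_zero P x r y : Hol P x r -> Hol P y r.
Proof.
move=> hP; have := HolM (Hol1 (y - x)) hP.
by rewrite !mul1mx add0r addrC subrK.
Qed.

(** The half turn about [q] sends [p] to [- p], so it conjugates [rot p (- t / 2)] to
    [rot p (t / 2)]. The commutator is [rot p t], and the indices cancel. *)
Lemma Hol_rot0 p q t : orthopair p q -> Hol (rot p t) 0 0.
Proof.
move=> [p1 q1 pq].
have [x [r hx]] := Hol_rotation (rot_SO3 pi q1).
have [y [s hy]] := Hol_rotation (rot_SO3 (- t / 2) p1).
have [z hz] := Hol_conj hx hy.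
have := HolM hz (HolV hy); rewrite subrr => /(Hol_zero 0).
rewrite rot_conj; last exact: rot_SO3.
rewrite (_ : rot q pi *m p = - p); last first.
  rewrite rotE (dotC q p) pq mulr0 scale0r addr0 cospi sinpi scale0r addr0.
  by rewrite scaleN1r.
by rewrite rotN rot_tr rotD// (_ : _ + _ = t)//; field.
Qed.

Theorem Hol_full P x : SO3 P -> Hol P x 0.
Proof.
move=> /(SO3_euler uvo)[s [t [r ->]]].
have h1 := Hol_rot0 s uvo; have h2 := Hol_rot0 t (orthopair_sym uvo).
have h3 := Hol_rot0 r uvo.
have := HolM (HolM h1 h2) h3; rewrite !addr0; exact: Hol_zero.
Qed.

End Generation.

Theorem holonomy_full u v y r P x : full_axis u -> full_axis v -> cross u v != 0 ->
  y != 0 -> Hol 1%:M y r -> SO3 P -> Hol P x 0.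
Proof.
move=> hu hv uv y0 hy hP; have [u1 _] := hu; have [v1 _] := hv.
have k1 : -1 < dot u v < 1.
  have : 0 < dot (cross u v) (cross u v).
    by rewrite lt_neqAle dot_ge0 andbT eq_sym; apply: contra_neq uv => /dot_eq0.
  by rewrite dot_cross2 u1 v1 => h; apply/andP; split; nra.
have [w [hw uw]] := full_axis_orthogonal hu hv k1.
have uwo : orthopair u w by split => //; have [] := hw.
exact: (Hol_full uwo hu hw y0 hy).
Qed.

End HolonomyGroup.

(** * Structure of the resistance matrix *)

Section LinkBlocks.
Context {R : realType} (Cpar Cperp Ctau : R) {N : nat} (ell : N.-tuple R).
Implicit Types (s : swimmer_shape R N) (i j : 'I_N) (Q : 'M[R]_3) (k : 'cV[R]_3).

Local Notation "'l_ i" := (tnth ell i) (at level 8, i at level 2).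
Local Notation D s i := (drag_mx Cpar Cperp s i).
Local Notation A s i := (arm_mx ell s i).
Local Notation J s i := (J_link Cpar Cperp Ctau ell s i).
Local Notation E s i := (cross_mx (link_dir s i)).

Definition ez : 'cV[R]_3 := vec3 0 0 1.

Lemma dot_ez : dot ez ez = 1.
Proof. by rewrite /dot !vec3E; ring. Qed.

Definition C_link s i : 'M[R]_3 :=
  'l_i *: (A s i *m D s i) + ('l_i ^+ 2 / 2 * Cperp) *: E s i.

Definition link_mx s i : 'M[R]_(3 + 3) :=
  block_mx ('l_i *: D s i) (C_link s i)^T (C_link s i) (J s i).

Definition diag2 Q : 'M[R]_(3 + 3) := block_mx Q 0 0 Q.

Lemma sum_block_mx (I : Type) (r : seq I) (P : pred I) m1 m2 n1 n2
    (a : I -> 'M[R]_(m1, n1)) (b : I -> 'M[R]_(m1, n2))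
    (c : I -> 'M[R]_(m2, n1)) (d : I -> 'M[R]_(m2, n2)) :
  \sum_(i <- r | P i) block_mx (a i) (b i) (c i) (d i) =
  block_mx (\sum_(i <- r | P i) a i) (\sum_(i <- r | P i) b i)
    (\sum_(i <- r | P i) c i) (\sum_(i <- r | P i) d i).
Proof.
elim: r => [|i r ih]; first by rewrite !big_nil block_mx_const.
by rewrite !big_cons; case: ifP => // _; rewrite ih add_block_mx.
Qed.

Lemma resistance_sum s :
  resistance_mx Cpar Cperp Ctau ell s = \sum_i link_mx s i.
Proof. by rewrite sum_block_mx /resistance_mx /C_mx -raddf_sum. Qed.

(** Link 0 is separated because its block does not depend on the shape ([base_mxE]), while that of
    the other links is merely conjugated when they rotate together. *)
Definition base_mx s : 'M[R]_(3 + 3) := \sum_(i < N | (i == 0 :> nat)%N) link_mx s i.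
Definition rest_mx s : 'M[R]_(3 + 3) := \sum_(i < N | (0 < i)%N) link_mx s i.

Lemma resistance_split s :
  resistance_mx Cpar Cperp Ctau ell s = rest_mx s + base_mx s.
Proof.
rewrite resistance_sum (bigID (fun i : 'I_N => (0 < i)%N)) /=; congr (_ + _).
by apply: eq_bigl => i; rewrite lt0n negbK.
Qed.

Lemma diag2_mul P Q : diag2 P *m diag2 Q = diag2 (P *m Q).
Proof. by rewrite /diag2 mulmx_block !(mulmx0, mul0mx, addr0, add0r). Qed.

Lemma diag2_tr Q : (diag2 Q)^T = diag2 Q^T.
Proof. by rewrite /diag2 tr_block_mx !trmx0. Qed.

Lemma diag2_1 : diag2 1%:M = 1%:M.
Proof. by rewrite /diag2 -scalar_mx_block. Qed.

Lemma diag2_col Q (a b : 'cV[R]_3) : diag2 Q *m col_mx a b = col_mx (Q *m a) (Q *m b).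
Proof. by rewrite /diag2 mul_block_col !mul0mx addr0 add0r. Qed.

Lemma conj_block Q (a b c d : 'M[R]_3) :
  diag2 Q *m block_mx a b c d *m (diag2 Q)^T =
  block_mx (Q *m a *m Q^T) (Q *m b *m Q^T) (Q *m c *m Q^T) (Q *m d *m Q^T).
Proof.
by rewrite diag2_tr /diag2 !mulmx_block !(mulmx0, mul0mx, addr0, add0r).
Qed.

Section Equivariance.
Variables (s s' : swimmer_shape R N) (Q : 'M[R]_3).
Hypothesis sQ : SO3 Q.
Hypothesis ss' : forall i, (0 < i)%N -> link_dir s' i = Q *m link_dir s i.

Let QQ : Q *m Q^T = 1%:M := mulmx1C sQ.1.

Let conjM (a b : 'M[R]_3) :
  (Q *m a *m Q^T) *m (Q *m b *m Q^T) = Q *m (a *m b) *m Q^T.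
Proof. by rewrite !mulmxA -(mulmxA _ Q^T Q) sQ.1 mulmx1. Qed.

Let conjZ c (a : 'M[R]_3) : c *: (Q *m a *m Q^T) = Q *m (c *: a) *m Q^T.
Proof. by rewrite -scalemxAr -scalemxAl. Qed.

Let conjD (a b : 'M[R]_3) : Q *m a *m Q^T + Q *m b *m Q^T = Q *m (a + b) *m Q^T.
Proof. by rewrite mulmxDr mulmxDl. Qed.

Let conjN (a : 'M[R]_3) : - (Q *m a *m Q^T) = Q *m (- a) *m Q^T.
Proof. by rewrite mulmxN mulNmx. Qed.

Let conj1 : (1%:M : 'M[R]_3) = Q *m 1%:M *m Q^T.
Proof. by rewrite mulmx1. Qed.

Lemma arm_mx_equiv i : A s' i = Q *m A s i *m Q^T.
Proof.
rewrite /arm_mx mulmx_sumr mulmx_suml; apply: eq_bigr => j /andP[j0 _].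
by rewrite ss'// cross_mx_SO3// conjZ.
Qed.

Section OneLink.
Variable i : 'I_N.
Hypothesis eiQ : link_dir s' i = Q *m link_dir s i.

Lemma drag_mx_equiv : D s' i = Q *m D s i *m Q^T.
Proof. by rewrite /drag_mx eiQ tensor_mul {1}conj1 !conjZ conjD. Qed.

Lemma C_link_equiv : C_link s' i = Q *m C_link s i *m Q^T.
Proof.
by rewrite /C_link arm_mx_equiv drag_mx_equiv eiQ cross_mx_SO3// conjM !conjZ conjD.
Qed.

Lemma J_link_equiv : J s' i = Q *m J s i *m Q^T.
Proof.
rewrite /J_link arm_mx_equiv eiQ cross_mx_SO3// tensor_mul.
rewrite [X in X - Q *m _ *m _]conj1.
by case: ifP => _; rewrite !(conjM, conjN, conjD, conjZ).
Qed.

Lemma link_mx_equiv : link_mx s' i = diag2 Q *m link_mx s i *m (diag2 Q)^T.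
Proof.
rewrite /link_mx conj_block drag_mx_equiv C_link_equiv J_link_equiv.
by rewrite conjZ !trmx_mul trmxK mulmxA.
Qed.

End OneLink.

(** Link 0 need not rotate: the arms of the other links start at its end joint and do not involve
    its direction. *)
Lemma rest_mx_equiv : rest_mx s' = diag2 Q *m rest_mx s *m (diag2 Q)^T.
Proof.
rewrite /rest_mx mulmx_sumr mulmx_suml; apply: eq_bigr => i i0.
by apply: link_mx_equiv; exact: ss'.
Qed.

Lemma resistance_equiv : (forall i, link_dir s' i = Q *m link_dir s i) ->
  resistance_mx Cpar Cperp Ctau ell s' =
  diag2 Q *m resistance_mx Cpar Cperp Ctau ell s *m (diag2 Q)^T.
Proof.
move=> ssQ; rewrite !resistance_sum mulmx_sumr mulmx_suml.
by apply: eq_bigr => i _; exact: link_mx_equiv.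
Qed.

Variables (de de' : 'I_N -> 'cV[R]_3).
Hypothesis dde : forall i, (0 < i)%N -> de' i = Q *m de i.

Lemma arm_velocity_equiv i : arm_velocity ell de' i = Q *m arm_velocity ell de i.
Proof.
rewrite /arm_velocity mulmx_sumr; apply: eq_bigr => j /andP[j0 _].
by rewrite dde// -scalemxAr.
Qed.

Let conjv (a : 'M[R]_3) (v : 'cV[R]_3) : Q *m a *m Q^T *m (Q *m v) = Q *m (a *m v).
Proof. by rewrite !mulmxA -(mulmxA _ Q^T Q) sQ.1 mulmx1. Qed.

Lemma shape_force_equiv :
  shape_force Cpar Cperp ell s' de' = Q *m shape_force Cpar Cperp ell s de.
Proof.
rewrite /shape_force mulmx_sumr; apply: eq_bigr => i i0.
rewrite drag_mx_equiv ?ss'// arm_velocity_equiv dde// conjv.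
by rewrite mulmxDr -!scalemxAr.
Qed.

Lemma shape_torque_equiv :
  shape_torque Cpar Cperp ell s' de' = Q *m shape_torque Cpar Cperp ell s de.
Proof.
rewrite /shape_torque mulmx_sumr; apply: eq_bigr => i i0.
rewrite drag_mx_equiv ?ss'// arm_velocity_equiv dde// arm_mx_equiv.
by rewrite cross_mx_SO3// conjM !conjv !mulmxDr -!scalemxAr.
Qed.

End Equivariance.

Section Rigid.
Variables (s : swimmer_shape R N) (de : 'I_N -> 'cV[R]_3) (k : 'cV[R]_3).
Hypothesis e1 : forall i, dot (link_dir s i) (link_dir s i) = 1.
Hypothesis dek : forall i, (0 < i)%N -> de i = cross k (link_dir s i).

Lemma arm_mx_rigid i : A s i *m k = - arm_velocity ell de i.
Proof.
rewrite /arm_mx /arm_velocity mulmx_suml -sumrN; apply: eq_bigr => j /andP[j0 _].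
by rewrite dek// -scalemxAl cross_mxE -scalerN; congr (_ *: _); vec3.
Qed.

Lemma drag_mx_tr i : (D s i)^T = D s i.
Proof. by rewrite /drag_mx linearD /= !linearZ /= tensor_tr trmx1. Qed.

Lemma arm_mx_tr i : (A s i)^T = - A s i.
Proof.
rewrite /arm_mx raddf_sum -sumrN; apply: eq_bigr => j _ /=.
by rewrite linearZ /= cross_mx_tr scalerN.
Qed.

Lemma E_rigid i : (0 < i)%N -> E s i *m k = - de i.
Proof. by move=> i0; rewrite dek// cross_mxE; vec3. Qed.

Lemma C_link_rigid i : (0 < i)%N -> (C_link s i)^T *m k =
  'l_i *: (D s i *m arm_velocity ell de i) + ('l_i ^+ 2 / 2 * Cperp) *: de i.
Proof.
move=> i0; rewrite /C_link linearD /= !linearZ /= trmx_mul drag_mx_tr arm_mx_tr.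
rewrite cross_mx_tr mulmxDl -!scalemxAl mulmxN !mulNmx -mulmxA arm_mx_rigid.
by rewrite E_rigid// mulmxN !opprK.
Qed.

Lemma J_link_rigid i : (0 < i)%N -> J s i *m k =
  'l_i *: (A s i *m D s i *m arm_velocity ell de i)
   + ('l_i ^+ 2 / 2 * Cperp) *: (E s i *m arm_velocity ell de i)
   + ('l_i ^+ 2 / 2 * Cperp) *: (A s i *m de i)
   + ('l_i ^+ 3 / 3 * Cperp) *: (E s i *m de i).
Proof.
move=> i0; rewrite /J_link gtn_eqF//.
(* Valid for unit directions; with [E *m k = - de] it turns the last term of [J_link] into the last
   term of the torque. *)
have -> : 1%:M - tensor (link_dir s i) (link_dir s i) = - (E s i *m E s i).
  by rewrite cross_mxM e1 scale1r opprB.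
rewrite /drag_mx; move: (tensor (link_dir s i) (link_dir s i)) => T.
rewrite !mulmxDl !mulNmx -!scalemxAl mulmxDl mulNmx -!mulmxA !arm_mx_rigid !E_rigid//.
rewrite mulmxDl -!scalemxAl mul1mx !mulmxDr -!scalemxAr !mulmxN.
move: (A s i *m (T *m _)) (A s i *m arm_velocity _ _ _)
  (E s i *m arm_velocity _ _ _) (A s i *m de i) (E s i *m de i) => x1 x2 x3 x4 x5.
by apply/matrixP => j j'; rewrite !mxE; ring.
Qed.

(** When the moving links turn together with angular velocity [k], their drag is that of a rigid
    body, given link by link by the resistance blocks applied to the twist (0; k). *)
Lemma shape_rigid : col_mx (shape_force Cpar Cperp ell s de)
  (shape_torque Cpar Cperp ell s de) = rest_mx s *m col_mx 0 k.
Proof.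
rewrite /rest_mx mulmx_suml.
rewrite (eq_bigr (fun i => col_mx ((C_link s i)^T *m k) (J s i *m k))); last first.
  by move=> i _; rewrite /link_mx mul_block_col !mulmx0 !add0r.
have colD (I : Type) (r : seq I) (P : pred I) (a b : I -> 'cV[R]_3) :
    \sum_(i <- r | P i) col_mx (a i) (b i) =
    col_mx (\sum_(i <- r | P i) a i) (\sum_(i <- r | P i) b i).
  elim: r => [|i r ih]; first by rewrite !big_nil col_mx0.
  by rewrite !big_cons; case: ifP => // _; rewrite ih add_col_mx.
rewrite colD; congr col_mx; apply: eq_bigr => i i0.
  by rewrite C_link_rigid.
by rewrite J_link_rigid.
Qed.

End Rigid.

Lemma link_dir0 s i : (i == 0 :> nat)%N -> link_dir s i = ez.
Proof. by move=> i0; rewrite /link_dir insubF// lt0n i0. Qed.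

Section BaseLink.
Variable i0 : 'I_N.
Hypothesis i0_eq0 : (i0 == 0 :> nat)%N.

Lemma base_mx_link s : base_mx s = link_mx s i0.
Proof.
rewrite /base_mx (big_pred1 i0)// => i /=.
by rewrite -(eqP i0_eq0); apply/idP/idP => [/eqP/val_inj ->|/eqP ->].
Qed.

Lemma arm_mx_base s : A s i0 = 0.
Proof.
rewrite /arm_mx big_pred0// => j.
by rewrite (eqP i0_eq0) ltn0 andbF.
Qed.

Lemma base_mxE s : base_mx s = block_mx
  ('l_i0 *: ((Cpar - Cperp) *: tensor ez ez + Cperp *: 1%:M))
  ((('l_i0 ^+ 2 / 2 * Cperp) *: cross_mx ez)^T)
  (('l_i0 ^+ 2 / 2 * Cperp) *: cross_mx ez)
  (('l_i0 ^+ 3 / 3 * Cperp) *: (1%:M - tensor ez ez) + ('l_i0 * Ctau) *: tensor ez ez).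
Proof.
rewrite base_mx_link /link_mx /C_link arm_mx_base mul0mx scaler0 add0r.
by rewrite /drag_mx /J_link i0_eq0 !link_dir0.
Qed.

(** Link 0 turning about its own axis meets only torsional drag. *)
Lemma base_mx_ez s : base_mx s *m col_mx 0 ez = col_mx 0 (('l_i0 * Ctau) *: ez).
Proof.
rewrite base_mxE mul_block_col !mulmx0 !add0r; congr col_mx.
  by rewrite linearZ /= cross_mx_tr scalerN mulNmx -scalemxAl cross_mxE /ez; vec3.
rewrite mulmxDl -!scalemxAl mulmxDl mul1mx mulNmx.
rewrite (_ : tensor ez ez *m ez = ez); last first.
  by rewrite /tensor -mulmxA -[X in _ *m X = _](_ : 1%:M = _) ?mulmx1//;
    apply/matrixP => x y; rewrite !ord1 [RHS]dotE dot_ez mxE.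
by rewrite subrr scaler0 add0r.
Qed.

End BaseLink.

End LinkBlocks.

(** * Nondegeneracy for almost every choice of lengths *)

Section PolynomialMatrices.
Context {R : realType} {N : nat}.
Local Notation tup := (N.-tuple (measurableTypeR R)).

Definition polymx m n (A : tup -> 'M[R]_(m, n)) :=
  forall i j, polyfun (fun t => A t i j).

Lemma polymx_cst m n (A : 'M[R]_(m, n)) : polymx (fun=> A).
Proof. by move=> i j; exact: polyfun_cst. Qed.

Lemma polymxD m n (A B : tup -> 'M[R]_(m, n)) :
  polymx A -> polymx B -> polymx (fun t => A t + B t).
Proof.
by move=> hA hB i j; apply: polyfun_eq (polyfunD (hA i j) (hB i j)) => t; rewrite mxE.
Qed.

Lemma polymxN m n (A : tup -> 'M[R]_(m, n)) : polymx A -> polymx (fun t => - A t).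
Proof. by move=> hA i j; apply: polyfun_eq (polyfunN (hA i j)) => t; rewrite mxE. Qed.

Lemma polymxB m n (A B : tup -> 'M[R]_(m, n)) :
  polymx A -> polymx B -> polymx (fun t => A t - B t).
Proof. by move=> hA hB; apply: polymxD => //; exact: polymxN. Qed.

Lemma polymxZ m n (f : tup -> R) (A : tup -> 'M[R]_(m, n)) :
  polyfun f -> polymx A -> polymx (fun t => f t *: A t).
Proof.
by move=> hf hA i j; apply: polyfun_eq (polyfunM hf (hA i j)) => t; rewrite mxE.
Qed.

Lemma polymxM m n p (A : tup -> 'M[R]_(m, n)) (B : tup -> 'M[R]_(n, p)) :
  polymx A -> polymx B -> polymx (fun t => A t *m B t).
Proof.
move=> hA hB i j; apply: (@polyfun_eq _ _ (fun t => \sum_k A t i k * B t k j)).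
  by move=> t; rewrite mxE.
by apply: polyfun_sum => k _; exact: polyfunM.
Qed.

Lemma polymx_sum m n (I : Type) (r : seq I) (P : pred I) (A : I -> tup -> 'M[R]_(m, n)) :
  (forall i, P i -> polymx (A i)) -> polymx (fun t => \sum_(i <- r | P i) A i t).
Proof.
move=> hA i j; apply: (@polyfun_eq _ _ (fun t => \sum_(k <- r | P k) A k t i j)).
  by move=> t; rewrite summxE.
by apply: polyfun_sum => k Pk; exact: hA.
Qed.

Lemma polymx_tr m n (A : tup -> 'M[R]_(m, n)) : polymx A -> polymx (fun t => (A t)^T).
Proof. by move=> hA i j; apply: polyfun_eq (hA j i) => t; rewrite mxE. Qed.

Lemma polymx_block m1 m2 n1 n2 (A : tup -> 'M[R]_(m1, n1)) (B : tup -> 'M[R]_(m1, n2))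
    (C : tup -> 'M[R]_(m2, n1)) (D : tup -> 'M[R]_(m2, n2)) :
  polymx A -> polymx B -> polymx C -> polymx D ->
  polymx (fun t => block_mx (A t) (B t) (C t) (D t)).
Proof.
move=> hA hB hC hD i j.
case: (split_ordP i) => i' ->; case: (split_ordP j) => j' ->.
- by apply: polyfun_eq (hA i' j') => x; rewrite block_mxEul.
- by apply: polyfun_eq (hB i' j') => x; rewrite block_mxEur.
- by apply: polyfun_eq (hC i' j') => x; rewrite block_mxEdl.
- by apply: polyfun_eq (hD i' j') => x; rewrite block_mxEdr.
Qed.

Lemma polymx_usub m1 m2 n (A : tup -> 'M[R]_(m1 + m2, n)) :
  polymx A -> polymx (fun t => usubmx (A t)).
Proof. by move=> hA i j; apply: polyfun_eq (hA (lshift _ i) j) => t; rewrite mxE. Qed.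

Lemma polymx_dsub m1 m2 n (A : tup -> 'M[R]_(m1 + m2, n)) :
  polymx A -> polymx (fun t => dsubmx (A t)).
Proof. by move=> hA i j; apply: polyfun_eq (hA (rshift _ i) j) => t; rewrite mxE. Qed.

Lemma polyfun_det n (A : tup -> 'M[R]_n) : polymx A -> polyfun (fun t => \det (A t)).
Proof.
move=> hA; apply: polyfun_sum => s _; apply: polyfunM; first exact: polyfun_cst.
by apply: polyfun_prod => i _; exact: hA.
Qed.

(** The reason for working with adjugates: unlike the inverse, they stay polynomial in the
    lengths. *)
Lemma polymx_adj n (A : tup -> 'M[R]_n) : polymx A -> polymx (fun t => \adj (A t)).
Proof.
move=> hA i j; apply: (@polyfun_eq _ _ (fun t => (-1) ^+ (j + i) *
    \det (row' j (col' i (A t))))) => [t|]; first by rewrite mxE.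
apply: polyfunM; first exact: polyfun_cst.
apply: polyfun_det => k l.
by apply: polyfun_eq (hA (lift j k) (lift i l)) => t; rewrite !mxE.
Qed.

Lemma polyfun_dot (a b : tup -> 'cV[R]_3) : polymx a -> polymx b ->
  polyfun (fun t => dot (a t) (b t)).
Proof.
move=> ha hb; exact: (polyfunD (polyfunD (polyfunM (ha 0 0) (hb 0 0))
  (polyfunM (ha 1 0) (hb 1 0))) (polyfunM (ha 2 0) (hb 2 0))).
Qed.

Lemma polymx_cross (a b : tup -> 'cV[R]_3) : polymx a -> polymx b ->
  polymx (fun t => cross (a t) (b t)).
Proof.
move=> ha hb i j.
apply: (@polyfun_eq _ _ (fun t => a t (i + 1) 0 * b t (i + 2) 0 -
   a t (i + 2) 0 * b t (i + 1) 0)) => [t|]; first by rewrite mxE.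
exact: (polyfunB (polyfunM (ha _ _) (hb _ _)) (polyfunM (ha _ _) (hb _ _))).
Qed.

End PolynomialMatrices.

(** * The two nondegeneracy conditions: pitch and turning *)

Section Nondegeneracy.
Context {R : realType}.
Implicit Types (M B : 'M[R]_(3 + 3)) (k v w : 'cV[R]_3).

(* [spin_vec M = \det M * invmx M (0; ez)], the twist of links [1], ..., [N - 1] (up to
   scale) when they spin rigidly around link [0]. *)
Definition spin_vec M : 'cV[R]_(3 + 3) := \adj M *m col_mx 0 ez.

(* Up to positive factors, the pitch of the screw motion performed by a spinning swimmer. *)
Definition pitch M := dot (usubmx (spin_vec M)) (dsubmx (spin_vec M)).

(* [(\det M)^2] times the derivative, in the laboratory frame, of the spin axis when
   links [1], ..., [N - 1] rotate rigidly with angular velocity [k]. *)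
Definition axis_drift M B k : 'cV[R]_3 :=
  cross (dsubmx (\adj M *m (B *m col_mx 0 k))) (dsubmx (spin_vec M))
  - \det M *: dsubmx (\adj M *m col_mx 0 (cross k ez))
  + dsubmx (\adj M *m ((diag2 (cross_mx k) *m B - B *m diag2 (cross_mx k)) *m spin_vec M)).

(** A squared length, so that one scalar polynomial expresses that the spin axis changes direction
    and not only size. *)
Definition turning M B k :=
  let c := cross (axis_drift M B k) (dsubmx (spin_vec M)) in dot c c.

Lemma unitmx_inj n (M : 'M[R]_n) :
  (forall y : 'cV[R]_n, M *m y = 0 -> y = 0) -> M \in unitmx.
Proof.
move=> Minj; rewrite -unitmx_tr -row_free_unit -kermx_eq0; apply/eqP/row_matrixP => i.
rewrite row0; apply: trmx_inj; rewrite trmx0; apply: Minj.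
apply: trmx_inj; rewrite trmx_mul trmxK trmx0.
by have /sub_kermxP := row_sub i (kermx M^T).
Qed.

Lemma positive_definite_unitmx n (M : 'M[R]_n) : positive_definite M -> M \in unitmx.
Proof.
move=> [_ pM]; apply: unitmx_inj => y My; apply: contrapT => /eqP /pM.
by rewrite -mulmxA My mulmx0 mxE ltxx.
Qed.

Lemma adj_mul_col n (M : 'M[R]_n) (y b : 'cV[R]_n) : M *m y = b -> \adj M *m b = \det M *: y.
Proof. by move=> <-; rewrite mulmxA mul_adj_mx mul_scalar_mx. Qed.

End Nondegeneracy.

Section Vec3Arithmetic.
Context {R : realType}.
Implicit Types a b c x y z k : R.

Lemma vec3Z k a b c : k *: vec3 a b c = vec3 (k * a) (k * b) (k * c).
Proof. by apply: col3P; rewrite mxE !vec3E. Qed.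

Lemma vec3D a b c x y z : vec3 a b c + vec3 x y z = vec3 (a + x) (b + y) (c + z).
Proof. by apply: col3P; rewrite mxE !vec3E. Qed.

Lemma vec3N a b c : - vec3 a b c = vec3 (- a) (- b) (- c).
Proof. by apply: col3P; rewrite mxE !vec3E. Qed.

Lemma cross_vec3 a b c x y z : cross (vec3 a b c) (vec3 x y z) =
  vec3 (b * z - c * y) (c * x - a * z) (a * y - b * x).
Proof. by apply: col3P; rewrite crossE !vec3E. Qed.

Lemma dot_vec3 a b c x y z : dot (vec3 a b c) (vec3 x y z) = a * x + b * y + c * z.
Proof. by rewrite /dot !vec3E. Qed.

Lemma vec3_eta (v : 'cV[R]_3) : v = vec3 (v 0 0) (v 1 0) (v 2 0).
Proof. by apply: col3P; rewrite vec3E. Qed.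

Lemma vec3_0 : 0 = vec3 0 0 0 :> 'cV[R]_3.
Proof. by apply: col3P; rewrite vec3E mxE. Qed.

Definition vec3S := (vec3Z, vec3D, vec3N, cross_vec3, dot_vec3).

End Vec3Arithmetic.

(** * Explicit solution for two unit links at a right angle *)

Section ReferenceShape.
Context {R : realType} (Cpar Cperp Ctau : R) {N : nat}.
Hypothesis (hpar : 0 < Cpar) (hperp : Cpar < Cperp) (hN : (2 < N)%N).
Variable s : swimmer_shape R N.
Local Notation p := Cpar.
Local Notation q := Cperp.

Let i0 : 'I_N := Ordinal (ltn_trans (ltn0Sn 1) hN).
Let i1 : 'I_N := Ordinal (ltn_trans (ltnSn 1) hN).
Let i2 : 'I_N := Ordinal hN.

Definition ex : 'cV[R]_3 := vec3 1 0 0.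
(** The 3-4-5 triangle keeps all coordinates rational; with [n2 = cross ex e2] it gives an
    orthonormal frame adapted to the two links, in which [ez] is along neither [e2] nor [n2]. *)
Definition e2 : 'cV[R]_3 := vec3 0 (4 / 5) (3 / 5).
Definition n2 : 'cV[R]_3 := vec3 0 (- (3 / 5)) (4 / 5).

Hypothesis (s1 : link_dir s i1 = ex) (s2 : link_dir s i2 = e2).

(* Only one length vector with nonzero pitch and turning is needed; degenerate lengths
   are allowed, and two unit links at an angle make the system explicitly solvable. *)
Definition ell_ref : N.-tuple R :=
  [tuple (((i == i1) || (i == i2))%:R : R) | i < N].

Let ell1 : tnth ell_ref i1 = 1. Proof. by rewrite tnth_mktuple eqxx. Qed.
Let ell2 : tnth ell_ref i2 = 1. Proof. by rewrite tnth_mktuple eqxx orbT. Qed.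
Let ell_other i : i != i1 -> i != i2 -> tnth ell_ref i = 0.
Proof. by rewrite tnth_mktuple => /negPf -> /negPf ->. Qed.

Let M : 'M[R]_(3 + 3) := resistance_mx p q Ctau ell_ref s.

Definition D1 : 'M[R]_3 := (p - q) *: tensor ex ex + q *: 1%:M.
Definition D2 : 'M[R]_3 := (p - q) *: tensor e2 e2 + q *: 1%:M.
Definition C1 : 'M[R]_3 := (q / 2) *: cross_mx ex.
Definition C2 : 'M[R]_3 := cross_mx ex *m D2 + (q / 2) *: cross_mx e2.
Definition J1 : 'M[R]_3 := (q / 3) *: (1%:M - tensor ex ex).
Definition J2 : 'M[R]_3 := - ((p - q) *: (cross_mx ex *m tensor e2 e2 *m cross_mx ex))
  - q *: (cross_mx ex *m cross_mx ex)
  - (q / 2) *: (cross_mx e2 *m cross_mx ex + cross_mx ex *m cross_mx e2)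
  + (q / 3) *: (1%:M - tensor e2 e2).

Lemma link_mx_zero i : tnth ell_ref i = 0 -> link_mx p q Ctau ell_ref s i = 0.
Proof.
move=> l0; rewrite /link_mx /C_link /J_link l0 !expr0n /= !mul0r !scale0r.
by rewrite !(subr0, addr0, oppr0, trmx0) if_same block_mx_const.
Qed.

Lemma resistance_ref : M = block_mx (D1 + D2) (C1 + C2)^T (C1 + C2) (J1 + J2).
Proof.
have i12 : i2 != i1 by [].
rewrite /M resistance_sum (bigD1 i1)//= (bigD1 i2)//= big1 ?addr0; last first.
  by move=> i /andP[? ?]; apply: link_mx_zero; exact: ell_other.
have A1 : arm_mx ell_ref s i1 = 0.
  by rewrite /arm_mx big_pred0// => j /=; case: (nat_of_ord j).
have A2 : arm_mx ell_ref s i2 = cross_mx ex.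
  rewrite /arm_mx (big_pred1 i1) ?ell1 ?s1 ?scale1r// => j /=.
  by apply/idP/idP => [|/eqP ->//]; case: j => -[|[|//]] hj //= _; apply/eqP/val_inj.
rewrite /link_mx /C_link /J_link A1 A2 /drag_mx s1 s2 ell1 ell2 /= !expr1n !mul1r.
rewrite !(mul0mx, mulmx0, scaler0, addr0, add0r, subr0, oppr0, scale1r).
rewrite add_block_mx -linearD /= ![_^-1 * _]mulrC.
congr block_mx.
Qed.

(** Links along [ex] and [e2] form an L. Reflection in its plane separates planar motions (velocity
    in the plane, spin along [n2]) from the others, so the system splits: [ref_wy] answers a torque
    along [e2], [ref_wz] one along [n2]. *)
Definition ref_wy (al : R) := 15 * al / (2 * q).
Definition ref_wz (be : R) := be / (q * (2 / 3 - q / (2 * (p + q)))).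

Definition ref_w (al be : R) : 'cV[R]_3 :=
  (3 / 5 * ref_wy al) *: ex + ref_wy al *: e2 + ref_wz be *: n2.

Definition ref_v (al be : R) : 'cV[R]_3 :=
  (q / 2 * ref_wz be / (p + q)) *: (ex + e2) + (3 / 5 * ref_wy al) *: n2
  - ref_wz be *: e2.

Let tensorv (a b c : 'cV[R]_3) : tensor a b *m c = dot b c *: a.
Proof. rewrite /tensor -mulmxA; apply: col3P; rewrite !(mxE, big_ord1, sum3) /dot; ring. Qed.

Lemma resistance_refE (v w : 'cV[R]_3) : M *m col_mx v w = col_mx
  ((p - q) *: (dot ex v *: ex) + q *: v + ((p - q) *: (dot e2 v *: e2) + q *: v)
   - (q / 2) *: cross ex w - (p - q) *: (dot e2 (cross ex w) *: e2) - q *: cross ex w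
   - (q / 2) *: cross e2 w)
  ((q / 2) *: cross ex v + cross ex ((p - q) *: (dot e2 v *: e2) + q *: v)
   + (q / 2) *: cross e2 v + (q / 3) *: (w - dot ex w *: ex)
   - (p - q) *: cross ex (dot e2 (cross ex w) *: e2) - q *: cross ex (cross ex w)
   - (q / 2) *: (cross e2 (cross ex w) + cross ex (cross e2 w))
   + (q / 3) *: (w - dot e2 w *: e2)).
Proof.
have trD (a b : 'M[R]_3) : (a + b)^T = a^T + b^T by rewrite linearD.
have trZ c (a : 'M[R]_3) : (c *: a)^T = c *: a^T by rewrite linearZ.
rewrite resistance_ref mul_block_col /C1 /C2 /J1 /J2 /D1 /D2.
rewrite !trD trmx_mul !trZ !trD !trZ trmx1 !tensor_tr !cross_mx_tr.
have h1 := tensorv ex ex; have h2 := tensorv e2 e2.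
move: (tensor ex ex) (tensor e2 e2) h1 h2 => T1 T2 h1 h2.
congr col_mx; do 3 rewrite ?(mulmxDl, mulNmx, mul1mx) -?scalemxAl -?mulmxA;
  rewrite !cross_mxE !h1 !h2 [v]vec3_eta [w]vec3_eta /ex /e2 /n2 !vec3S;
  by apply: col3P; rewrite !vec3E; ring.
Qed.

Lemma ref_solution al be : M *m col_mx (ref_v al be) (ref_w al be) =
  col_mx 0 (al *: e2 + be *: n2).
Proof.
have qp := lt_trans hpar hperp; have q0 : q != 0 by rewrite gt_eqF.
have pq0 : p + q != 0 by rewrite gt_eqF// addr_gt0.
have pq1 : 4 * p + q != 0 by rewrite gt_eqF// addr_gt0// mulr_gt0.
rewrite resistance_refE.
pose k := q / 2 * ref_wz be / (p + q).
(* These three relations are all that is used of the fractions; afterwards the six equations are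
   linear in products such as [q * wy]. *)
have r1 : 2 * (q * ref_wy al) = 15 * al by rewrite /ref_wy; field.
have r2 : q * k + p * k = q * ref_wz be / 2 by rewrite /k; field.
have r3 : 2 / 3 * (q * ref_wz be) - q * k = be.
  rewrite /k /ref_wz; field.
  by rewrite q0 pq0 (_ : 2 * (2 * (p + q)) + _ = 4 * p + q) ?pq1//; ring.
rewrite /ref_v /ref_w -/k; move: (ref_wy al) (ref_wz be) k r1 r2 r3 => wy wz k r1 r2 r3.
rewrite /ex /e2 /n2 !vec3S vec3_0.
by congr col_mx; apply: col3P; rewrite !vec3E; lra.
Qed.

(** Positive definiteness is assumed only for the lengths of the swimmer under study, so it is no
    help at [ell_ref]. Pairing the kernel equations with the kernel vector itself gives the
    dissipated power. *)
Lemma resistance_ref_unitmx : M \in unitmx.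
Proof.
have e0 : (0 : 'cV[R]_(3 + 3)) = col_mx 0 0 by rewrite col_mx0.
apply: unitmx_inj => y; rewrite -[y]vsubmxK resistance_refE e0 vec3_0.
move: (usubmx y) (dsubmx y) => v w /eq_col_mx[].
rewrite [v]vec3_eta [w]vec3_eta.
move: (v 0 0) (v 1 0) (v 2 0) (w 0 0) (w 1 0) (w 2 0) => a b c x y' z.
rewrite /ex /e2 !vec3S => hF hT.
have F0 := congr1 (fun u : 'cV_3 => u 0 0) hF.
have F1 := congr1 (fun u : 'cV_3 => u 1 0) hF.
have F2 := congr1 (fun u : 'cV_3 => u 2 0) hF.
have T0 := congr1 (fun u : 'cV_3 => u 0 0) hT.
have T1 := congr1 (fun u : 'cV_3 => u 1 0) hT.
have T2 := congr1 (fun u : 'cV_3 => u 2 0) hT.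
rewrite /= !vec3E in F0 F1 F2 T0 T1 T2.
have comb X0 X1 X2 X3 X4 X5 : X0 = 0 -> X1 = 0 -> X2 = 0 -> X3 = 0 -> X4 = 0 -> X5 = 0 ->
  a * X0 + b * X1 + c * X2 + x * X3 + y' * X4 + z * X5 = 0.
  by move=> -> -> -> -> -> ->; ring.
have qp := lt_trans hpar hperp.
(* The dissipated power is a sum of squares. *)
have E : p * a ^+ 2 + q * (b + z / 2) ^+ 2 + q * z ^+ 2 / 12 + q * (c - y' / 2) ^+ 2
    + q * y' ^+ 2 / 12 + p * (4 / 5 * (b + z) + 3 / 5 * (c - y')) ^+ 2
    + q * (a - (4 / 5 * z - 3 / 5 * y') / 2) ^+ 2 + q * (4 / 5 * z - 3 / 5 * y') ^+ 2 / 12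
    + q * (4 / 5 * (c - y') - 3 / 5 * (b + z) + x / 2) ^+ 2 + q * x ^+ 2 / 12 = 0.
  by rewrite -(comb _ _ _ _ _ _ F0 F1 F2 T0 T1 T2); field.
have sq k (t : R) : 0 < k -> 0 <= k * t ^+ 2 by move=> k0; rewrite mulr_ge0 ?sqr_ge0// ltW.
have := (sq p a hpar, sq q (b + z / 2) qp, sq q z qp, sq q (c - y' / 2) qp, sq q y' qp).
have := (sq p (4 / 5 * (b + z) + 3 / 5 * (c - y')) hpar,
  sq q (a - (4 / 5 * z - 3 / 5 * y') / 2) qp, sq q (4 / 5 * z - 3 / 5 * y') qp,
  sq q (4 / 5 * (c - y') - 3 / 5 * (b + z) + x / 2) qp, sq q x qp).
move=> [[[[s6 s7] s8] s9] s10] [[[[s1' s2'] s3] s4] s5].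
have sq0 k (t : R) : 0 < k -> k * t ^+ 2 = 0 -> t = 0.
  by move=> k0 /eqP; rewrite mulf_eq0 gt_eqF//= sqrf_eq0 => /eqP.
have a0 : a = 0 by apply: (sq0 p) => //; lra.
have z0 : z = 0 by apply: (sq0 q) => //; lra.
have y0 : y' = 0 by apply: (sq0 q) => //; lra.
have x0 : x = 0 by apply: (sq0 q) => //; lra.
have b0 : b + z / 2 = 0 by apply: (sq0 q) => //; lra.
have c0 : c - y' / 2 = 0 by apply: (sq0 q) => //; lra.
rewrite z0 mul0r addr0 in b0; rewrite y0 mul0r subr0 in c0.
by rewrite a0 b0 c0 x0 y0 z0.
Qed.

(** Link 0 has length 0 in [ell_ref]; only the middle term of [axis_drift] survives there. *)
Lemma base_mx_ref : base_mx p q Ctau ell_ref s = 0.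
Proof.
have l0 : tnth ell_ref i0 = 0 by exact: ell_other.
rewrite (base_mxE p q Ctau ell_ref (i0 := i0))// l0 !expr0n /= !mul0r !scale0r trmx0.
by rewrite addr0 block_mx_const.
Qed.

Lemma ez_e2n2 : (ez : 'cV[R]_3) = (3 / 5) *: e2 + (4 / 5) *: n2.
Proof. by rewrite /ez /e2 /n2 !vec3S; apply: col3P; rewrite !vec3E; lra. Qed.

Let detM : \det M != 0.
Proof. by rewrite -unitfE -unitmxE resistance_ref_unitmx. Qed.

Let spin_ref : spin_vec M = \det M *: col_mx (ref_v (3 / 5) (4 / 5)) (ref_w (3 / 5) (4 / 5)).
Proof. by apply: adj_mul_col; rewrite ref_solution -ez_e2n2. Qed.

Let ref_wy_gt0 al : 0 < al -> 0 < ref_wy al.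
Proof. by move=> a0; rewrite divr_gt0 ?mulr_gt0// (lt_trans hpar). Qed.

Let ref_wz_gt0 be : 0 < be -> 0 < ref_wz be.
Proof.
move=> b0; have qp := lt_trans hpar hperp; rewrite divr_gt0// mulr_gt0//.
by have hp := hpar; rewrite subr_gt0 ltr_pdivrMr ?mulr_gt0 ?addr_gt0//; lra.
Qed.

(** The pitch comes out proportional to [q - p]: it is the anisotropy of the drag that makes the
    screw advance. *)
Lemma pitch_ref : pitch M != 0.
Proof.
have qp := lt_trans hpar hperp; have pq0 : p + q != 0 by rewrite gt_eqF// addr_gt0.
rewrite /pitch spin_ref scale_col_mx col_mxKu col_mxKd dotZl dotZr !mulf_neq0//.
have a0 : (0 : R) < 3 / 5 by lra.
have b0 : (0 : R) < 4 / 5 by lra.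
have := ref_wy_gt0 a0; have := ref_wz_gt0 b0; rewrite /ref_v /ref_w.
move: (ref_wz _) (ref_wy _) => wz wy wz0 wy0.
rewrite /ex /e2 /n2 !vec3S (_ : _ + _ = wz * wy * 2 / 5 * (q - p) / (p + q)); last by field.
by rewrite gt_eqF// divr_gt0 ?addr_gt0// !mulr_gt0// subr_gt0.
Qed.

Lemma turning_ref : turning M (base_mx p q Ctau ell_ref s) (- ex) != 0.
Proof.
have qp := lt_trans hpar hperp; have pq0 : p + q != 0 by rewrite gt_eqF// addr_gt0.
rewrite /turning /axis_drift base_mx_ref !(mul0mx, mulmx0) subrr mul0mx mulmx0.
have -> : cross (- ex) ez = (4 / 5) *: e2 + (- (3 / 5)) *: n2.
  by rewrite /ex /ez /e2 /n2 !vec3S; apply: col3P; rewrite !vec3E; lra.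
have -> : \adj M *m col_mx 0 ((4 / 5) *: e2 + (- (3 / 5)) *: n2) =
    \det M *: col_mx (ref_v (4 / 5) (- (3 / 5))) (ref_w (4 / 5) (- (3 / 5))).
  by apply: adj_mul_col; rewrite ref_solution.
rewrite spin_ref !scale_col_mx !col_mxKd linear0.
have a0 : (0 : R) < 3 / 5 by lra.
have b0 : (0 : R) < 4 / 5 by lra.
have wzN : ref_wz (- (3 / 5)) = - ref_wz (3 / 5) by rewrite /ref_wz mulNr.
have y1 := ref_wy_gt0 a0; have y2 := ref_wy_gt0 b0.
have z1 := ref_wz_gt0 a0; have z2 := ref_wz_gt0 b0.
rewrite /ref_w wzN; move: (ref_wy (3 / 5)) (ref_wy (4 / 5)) (ref_wz (3 / 5))
  (ref_wz (4 / 5)) y1 y2 z1 z2 => wy wy' wz' wz y1 y2 z1 z2.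
(* The component along [ex] suffices: up to sign it is [d ^+ 3] times a sum of products of positive
   numbers. *)
apply/eqP => /dot_eq0 /(congr1 (dot ex)); move: detM; set d := \det M => d0.
rewrite addr0 vec3_0 /ex /e2 /n2 !vec3S => /eqP.
rewrite (_ : _ == _ = (d ^+ 3 * (wy' * wz + wz' * wy) == 0)); last first.
  by rewrite -oppr_eq0; congr (_ == _); field.
by rewrite mulf_eq0 expf_eq0 /= (negPf d0) gt_eqF// addr_gt0// mulr_gt0.
Qed.

End ReferenceShape.

(** * Nondegeneracy of generic lengths *)

Section GenericLengths.
Context {R : realType} (Cpar Cperp Ctau : R) {N : nat}.
Variable s : swimmer_shape R N.
Local Notation tup := (N.-tuple (measurableTypeR R)).

Lemma polymx_arm i : polymx (fun t : tup => arm_mx t s i).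
Proof.
apply: polymx_sum => j _; apply: polymxZ; first exact: polyfun_coord.
exact: polymx_cst.
Qed.

Lemma polyfun_coordX (i : 'I_N) m c : polyfun (fun t : tup => tnth t i ^+ m / c : R).
Proof. exact: (polyfunM (polyfunX m (polyfun_coord i)) (polyfun_cst N c^-1)). Qed.

Lemma polymx_C_link i : polymx (fun t : tup => C_link Cpar Cperp t s i).
Proof.
apply: polymxD; apply: polymxZ.
- exact: polyfun_coord.
- by apply: polymxM; [exact: polymx_arm|exact: polymx_cst].
- exact: (polyfunM (polyfun_coordX i 2 2) (polyfun_cst N Cperp)).
- exact: polymx_cst.
Qed.

Lemma polymx_J_link i : polymx (fun t : tup => J_link Cpar Cperp Ctau t s i).
Proof.
have pc (A : 'M[R]_3) : polymx (fun _ : tup => A) by exact: polymx_cst.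
have pa := polymx_arm i.
rewrite /J_link; case: (nat_of_ord i == 0%N).
  apply: polymxD; apply: polymxZ => //.
    exact: (polyfunM (polyfun_coordX i 3 3) (polyfun_cst N Cperp)).
  exact: (polyfunM (polyfun_coord i) (polyfun_cst N Ctau)).
apply: polymxD; last first.
  apply: polymxZ => //.
  exact: (polyfunM (polyfun_coordX i 3 3) (polyfun_cst N Cperp)).
apply: polymxB; last first.
  apply: polymxZ; first exact: (polyfunM (polyfun_coordX i 2 2) (polyfun_cst N Cperp)).
  by apply: polymxD; apply: polymxM.
apply: polymxB; last first.
  apply: polymxZ; last exact: polymxM.
  exact: (polyfunM (polyfun_coord i) (polyfun_cst N Cperp)).
apply: polymxN; apply: polymxZ.
  exact: (polyfunM (polyfun_coord i) (polyfun_cst N (Cpar - Cperp))).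
by apply: polymxM => //; apply: polymxM.
Qed.

Lemma polymx_link i : polymx (fun t : tup => link_mx Cpar Cperp Ctau t s i).
Proof.
apply: polymx_block.
- by apply: polymxZ; [exact: polyfun_coord|exact: polymx_cst].
- by apply: polymx_tr; exact: polymx_C_link.
- exact: polymx_C_link.
- exact: polymx_J_link.
Qed.

Lemma polymx_resistance : polymx (fun t : tup => resistance_mx Cpar Cperp Ctau t s).
Proof.
move=> i j; apply: (@polyfun_eq _ _ (fun t => (\sum_k link_mx Cpar Cperp Ctau t s k) i j)).
  by move=> t; rewrite resistance_sum.
by apply: polymx_sum => k _; exact: polymx_link.
Qed.

Lemma polymx_base : polymx (fun t : tup => base_mx Cpar Cperp Ctau t s).
Proof. by apply: polymx_sum => k _; exact: polymx_link. Qed.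

Lemma polymx_spin (M : tup -> 'M[R]_(3 + 3)) : polymx M -> polymx (fun t => spin_vec (M t)).
Proof. by move=> hM; apply: polymxM; [exact: polymx_adj|exact: polymx_cst]. Qed.

Lemma polyfun_pitch (M : tup -> 'M[R]_(3 + 3)) : polymx M -> polyfun (fun t => pitch (M t)).
Proof.
move=> /polymx_spin hM; apply: polyfun_dot; first exact: polymx_usub.
exact: polymx_dsub.
Qed.

Lemma polyfun_turning (M B : tup -> 'M[R]_(3 + 3)) k : polymx M -> polymx B ->
  polyfun (fun t => turning (M t) (B t) k).
Proof.
move=> hM hB; have hs := polymx_dsub (polymx_spin hM).
have ha := polymx_adj hM.
have pc m n (A : 'M[R]_(m, n)) : polymx (fun _ : tup => A) by exact: polymx_cst.
suff hD : polymx (fun t => axis_drift (M t) (B t) k).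
  by apply: polyfun_dot; apply: polymx_cross.
apply: polymxD; last first.
  apply: polymx_dsub; apply: polymxM => //; apply: polymxM; last exact: polymx_spin.
  by apply: polymxB; apply: polymxM.
apply: polymxB; last first.
  apply: polymxZ; first exact: polyfun_det.
  by apply: polymx_dsub; apply: polymxM.
apply: polymx_cross => //; apply: polymx_dsub; apply: polymxM => //.
exact: polymxM.
Qed.

Lemma negligible_zero (f : tup -> R) t0 : polyfun f -> f t0 != 0 ->
  {ae @lebesgue_tuple R N, forall t, f t != 0}.
Proof.
move=> pf f0; have [A [mA A0 sA]] := null_polyfun pf f0; exists A; split => //.
by move=> t /= /negP; rewrite negbK => /eqP; exact: sA.
Qed.

Hypothesis (hpar : 0 < Cpar) (hperp : Cpar < Cperp) (hN : (2 < N)%N).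
Hypothesis s1 : link_dir s (Ordinal (ltn_trans (ltnSn 1) hN)) = ex.
Hypothesis s2 : link_dir s (Ordinal hN) = e2.

(** Each polynomial may be tested at its own lengths: all ones for the length of a single link, and
    [ell_ref], where link 0 is degenerate, for the other two. *)
Theorem generic_lengths (i0 : 'I_N) :
  {ae @lebesgue_tuple R N, forall ell : N.-tuple (measurableTypeR R),
    [/\ tnth ell i0 != 0 :> R, pitch (resistance_mx Cpar Cperp Ctau ell s) != 0 &
      turning (resistance_mx Cpar Cperp Ctau ell s)
        (base_mx Cpar Cperp Ctau ell s) (- ex) != 0]}.
Proof.
have [m em] := @lebesgue_tuple_sigma_finite R N; rewrite em.
have h1 : {ae m, forall t : tup, tnth t i0 != 0 :> R}.
  rewrite -em; apply: (@negligible_zero _ [tuple 1 | i < N]).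
    exact: polyfun_coord.
  by rewrite tnth_mktuple oner_eq0.
have h2 := negligible_zero (polyfun_pitch polymx_resistance)
  (pitch_ref Ctau hpar hperp s1 s2).
have h3 := negligible_zero (polyfun_turning (- ex) polymx_resistance polymx_base)
  (turning_ref Ctau hpar hperp s1 s2).
rewrite em in h2 h3; apply: filterS3 h1 h2 h3 => t h1 h2 h3; split; [exact: h1|exact: h2|exact: h3].
Qed.

End GenericLengths.

(** * Rigid motions as solutions of differential equations *)

Section AbsoluteContinuityClosure.
Context {R : realType}.
Variables (a b : R).
Local Notation ac := (@absolutely_continuous R R a b).

(** The common criterion behind sums, opposites and products of bounded functions: control of
    increments passes through sums over intervals. *)
Lemma ac_comb (f g h : R -> R) (k : R) : 0 < k ->
  (forall x y, a <= x <= b -> a <= y <= b ->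
    `|h y - h x| <= k * (`|f y - f x| + `|g y - g x|)) ->
  ac f -> ac g -> ac h.
Proof.
move=> k0 hfg acf acg e e0; have e2 : 0 < e / k / 2 by rewrite !divr_gt0.
have [d1 d10 f1] := acf _ e2; have [d2 d20 g2] := acg _ e2.
exists (Num.min d1 d2) => [|n x y xy tri]; first by rewrite lt_min d10.
rewrite lt_min => /andP[/(f1 n x y xy tri) fe /(g2 n x y xy tri) ge].
apply: (@le_lt_trans _ _ (k * (\sum_(i < n) `|f (y i) - f (x i)| +
    \sum_(i < n) `|g (y i) - g (x i)|))).
  rewrite -big_split mulr_sumr; apply: ler_sum => i _ /=.
  have [ax [xyi yb]] := xy i.
  by apply: hfg; [rewrite ax (le_trans xyi)|rewrite yb (le_trans ax)].
rewrite mulrC -ltr_pdivlMr//; have := ltrD fe ge.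
by rewrite -splitr.
Qed.

Lemma acD (f g : R -> R) : ac f -> ac g -> ac (fun x => f x + g x).
Proof.
apply: (@ac_comb _ _ _ 1) => // x y _ _; rewrite mul1r opprD addrACA.
exact: ler_normD.
Qed.

Lemma acN (f : R -> R) : ac f -> ac (fun x => - f x).
Proof.
move=> acf; apply: (@ac_comb f f _ 1 ltr01 _ acf acf) => x y _ _.
by rewrite mul1r -opprD normrN lerDl.
Qed.

Lemma acM (f g : R -> R) (B : R) : (forall x, a <= x <= b -> `|f x| <= B) ->
  (forall x, a <= x <= b -> `|g x| <= B) -> ac f -> ac g -> ac (fun x => f x * g x).
Proof.
move=> fB gB; apply: (@ac_comb _ _ _ (`|B| + 1)); first by rewrite ltr_wpDl.
move=> x y xab yab.
have -> : f y * g y - f x * g x = (f y - f x) * g y + f x * (g y - g x) by ring.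
apply: (le_trans (ler_normD _ _)); rewrite !normrM mulrDr lerD//.
  rewrite mulrC ler_wpM2r//; apply: (le_trans (gB y yab)).
  by rewrite (le_trans (ler_norm _))// lerDl.
rewrite ler_wpM2r//; apply: (le_trans (fB x xab)).
by rewrite (le_trans (ler_norm _))// lerDl.
Qed.

Lemma ac_sum (I : Type) (r : seq I) (F : I -> R -> R) :
  (forall i, ac (F i)) -> ac (fun x => \sum_(i <- r) F i x).
Proof.
move=> hF; elim: r => [|i r ih].
  by move=> e e0; exists 1 => // n x y _ _ _; rewrite big1// => i _; rewrite !big_nil subrr normr0.
apply: (@ac_comb (F i) (fun x => \sum_(j <- r) F j x) _ 1) => // x y _ _.
by rewrite !big_cons mul1r opprD addrACA ler_normD.
Qed.

Lemma ac_mulmx n m p (A : R -> 'M[R]_(n, m)) (C : R -> 'M[R]_(m, p)) (B : R) :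
  (forall i j x, a <= x <= b -> `|A x i j| <= B) ->
  (forall i j x, a <= x <= b -> `|C x i j| <= B) ->
  (forall i j, ac (fun x => A x i j)) -> (forall i j, ac (fun x => C x i j)) ->
  forall i j, ac (fun x => (A x *m C x) i j).
Proof.
move=> AB CB acA acC i j.
have -> : (fun x => (A x *m C x) i j) = (fun x => \sum_k A x i k * C x k j).
  by apply/funext => x; rewrite mxE.
by apply: ac_sum => k; apply: (acM (B := B)) => // x; [exact: AB|exact: CB].
Qed.

Lemma ac_mx n m (A : R -> 'M[R]_(n.+1, m.+1)) :
  absolutely_continuous a b A -> forall i j, ac (fun x => A x i j).
Proof.
move=> acA i j e e0; have [d d0 dA] := acA e e0; exists d => // k x y xy tri xyd.
apply: le_lt_trans (dA k x y xy tri xyd); apply: ler_sum => l _.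
have -> : A (y l) i j - A (x l) i j = (A (y l) - A (x l)) i j by rewrite !mxE.
rewrite [leRHS]/Num.Def.normr/= mx_normrE.
exact: (le_bigmax _ (fun ij => `|(A (y l) - A (x l)) ij.1 ij.2|) (i, j)).
Qed.

Lemma lipschitz_mx n m (A : R -> 'M[R]_(n.+1, m.+1)) :
  (forall i j, lipschitz_itv a b (fun x => A x i j)) -> lipschitz_itv a b A.
Proof.
move=> lA.
have [L hL] : {L : 'I_n.+1 -> 'I_m.+1 -> R | forall i j, 0 < L i j /\
    forall x y, a <= x <= b -> a <= y <= b ->
      `|A y i j - A x i j| <= L i j * `|y - x|}.
  exists (fun i j => sval (cid2 (lA i j))) => i j.
  by case: cid2.
pose S := \sum_i \sum_j L i j.
have LS i j : L i j <= S.
  rewrite /S (bigD1 i)//= (bigD1 j)//= -addrA lerDl addr_ge0//.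
    by apply: sumr_ge0 => k _; have [/ltW] := hL i k.
  by apply: sumr_ge0 => k _; apply: sumr_ge0 => l _; have [/ltW] := hL k l.
exists S => [|x y xab yab].
  by apply: lt_le_trans (LS ord0 ord0); have [] := hL ord0 ord0.
rewrite [leLHS]/Num.Def.normr/= mx_normrE; apply/bigmax_le => [|[i j] _].
  by rewrite mulr_ge0// (le_trans _ (LS ord0 ord0))//; have [/ltW] := hL ord0 ord0.
have [_ /(_ x y xab yab) h] := hL i j; rewrite !mxE /=.
by apply: (le_trans h); rewrite ler_wpM2r.
Qed.

End AbsoluteContinuityClosure.

Section RigidMotions.
Context {R : realType}.

Definition se3 (P : 'M[R]_3) (x : 'cV[R]_3) : 'M[R]_(3 + 1) := block_mx P x 0 1%:M.

Lemma se3M P x Q y : se3 P x *m se3 Q y = se3 (P *m Q) (P *m y + x).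
Proof. by rewrite /se3 mulmx_block !(mulmx0, mul0mx, addr0, add0r, mulmx1, mul1mx). Qed.

Lemma se3_1 : se3 1%:M 0 = 1%:M.
Proof. by rewrite /se3 -scalar_mx_block. Qed.

Lemma SE3P (g : 'M[R]_(3 + 1)) : SE3 g <-> exists P x, SO3 P /\ g = se3 P x.
Proof.
by split=> [[P [x [PP dP ->]]]|[P [x [[PP dP] ->]]]]; exists P, x.
Qed.

Lemma SE3_se3 P x : SO3 P -> SE3 (se3 P x).
Proof. by move=> hP; apply/SE3P; exists P, x. Qed.

Lemma SE3M (g h : 'M[R]_(3 + 1)) : SE3 g -> SE3 h -> SE3 (g *m h).
Proof.
move=> /SE3P[P [x [hP ->]]] /SE3P[Q [y [hQ ->]]]; rewrite se3M.
by apply: SE3_se3; exact: SO3_mul.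
Qed.

(** The element of the Lie algebra of SE(3) given by a body twist (linear part above, angular
    below); motion then reads g' = g [hat xi]. *)
Definition hat (xi : 'cV[R]_(3 + 3)) : 'M[R]_(3 + 1) :=
  block_mx (cross_mx (dsubmx xi)) (usubmx xi) 0 0.

Lemma se3_hat P x xi : se3 P x *m hat xi =
  block_mx (P *m cross_mx (dsubmx xi)) (P *m usubmx xi) 0 0.
Proof. by rewrite /se3 /hat mulmx_block !(mulmx0, mul0mx, addr0, mul1mx). Qed.

Lemma cross_mxD (u v : 'cV[R]_3) : cross_mx (u + v) = cross_mx u + cross_mx v.
Proof. mat3. Qed.

Lemma cross_mxZ k (u : 'cV[R]_3) : cross_mx (k *: u) = k *: cross_mx u.
Proof. mat3. Qed.

Lemma hatD xi eta : hat (xi + eta) = hat xi + hat eta.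
Proof. by rewrite /hat !linearD /= cross_mxD add_block_mx !addr0. Qed.

Lemma hatZ k xi : hat (k *: xi) = k *: hat xi.
Proof. by rewrite /hat !linearZ /= cross_mxZ scale_block_mx !scaler0. Qed.

Lemma hat_conj Q xi : SO3 Q ->
  hat (diag2 Q *m xi) = se3 Q 0 *m hat xi *m se3 Q^T 0.
Proof.
move=> hQ; rewrite -[xi]vsubmxK diag2_col /hat !col_mxKu !col_mxKd.
rewrite /se3 !mulmx_block !(mulmx0, mul0mx, addr0, add0r, mulmx1, mul1mx).
by rewrite cross_mx_SO3.
Qed.

Lemma is_derive_locally_constant (f : R -> R) t :
  (\forall x \near t, f x = f t) -> is_derive t (1 : R) f 0.
Proof.
move=> h; apply: (@near_eq_is_derive _ _ _ (fun=> f t)).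
by apply: filterS h => x ->.
Qed.

Lemma lipschitz_bounded (f : R -> R) a b : lipschitz_itv a b f ->
  exists2 B, 0 < B & forall x, a <= x <= b -> `|f x| <= B.
Proof.
move=> [L L0 fL]; exists (`|f a| + L * `|b - a| + 1).
  by rewrite ltr_wpDl// addr_ge0// mulr_ge0// ltW.
move=> x /andP[ax xb].
have haa : a <= a <= b by rewrite lexx (le_trans ax).
have hx : a <= x <= b by rewrite ax.
have := fL _ _ haa hx; have := ler_normD (f x - f a) (f a); rewrite subrK.
have : L * `|x - a| <= L * `|b - a|.
  by rewrite ler_pM2l// !ger0_norm ?subr_ge0 ?(le_trans ax)// lerD2r.
by lra.
Qed.

Lemma lipschitz_mx_bounded n m (A : R -> 'M[R]_(n, m)) a b :
  (forall i j, lipschitz_itv a b (fun x => A x i j)) ->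
  exists2 B, 0 < B & forall i j x, a <= x <= b -> `|A x i j| <= B.
Proof.
move=> lA.
have [L hL] : {L : 'I_n -> 'I_m -> R | forall i j, 0 < L i j /\
    forall x, a <= x <= b -> `|A x i j| <= L i j}.
  exists (fun i j => sval (cid2 (lipschitz_bounded (lA i j)))) => i j.
  by case: cid2.
pose S := \sum_i \sum_j L i j.
have S0 : 0 <= S.
  by apply: sumr_ge0 => k _; apply: sumr_ge0 => l _; have [/ltW] := hL k l.
exists (S + 1) => [|i j x xab]; first by rewrite ltr_wpDl.
have [_ /(_ x xab) h] := hL i j; apply: (le_trans h).
rewrite /S (bigD1 i)//= (bigD1 j)//= -!addrA lerDl !addr_ge0//.
  by apply: sumr_ge0 => k _; have [/ltW] := hL i k.
by apply: sumr_ge0 => k _; apply: sumr_ge0 => l _; have [/ltW] := hL k l.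
Qed.

Lemma ac_cst_interior (a b : R) (f : R -> R) : absolutely_continuous a b f ->
  (forall t, a < t < b -> is_derive t (1 : R) f 0) ->
  forall t, a <= t <= b -> f t = f a.
Proof.
move=> acf f0; apply: ac_derive0_cst acf _; apply: aeW => t /=.
by rewrite in_itv/=; exact: f0.
Qed.

Lemma cst_mx_interior n m (A : R -> 'M[R]_(n, m)) a b :
  (forall i j, absolutely_continuous a b (fun x => A x i j)) ->
  (forall t, a < t < b -> is_dmx A t 0) -> forall t, a <= t <= b -> A t = A a.
Proof.
move=> acA A0 t tab; apply/matrixP => i j.
apply: (ac_cst_interior (acA i j)) tab => s sab.
by have := A0 s sab i j; rewrite mxE.
Qed.

(** The values are 1 or -1, and absolute continuity forbids a change of size 2 over a short
    interval. *)
Lemma ac_sign_cst (a b : R) (f : R -> R) : absolutely_continuous a b f ->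
  (forall t, a <= t <= b -> f t ^+ 2 = 1) -> forall t, a <= t <= b -> f t = f a.
Proof.
move=> acf f1; apply: ac_cst_interior => // t /andP[at_ tb].
have [d d0 fd] := acf 1 ltr01.
have close x y : a <= x -> x <= y -> y <= b -> y - x < d -> f y = f x.
  move=> ax xy yb yxd.
  have := fd 1%N (fun=> x) (fun=> y); rewrite !big_ord1 => /(_ _ _ yxd) h.
  have {}h : `|f y - f x| < 1.
    by apply: h => // i j _ _ _; rewrite !ord1.
  have fx : f x ^+ 2 = 1 by apply: f1; rewrite ax (le_trans xy).
  have fy : f y ^+ 2 = 1 by apply: f1; rewrite yb (le_trans ax).
  have : (f y - f x) * (f y + f x) = 0 by rewrite -subr_sqr fx fy subrr.
  move/eqP; rewrite mulf_eq0 subr_eq0 => /orP[/eqP//|].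
  rewrite addr_eq0 => /eqP fyx; move: h fx; rewrite fyx ltr_norml => /andP[? ?] ?; nra.
apply: is_derive_locally_constant; near=> y.
have yta : `|y - t| < t - a by near: y; apply: near_dist_lt; rewrite subr_gt0.
have ytb : `|y - t| < b - t by near: y; apply: near_dist_lt; rewrite subr_gt0.
have ytd : `|y - t| < d by near: y; exact: near_dist_lt.
move: yta ytb ytd; rewrite !ltr_norml => /andP[? ?] /andP[? ?] /andP[? ?].
have [yt|/ltW ty] := leP y t; first by apply/esym/close => //; lra.
by apply: close => //; lra.
Unshelve. all: by end_near. Qed.

Lemma ac_det3 (a b B : R) (P : R -> 'M[R]_3) :
  (forall i j s, a <= s <= b -> `|P s i j| <= B) ->
  (forall i j, absolutely_continuous a b (fun t => P t i j)) ->
  absolutely_continuous a b (fun t => \det (P t)).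
Proof.
move=> PB acP; under [X in absolutely_continuous _ _ X]funext do rewrite det3.
have m2 i j k l : absolutely_continuous a b (fun t => P t i j * P t k l).
  by apply: (acM (B := B)) => // s; exact: PB.
have m3 i j k l i' j' k' l' u v : absolutely_continuous a b
    (fun t => P t u v * (P t i j * P t k l - P t i' j' * P t k' l')).
  have B0 x : a <= x <= b -> 0 <= B by move=> /(PB 0 0 x); exact: le_trans.
  apply: (acM (B := B + B * B + B * B)) => // [x xab|x xab|].
  - apply: (le_trans (PB _ _ _ xab)); have := B0 x xab; nra.
  - apply: (le_trans (ler_normB _ _)); rewrite !normrM.
    have h1 := ler_pM (normr_ge0 _) (normr_ge0 _) (PB i j x xab) (PB k l x xab).
    have h2 := ler_pM (normr_ge0 _) (normr_ge0 _) (PB i' j' x xab) (PB k' l' x xab).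
    by have := B0 x xab; lra.
  - by apply: acD => //; exact: acN.
exact: (acD (acD (m3 _ _ _ _ _ _ _ _ _ _) (acN (m3 _ _ _ _ _ _ _ _ _ _)))
  (m3 _ _ _ _ _ _ _ _ _ _)).
Qed.

Lemma continuous_ext (f g : R -> R) t :
  f =1 g -> {for t, continuous f} -> {for t, continuous g}.
Proof. by move=> /funext ->. Qed.

(** The linear system does not leave SE(3): [cross_mx] is skew, so Gram matrices of solutions of A'
    = A [cross_mx] are constant. This keeps [P] orthogonal and the lower left block 0, hence the
    corner equal to 1; the determinant cannot jump from 1 to -1. *)
Theorem rigid_motion_ode (xi : R -> 'cV[R]_(3 + 3)) :
  (forall i j t, {for t, continuous (fun x => xi x i j)}) ->
  exists X : R -> 'M[R]_(3 + 1), [/\ X 0 = 1%:M,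
    forall i j, lipschitz_itv 0 1 (fun t => X t i j),
    forall t, 0 <= t <= 1 -> SE3 (X t) &
    forall t, 0 < t < 1 -> is_dmx X t (X t *m hat (xi t))].
Proof.
move=> cxi; have [|X [X0 lX dX]] := @linear_ode R (3 + 1) (fun t => hat (xi t)).
  have cw k t : {for t, continuous (fun x => dsubmx (xi x) k 0)}.
    by under [X in {for _, continuous X}]funext do rewrite mxE; exact: cxi.
  move=> i j t; case: (split_ordP i) => i' ->; case: (split_ordP j) => j' ->.
  - under [X in {for _, continuous X}]funext do rewrite block_mxEul.
    apply: (@continuous_ext (fun x =>
        dsubmx (xi x) (i' + 1) 0 * (delta_mx j' 0 : 'cV[R]_3) (i' + 2) 0 -
        dsubmx (xi x) (i' + 2) 0 * (delta_mx j' 0 : 'cV[R]_3) (i' + 1) 0)).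
      by move=> x; rewrite [RHS]mxE [RHS]mxE.
    have cwd k l : {for t, continuous (fun x => dsubmx (xi x) k 0 *
        (delta_mx j' 0 : 'cV[R]_3) l 0)}.
      by apply: cvgM; [exact: cw|exact: cst_continuous].
    exact: (cvgB (cwd (i' + 1) (i' + 2)) (cwd (i' + 2) (i' + 1))).
  - under [X in {for _, continuous X}]funext do rewrite block_mxEur mxE.
    exact: cxi.
  - by under [X in {for _, continuous X}]funext do rewrite block_mxEdl mxE; exact: cst_continuous.
  - by under [X in {for _, continuous X}]funext do rewrite block_mxEdr mxE; exact: cst_continuous.
exists X; split => //.
have [B B0 XB] := lipschitz_mx_bounded lX.
pose P t := ulsubmx (X t); pose x t := ursubmx (X t).
pose rho t := dlsubmx (X t); pose sg t := drsubmx (X t).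
have XE t : X t = block_mx (P t) (x t) (rho t) (sg t) by rewrite submxK.
have XhatE t : X t *m hat (xi t) = block_mx (P t *m cross_mx (dsubmx (xi t)))
    (P t *m usubmx (xi t)) (rho t *m cross_mx (dsubmx (xi t))) (rho t *m usubmx (xi t)).
  by rewrite XE /hat mulmx_block !mulmx0 !addr0.
have acP i j : absolutely_continuous 0 1 (fun t => P t i j).
  by under [X in absolutely_continuous _ _ X]funext do rewrite !mxE; exact: lipschitz_ac (lX _ _).
have acrho i j : absolutely_continuous 0 1 (fun t => rho t i j).
  by under [X in absolutely_continuous _ _ X]funext do rewrite !mxE; exact: lipschitz_ac (lX _ _).
have acsg i j : absolutely_continuous 0 1 (fun t => sg t i j).
  by under [X in absolutely_continuous _ _ X]funext do rewrite !mxE; exact: lipschitz_ac (lX _ _).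
have PB i j s : 0 <= s <= 1 -> `|P s i j| <= B by rewrite !mxE; exact: XB.
have rhoB i j s : 0 <= s <= 1 -> `|rho s i j| <= B by rewrite !mxE; exact: XB.
have dP s : 0 < s < 1 -> is_dmx P s (P s *m cross_mx (dsubmx (xi s))).
  by move=> /dX /is_dmx_ulsub; rewrite XhatE block_mxKul.
have drho s : 0 < s < 1 -> is_dmx rho s (rho s *m cross_mx (dsubmx (xi s))).
  move=> /dX h i j; have := h (rshift 3 i) (lshift 1 j).
  rewrite XhatE block_mxEdl; apply: is_derive_ext => y; by rewrite !mxE.
have dsg s : 0 < s < 1 -> is_dmx sg s (rho s *m usubmx (xi s)).
  move=> /dX h i j; have := h (rshift 3 i) (rshift 3 j).
  rewrite XhatE block_mxEdr; apply: is_derive_ext => y; by rewrite !mxE.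
have z01 : (0 : R) <= 0 <= (1 : R) by rewrite lexx /= ler01.
have P0 : P 0 = 1%:M by rewrite /P X0 (scalar_mx_block 3 1) block_mxKul.
have rho0 : rho 0 = 0 by rewrite /rho X0 (scalar_mx_block 3 1) block_mxKdl.
have sg0 : sg 0 = 1%:M by rewrite /sg X0 (scalar_mx_block 3 1) block_mxKdr.
have gram n (A : R -> 'M[R]_(n, 3)) :
    (forall i j s, 0 <= s <= 1 -> `|A s i j| <= B) ->
    (forall i j, absolutely_continuous 0 1 (fun t => A t i j)) ->
    (forall s, 0 < s < 1 -> is_dmx A s (A s *m cross_mx (dsubmx (xi s)))) ->
    forall s, 0 <= s <= 1 -> A s *m (A s)^T = A 0 *m (A 0)^T.
  move=> AB acA dA; apply: (@cst_mx_interior n n (fun t => A t *m (A t)^T)) => [|s s01].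
    apply: (ac_mulmx (B := B)) => // i j; first by move=> s; rewrite mxE; exact: AB.
    by under [X in absolutely_continuous _ _ X]funext do rewrite mxE; exact: acA.
  have := is_dmxM (dA s s01) (is_dmx_tr (dA s s01)).
  by rewrite trmx_mul cross_mx_tr mulNmx mulmxN mulmxA subrr.
have rhoE s : 0 <= s <= 1 -> rho s = 0.
  move=> s01; have := gram 1%N rho rhoB acrho drho s s01.
  rewrite rho0 mul0mx => h.
  have : dot (rho s)^T (rho s)^T = 0 by rewrite -dotE trmxK h mxE.
  by move=> /dot_eq0 /(congr1 trmx); rewrite trmxK trmx0.
have sgE s : 0 <= s <= 1 -> sg s = 1%:M.
  move=> s01; rewrite -sg0; apply: cst_mx_interior s01 => // r r01.
  have := dsg r r01; rewrite rhoE ?mul0mx//.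
  by case/andP: r01 => /ltW -> /ltW ->.
have PP s : 0 <= s <= 1 -> P s *m (P s)^T = 1%:M.
  by move=> s01; rewrite (gram _ _ PB acP dP)// P0 trmx1 mulmx1.
move=> s s01; apply/SE3P; exists (P s), (x s).
split; last by rewrite XE rhoE// sgE.
split; first exact: mulmx1C (PP s s01).
have -> : \det (P s) = \det (P 0).
  apply: (@ac_sign_cst 0 1 (fun t => \det (P t)) _ _ s s01) => [|r r01]; first exact: ac_det3 PB acP.
  by have := congr1 determinant (PP r r01); rewrite det_mulmx det_tr det1.
by rewrite P0 det1.
Qed.

End RigidMotions.

(** * Steering the swimmer *)

Section SmoothMatrices.
Context {R : realType}.

(** Mere differentiability everywhere, which gives the continuity of twists required by
    [rigid_motion_ode]. *)
Definition smx {m n} (A : R -> 'M[R]_(m, n)) := forall t, exists dA, is_dmx A t dA.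

Lemma smx_cst m n (A : 'M[R]_(m, n)) : smx (fun=> A).
Proof. by move=> t; exists 0; exact: is_dmx_cst. Qed.

Lemma smxD m n (A B : R -> 'M[R]_(m, n)) : smx A -> smx B -> smx (fun x => A x + B x).
Proof.
by move=> hA hB t; have [a ha] := hA t; have [b hb] := hB t; exists (a + b); exact: is_dmxD.
Qed.

Lemma smxN m n (A : R -> 'M[R]_(m, n)) : smx A -> smx (fun x => - A x).
Proof. by move=> hA t; have [a ha] := hA t; exists (- a); exact: is_dmxN. Qed.

Lemma smxZ m n k (A : R -> 'M[R]_(m, n)) : smx A -> smx (fun x => k *: A x).
Proof.
move=> hA t; have [a ha] := hA t.
by eexists; exact: is_dmxZ (is_derive_cst1 k t) ha.
Qed.

Lemma smxM m n p (A : R -> 'M[R]_(m, n)) (B : R -> 'M[R]_(n, p)) :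
  smx A -> smx B -> smx (fun x => A x *m B x).
Proof.
by move=> hA hB t; have [a ha] := hA t; have [b hb] := hB t; eexists; exact: is_dmxM.
Qed.

Lemma smx_tr m n (A : R -> 'M[R]_(m, n)) : smx A -> smx (fun x => (A x)^T).
Proof. by move=> hA t; have [a ha] := hA t; exists a^T; exact: is_dmx_tr. Qed.

Lemma smx_block m1 m2 n1 n2 (A : R -> 'M[R]_(m1, n1)) (B : R -> 'M[R]_(m1, n2))
    (C : R -> 'M[R]_(m2, n1)) (D : R -> 'M[R]_(m2, n2)) :
  smx A -> smx B -> smx C -> smx D ->
  smx (fun x => block_mx (A x) (B x) (C x) (D x)).
Proof.
move=> hA hB hC hD t; have [a ha] := hA t; have [b hb] := hB t.
by have [c hc] := hC t; have [d hd] := hD t; eexists; exact: is_dmx_block.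
Qed.

Lemma smx_col m1 m2 n (A : R -> 'M[R]_(m1, n)) (B : R -> 'M[R]_(m2, n)) :
  smx A -> smx B -> smx (fun x => col_mx (A x) (B x)).
Proof.
by move=> hA hB t; have [a ha] := hA t; have [b hb] := hB t; eexists; exact: is_dmx_col.
Qed.

Lemma smx_sum m n (I : Type) (r : seq I) (P : pred I) (A : I -> R -> 'M[R]_(m, n)) :
  (forall i, P i -> smx (A i)) -> smx (fun x => \sum_(i <- r | P i) A i x).
Proof.
move=> hA; elim: r => [|i r ih].
  by under [X in smx X]funext do rewrite big_nil; exact: smx_cst.
under [X in smx X]funext do rewrite big_cons.
by case: (boolP (P i)) => // Pi; apply: smxD => //; exact: hA.
Qed.

Lemma smx_inv n (A : R -> 'M[R]_n) : (forall x, A x \in unitmx) -> smx A ->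
  smx (fun x => invmx (A x)).
Proof.
by move=> uA hA t; have [a ha] := hA t; eexists; exact: is_dmx_inv ha.
Qed.

Lemma is_dmx_vec3 (f g h : R -> R) t f' g' h' : is_derive t (1 : R) f f' ->
  is_derive t (1 : R) g g' -> is_derive t (1 : R) h h' ->
  is_dmx (fun x => vec3 (f x) (g x) (h x)) t (vec3 f' g' h').
Proof.
move=> hf hg hh i j; rewrite ord1; move: i; apply: ord3P; rewrite vec3E.
- by apply: is_derive_ext hf => x; rewrite vec3E.
- by apply: is_derive_ext hg => x; rewrite vec3E.
- by apply: is_derive_ext hh => x; rewrite vec3E.
Qed.

Lemma is_dmx_cross (a b : R -> 'cV[R]_3) t da db : is_dmx a t da -> is_dmx b t db ->
  is_dmx (fun x => cross (a x) (b x)) t (cross da (b t) + cross (a t) db).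
Proof.
move=> ha hb i j.
apply: (@is_derive_ext _ (fun x => a x (i + 1) 0 * b x (i + 2) 0 -
  a x (i + 2) 0 * b x (i + 1) 0)) => [x|]; first by rewrite mxE.
apply: (trigger_derive (is_deriveB (is_derive_mul (ha (i + 1) 0) (hb (i + 2) 0))
  (is_derive_mul (ha (i + 2) 0) (hb (i + 1) 0)))).
by rewrite !mxE; ring.
Qed.

Lemma smx_cross_mx (a : R -> 'cV[R]_3) : smx a -> smx (fun x => cross_mx (a x)).
Proof.
move=> ha t; have [da hda] := ha t; exists (cross_mx da) => i j.
have := is_dmx_cross hda (is_dmx_cst (delta_mx j 0) t) i 0.
have -> : cross (a t) 0 = 0 by vec3.
rewrite addr0 (_ : cross da _ i 0 = cross_mx da i j) ?mxE//.
by apply: is_derive_ext => x; rewrite [RHS]mxE.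
Qed.

Lemma smx_tensor (a b : R -> 'cV[R]_3) : smx a -> smx b -> smx (fun x => tensor (a x) (b x)).
Proof. by move=> ha hb; apply: smxM => //; exact: smx_tr. Qed.

End SmoothMatrices.

(** * Motions with constant angle rates *)

Section Swimming.
Context {R : realType} (Cpar Cperp Ctau : R) {N : nat} (ell : N.-tuple R).
Local Notation resistance := (resistance_mx Cpar Cperp Ctau ell).
Local Notation angles := (mobile N -> R * R).
Implicit Types (al be : angles) (c d : angles) (s : swimmer_shape R N).

(** Computations use real lifts of the angles, in which constant rates trace straight lines; the
    circle enters only here. *)
Definition shape_of al : swimmer_shape R N := fun j => ((al j).1, to_circle (al j).2).

Definition line al c (t : R) : angles :=
  fun j => ((al j).1 + t * (c j).1, (al j).2 + t * (c j).2).

Definition udir (th ph : R) : 'cV[R]_3 := vec3 (cos th * sin ph) (sin th * sin ph) (cos ph).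

Definition dudir (th ph th' ph' : R) : 'cV[R]_3 :=
  vec3 (- (sin th * sin ph * th') + cos th * cos ph * ph')
       (cos th * sin ph * th' + sin th * cos ph * ph') (- (sin ph * ph')).

Definition ddir al c (i : 'I_N) : 'cV[R]_3 :=
  if insub i is Some j then dudir (al j).1 (al j).2 (c j).1 (c j).2 else 0.

Definition shape_load s (de : 'I_N -> 'cV[R]_3) : 'cV[R]_(3 + 3) :=
  col_mx (shape_force Cpar Cperp ell s de) (shape_torque Cpar Cperp ell s de).

Definition shape_twist al c : 'cV[R]_(3 + 3) :=
  - (invmx (resistance (shape_of al)) *m shape_load (shape_of al) (ddir al c)).

Lemma link_dirE al i : link_dir (shape_of al) i =
  if insub i is Some j then udir (al j).1 (al j).2 else ez.
Proof.
rewrite /link_dir; case: insubP => // j _ _.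
by rewrite /shape_of circle_sinE circle_cosE.
Qed.

Lemma shape_ofP s : exists al, s = shape_of al.
Proof.
exists (fun j => ((s j).1, repr (s j).2)); apply/funext => j.
by rewrite /shape_of /to_circle reprK; case: (s j).
Qed.

Lemma dot_link_dir s i : dot (link_dir s i) (link_dir s i) = 1.
Proof.
have [al ->] := shape_ofP s; rewrite link_dirE; case: insubP => [j _ _|_]; last exact: dot_ez.
rewrite /udir dot_vec3; have h1 := cos2Dsin2 (al j).1; have h2 := cos2Dsin2 (al j).2.
rewrite (_ : _ + _ = (cos (al j).1 ^+ 2 + sin (al j).1 ^+ 2) * sin (al j).2 ^+ 2
  + cos (al j).2 ^+ 2); last by ring.
by rewrite h1 mul1r addrC.
Qed.

Lemma is_derive_line (a b t : R) : is_derive t (1 : R) (fun x => a + x * b) b.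
Proof.
apply: (trigger_derive (is_deriveD (is_derive_cst1 a t)
  (is_derive_mul (is_derive_id t (1 : R)) (is_derive_cst1 b t)))).
by rewrite add0r mulr0 addr0 mul1r.
Qed.

Lemma is_derive_sin_comp (f : R -> R) t df : is_derive t (1 : R) f df ->
  is_derive t (1 : R) (fun x => sin (f x)) (cos (f t) * df).
Proof. exact: (@is_derive1_comp _ sin f). Qed.

Lemma is_derive_cos_comp (f : R -> R) t df : is_derive t (1 : R) f df ->
  is_derive t (1 : R) (fun x => cos (f x)) (- sin (f t) * df).
Proof. exact: (@is_derive1_comp _ cos f). Qed.

Lemma is_dmx_udir (f g : R -> R) t df dg : is_derive t (1 : R) f df ->
  is_derive t (1 : R) g dg -> is_dmx (fun x => udir (f x) (g x)) t (dudir (f t) (g t) df dg).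
Proof.
move=> hf hg; have sf := is_derive_sin_comp hf; have cf := is_derive_cos_comp hf.
have sg := is_derive_sin_comp hg; have cg := is_derive_cos_comp hg.
apply: is_dmx_vec3.
- by apply: (trigger_derive (is_derive_mul cf sg)); ring.
- by apply: (trigger_derive (is_derive_mul sf sg)); ring.
- by apply: (trigger_derive cg); ring.
Qed.

Lemma is_dmx_link_dir al c i t :
  is_dmx (fun x => link_dir (shape_of (line al c x)) i) t (ddir (line al c t) c i).
Proof.
rewrite /ddir; under [X in is_dmx X]funext do rewrite link_dirE.
by case: insub => [j|]; [apply: is_dmx_udir; exact: is_derive_line|exact: is_dmx_cst].
Qed.

Lemma smx_link_dir al c i : smx (fun x => link_dir (shape_of (line al c x)) i).
Proof. by move=> t; eexists; exact: is_dmx_link_dir. Qed.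

Lemma smx_ddir al c i : smx (fun x => ddir (line al c x) c i).
Proof.
move=> t; rewrite /ddir; case: insub => [j|]; last by exists 0; exact: is_dmx_cst.
have hf := is_derive_line (al j).1 (c j).1 t; have hg := is_derive_line (al j).2 (c j).2 t.
have sf := is_derive_sin_comp hf; have cf := is_derive_cos_comp hf.
have sg := is_derive_sin_comp hg; have cg := is_derive_cos_comp hg.
have k1 := is_derive_cst1 (c j).1 t; have k2 := is_derive_cst1 (c j).2 t.
eexists; exact: (is_dmx_vec3
  (is_deriveD (is_deriveN (is_derive_mul (is_derive_mul sf sg) k1))
    (is_derive_mul (is_derive_mul cf cg) k2))
  (is_deriveD (is_derive_mul (is_derive_mul cf sg) k1)
    (is_derive_mul (is_derive_mul sf cg) k2))
  (is_deriveN (is_derive_mul sg k2))).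
Qed.

Section SmoothShape.
Variables al c : angles.
Local Notation sh x := (shape_of (line al c x)).

Lemma smx_arm i : smx (fun x => arm_mx ell (sh x) i).
Proof.
apply: smx_sum => j _; apply: smxZ; apply: smx_cross_mx; exact: smx_link_dir.
Qed.

Lemma smx_drag i : smx (fun x => drag_mx Cpar Cperp (sh x) i).
Proof.
apply: smxD; last exact: smx_cst.
by apply: smxZ; apply: smx_tensor; exact: smx_link_dir.
Qed.

Lemma smx_C_link i : smx (fun x => C_link Cpar Cperp ell (sh x) i).
Proof.
apply: smxD; apply: smxZ; first by apply: smxM; [exact: smx_arm|exact: smx_drag].
by apply: smx_cross_mx; exact: smx_link_dir.
Qed.

Lemma smx_J_link i : smx (fun x => J_link Cpar Cperp Ctau ell (sh x) i).
Proof.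
have hd := smx_link_dir al c i; have ht := smx_tensor hd hd.
have ha := smx_arm i; have he := smx_cross_mx hd.
have h1 := smxD (smx_cst 1%:M) (smxN ht).
rewrite /J_link; case: (nat_of_ord i == 0%N); first by apply: smxD; exact: smxZ.
apply: smxD; last exact: smxZ.
apply: smxD; last by apply/smxN/smxZ; apply: smxD; exact: smxM.
apply: smxD; last by apply/smxN/smxZ; exact: smxM.
by apply/smxN/smxZ; apply: smxM => //; exact: smxM.
Qed.

Lemma smx_resistance : smx (fun x => resistance (sh x)).
Proof.
under [X in smx X]funext do rewrite resistance_sum.
apply: smx_sum => i _; apply: smx_block.
- by apply: smxZ; exact: smx_drag.
- by apply: smx_tr; exact: smx_C_link.
- exact: smx_C_link.
- exact: smx_J_link.
Qed.

Lemma smx_load : smx (fun x => shape_load (sh x) (ddir (line al c x) c)).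
Proof.
have hv i : smx (fun x => arm_velocity ell (ddir (line al c x) c) i).
  by apply: smx_sum => j _; apply: smxZ; exact: smx_ddir.
have hD := smx_drag; have hA := smx_arm; have he i := smx_cross_mx (smx_link_dir al c i).
have hd := smx_ddir al c.
apply: smx_col; apply: smx_sum => i _.
  by apply: smxD; apply: smxZ => //; exact: smxM.
apply: smxD; last by apply: smxZ; exact: smxM.
apply: smxD; last by apply: smxZ; exact: smxM.
apply: smxD; last by apply: smxZ; exact: smxM.
by apply: smxZ; apply: smxM => //; exact: smxM.
Qed.

End SmoothShape.

Hypothesis unitM : forall s, resistance s \in unitmx.

Lemma smx_twist al c : smx (fun x => shape_twist (line al c x) c).
Proof.
apply: smxN; apply: smxM; last exact: smx_load.
by apply: smx_inv => //; exact: smx_resistance.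
Qed.

Definition curve al c (X : R -> 'M[R]_(3 + 1)) :=
  [/\ forall i j, lipschitz_itv 0 1 (fun t => X t i j),
      forall t, 0 <= t <= 1 -> SE3 (X t) &
      forall t, 0 < t < 1 -> is_dmx X t (X t *m hat (shape_twist (line al c t) c))].

Lemma curve_exists al c : exists X, curve al c X /\ X 0 = 1%:M.
Proof.
have [|X [X0 lX sX dX]] := @rigid_motion_ode R (fun t => shape_twist (line al c t) c).
  by move=> i j t; have [d /is_dmx_continuous] := smx_twist al c t.
by exists X.
Qed.

(** Constant rates for one unit of time. Every control built below is a concatenation of such moves,
    hence piecewise constant. *)
Definition move (p q : 'M[R]_(3 + 1) * angles) :=
  exists c X, [/\ curve p.2 c X, X 0 = p.1, X 1 = q.1 & q.2 = line p.2 c 1].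

Inductive steers (p : 'M[R]_(3 + 1) * angles) : 'M[R]_(3 + 1) * angles -> Prop :=
| steers_refl : steers p p
| steers_move q r : steers p q -> move q r -> steers p r.

End Swimming.

(** * Symmetries of steering: time reversal, left translation, common spin *)

Section Steering.
Context {R : realType} (Cpar Cperp Ctau : R) {N : nat} (ell : N.-tuple R).
Local Notation resistance := (resistance_mx Cpar Cperp Ctau ell).
Local Notation angles := (mobile N -> R * R).
Local Notation twist := (shape_twist Cpar Cperp Ctau ell).
Local Notation curve := (curve Cpar Cperp Ctau ell).
Local Notation move := (move Cpar Cperp Ctau ell).
Local Notation steers := (steers Cpar Cperp Ctau ell).
Local Notation load := (shape_load Cpar Cperp ell).
Implicit Types (al be : angles) (c d : angles) (s : swimmer_shape R N).

Definition rate_scale (k : R) c : angles := fun j => (k * (c j).1, k * (c j).2).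

Lemma line0 al c : line al c 0 = al.
Proof. by apply/funext => j; rewrite /line !mul0r !addr0; case: (al j). Qed.

Lemma line_line al c k t u : line (line al c t) (rate_scale k c) u = line al c (t + u * k).
Proof. by apply/funext => j; rewrite /line /=; congr pair; ring. Qed.

Lemma ddir_scale al c k i : ddir al (rate_scale k c) i = k *: ddir al c i.
Proof.
rewrite /ddir; case: insub => [j|]; last by rewrite scaler0.
by rewrite /dudir vec3Z; apply: col3P; rewrite !vec3E /=; ring.
Qed.

Lemma load_scale s (de : 'I_N -> 'cV[R]_3) k :
  load s (fun i => k *: de i) = k *: load s de.
Proof.
have av i : arm_velocity ell (fun i => k *: de i) i = k *: arm_velocity ell de i.
  rewrite /arm_velocity scaler_sumr; apply: eq_bigr => j _.
  by rewrite scalerA mulrC -scalerA.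
rewrite /shape_load scale_col_mx /shape_force /shape_torque !scaler_sumr.
congr col_mx; apply: eq_bigr => i _; rewrite av.
  by rewrite -scalemxAr !scalerDr !scalerA ![_ * k]mulrC.
by rewrite -!scalemxAr !scalerDr !scalerA ![_ * k]mulrC.
Qed.

Lemma twist_scale al c k : twist al (rate_scale k c) = k *: twist al c.
Proof.
rewrite /shape_twist (_ : ddir al (rate_scale k c) = fun i => k *: ddir al c i); last first.
  by apply/funext => i; rewrite ddir_scale.
by rewrite load_scale -scalemxAr scalerN.
Qed.

(** The case [t2 < t1] is allowed: twists are linear in the rates, so a motion run backwards is a
    motion. Distinct times keep interior instants interior. *)
Lemma curve_sub al c X t1 t2 : curve al c X ->
  0 <= t1 <= 1 -> 0 <= t2 <= 1 -> t1 != t2 ->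
  curve (line al c t1) (rate_scale (t2 - t1) c) (fun t => X (t1 + t * (t2 - t1))).
Proof.
move=> [lX sX dX] /andP[t10 t11] /andP[t20 t21] t12.
have inn t : 0 <= t <= 1 -> 0 <= t1 + t * (t2 - t1) <= 1.
  by move=> /andP[? ?]; apply/andP; split; nra.
have inn' t : 0 < t < 1 -> 0 < t1 + t * (t2 - t1) < 1.
  move=> /andP[? ?]; move: t12; rewrite neq_lt => /orP[h|h]; apply/andP; split; nra.
split=> [i j|t /inn|t /inn' /dX h]; last first.
- by rewrite line_line twist_scale hatZ -scalemxAr; apply: is_dmx_affine.
- exact: sX.
- have [L L0 LX] := lX i j; exists L => // x y x01 y01.
  apply: (le_trans (LX _ _ (inn x x01) (inn y y01))).
  rewrite ler_pM2l// (_ : _ - _ = (t2 - t1) * (y - x)); last by ring.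
  rewrite normrM ler_piMl// ler_norml; apply/andP; split; lra.
Qed.

Lemma move_sub al c X t1 t2 : curve al c X ->
  0 <= t1 <= 1 -> 0 <= t2 <= 1 -> t1 != t2 ->
  move (X t1, line al c t1) (X t2, line al c t2).
Proof.
move=> hX h1 h2 t12; exists (rate_scale (t2 - t1) c), (fun t => X (t1 + t * (t2 - t1))).
split; first exact: curve_sub.
- by rewrite mul0r addr0.
- by rewrite mul1r subrKC.
- by rewrite line_line mul1r subrKC.
Qed.

Lemma move_sym p q : move p q -> move q p.
Proof.
case: p q => [g al] [h be] [c [X [hX X0 X1 /= ->]]]; rewrite /= in X0 X1.
rewrite -X0 -X1 -[in X in move _ X](line0 al c).
by apply: move_sub; rewrite ?lexx ?ler01 ?oner_eq0.
Qed.

Lemma lipschitz_lin n (a : 'I_n -> R) (f : 'I_n -> R -> R) (x0 x1 : R) :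
  (forall i, lipschitz_itv x0 x1 (f i)) -> lipschitz_itv x0 x1 (fun t => \sum_i a i * f i t).
Proof.
move=> lf; have [L hL] : {L : 'I_n -> R | forall i, 0 < L i /\
    forall x y, x0 <= x <= x1 -> x0 <= y <= x1 -> `|f i y - f i x| <= L i * `|y - x|}.
  by exists (fun i => sval (cid2 (lf i))) => i; case: cid2.
have S0 : 0 <= \sum_i `|a i| * L i.
  by apply: sumr_ge0 => i _; rewrite mulr_ge0//; have [/ltW] := hL i.
exists (\sum_i `|a i| * L i + 1) => [|x y hx hy]; first by rewrite ltr_wpDl.
rewrite -sumrB; apply: (le_trans (ler_norm_sum _ _ _)).
rewrite mulrDl mul1r mulr_suml; apply: ler_wpDr => //.
apply: ler_sum => i _; rewrite -mulrBr normrM -mulrA ler_wpM2l//.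
by have [_] := hL i; exact.
Qed.

Lemma curve_left al c X h : SE3 h -> curve al c X -> curve al c (fun t => h *m X t).
Proof.
move=> hh [lX sX dX]; split=> [i j|t /sX|t /dX dXt]; last first.
- by rewrite -mulmxA; exact: is_dmxMl.
- exact: SE3M.
- have -> : (fun t => (h *m X t) i j) = (fun t => \sum_k h i k * X t k j).
    by apply/funext => t; rewrite mxE.
  by apply: lipschitz_lin => k; exact: lX.
Qed.

Lemma move_left g al h be k : SE3 k ->
  move (g, al) (h, be) -> move (k *m g, al) (k *m h, be).
Proof.
move=> hk [c [X [hX X0 X1 /= ->]]]; rewrite /= in X0 X1; exists c, (fun t => k *m X t).
by split; [exact: curve_left|rewrite X0|rewrite X1|].
Qed.

Definition spin_shift al (a : R) : angles := fun j => ((al j).1 + a, (al j).2).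

Lemma line_shift al c a t : line (spin_shift al a) c t = spin_shift (line al c t) a.
Proof. by apply/funext => j; rewrite /line /spin_shift /= addrAC. Qed.

Lemma rot_ez_vec3 (a p q r : R) : rot ez a *m vec3 p q r =
  vec3 (cos a * p - sin a * q) (sin a * p + cos a * q) r.
Proof. by rewrite rotE /ez !vec3S; apply: col3P; rewrite !vec3E; ring. Qed.

Lemma rot_ez_ez (a : R) : rot ez a *m ez = ez :> 'cV[R]_3.
Proof. exact: rot_axis (dot_ez). Qed.

Lemma link_dir_shift al a i :
  link_dir (shape_of (spin_shift al a)) i = rot ez a *m link_dir (shape_of al) i.
Proof.
rewrite !link_dirE; case: insub => [j|]; last by rewrite rot_ez_ez.
by rewrite /udir rot_ez_vec3 /= cosD sinD; apply: col3P; rewrite !vec3E; ring.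
Qed.

Lemma ddir_shift al c a i : ddir (spin_shift al a) c i = rot ez a *m ddir al c i.
Proof.
rewrite /ddir; case: insub => [j|]; last by rewrite mulmx0.
by rewrite /dudir rot_ez_vec3 /= cosD sinD; apply: col3P; rewrite !vec3E; ring.
Qed.

Lemma rot_ez_SO3 (a : R) : SO3 (rot ez a). Proof. exact: rot_SO3 dot_ez. Qed.

Lemma unitmx_diag2 (Q : 'M[R]_3) : SO3 Q -> (diag2 Q)^T *m diag2 Q = 1%:M.
Proof. by move=> [QQ _]; rewrite diag2_tr diag2_mul QQ diag2_1. Qed.

Hypothesis unitM : forall s, resistance s \in unitmx.

Lemma solve_resistance s (y b : 'cV[R]_(3 + 3)) :
  resistance s *m y = b -> invmx (resistance s) *m b = y.
Proof. by move=> <-; rewrite mulKmx. Qed.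

(** All link directions rotate by [rot ez a], that of link 0 included since [ez] is fixed;
    resistance and load are conjugated accordingly. *)
Lemma twist_shift al c a : twist (spin_shift al a) c = diag2 (rot ez a) *m twist al c.
Proof.
have sQ := rot_ez_SO3 a; have QQ := unitmx_diag2 sQ.
rewrite /shape_twist mulmxN; congr (- _); apply: solve_resistance.
rewrite (@resistance_equiv _ _ _ _ _ ell (shape_of al) _ (rot ez a))//; last first.
- by move=> i; exact: link_dir_shift.
- by move=> i _; exact: link_dir_shift.
rewrite -!mulmxA [X in _ *m (_ *m X)]mulmxA QQ mul1mx mulKVmx//.
rewrite /shape_load diag2_col; congr col_mx.
  rewrite -(@shape_force_equiv _ _ _ _ ell (shape_of al) (shape_of (spin_shift al a)) _ sQ _
    (ddir al c) (ddir (spin_shift al a) c))// => i _; [exact: link_dir_shift|exact: ddir_shift].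
rewrite -(@shape_torque_equiv _ _ _ _ ell (shape_of al) (shape_of (spin_shift al a)) _ sQ _
  (ddir al c) (ddir (spin_shift al a) c))// => i _; [exact: link_dir_shift|exact: ddir_shift].
Qed.

Definition spin_g (a : R) : 'M[R]_(3 + 1) := se3 (rot ez a) 0.

Lemma spin_gM a b : spin_g a *m spin_g b = spin_g (a + b).
Proof. by rewrite /spin_g se3M mulmx0 addr0 rotD// dot_ez. Qed.

Lemma spin_g0 : spin_g 0 = 1%:M.
Proof. by rewrite /spin_g rot0 se3_1. Qed.

Lemma SE3_spin_g a : SE3 (spin_g a).
Proof. exact: SE3_se3 (rot_ez_SO3 a). Qed.

(** The same swimmer seen from a co-moving frame turned by [- a] about link 0, whence the factor on
    the right. *)
Lemma curve_shift al c X a : curve al c X ->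
  curve (spin_shift al a) c (fun t => X t *m spin_g (- a)).
Proof.
move=> [lX sX dX]; split=> [i j|t /sX|t /dX dXt]; last first.
- rewrite line_shift twist_shift hat_conj; last exact: rot_ez_SO3.
  rewrite rot_tr -!/(spin_g _) !mulmxA -(mulmxA (X t)) spin_gM addNr spin_g0 mulmx1.
  exact: is_dmxMr.
- by move=> h; apply: SE3M => //; exact: SE3_spin_g.
- have -> : (fun t => (X t *m spin_g (- a)) i j) =
      (fun t => \sum_k spin_g (- a) k j * X t i k).
    by apply/funext => t; rewrite mxE; apply: eq_bigr => k _; rewrite mulrC.
  by apply: lipschitz_lin => k; exact: lX.
Qed.

Lemma move_shift g al h be a : move (g, al) (h, be) ->
  move (g *m spin_g (- a), spin_shift al a) (h *m spin_g (- a), spin_shift be a).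
Proof.
move=> [c [X [hX X0 X1 /= ->]]]; rewrite /= in X0 X1.
exists c, (fun t => X t *m spin_g (- a)).
split; [exact: curve_shift|by rewrite X0|by rewrite X1|].
by rewrite /= line_shift.
Qed.

Lemma steers_trans p q r : steers p q -> steers q r -> steers p r.
Proof. by move=> pq; elim=> // x y _ px xy; exact: steers_move px xy. Qed.

Lemma steers_of_move p q : move p q -> steers p q.
Proof. by apply: steers_move; exact: steers_refl. Qed.

Lemma steers_sym p q : steers p q -> steers q p.
Proof.
elim=> [|x y _ xp xy]; first exact: steers_refl.
by apply: steers_trans xp; apply: steers_of_move; exact: move_sym.
Qed.

Lemma steers_left g al h be k : SE3 k ->
  steers (g, al) (h, be) -> steers (k *m g, al) (k *m h, be).
Proof.
move=> hk H; suff: forall p q, steers p q -> steers (k *m p.1, p.2) (k *m q.1, q.2).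
  by move/(_ _ _ H).
move=> p q; elim=> [|[x x'] [y y'] _ px xy]; first exact: steers_refl.
by apply: steers_move px _; exact: move_left.
Qed.

Lemma steers_shift g al h be a : steers (g, al) (h, be) ->
  steers (g *m spin_g (- a), spin_shift al a) (h *m spin_g (- a), spin_shift be a).
Proof.
move=> H; suff: forall p q, steers p q ->
    steers (p.1 *m spin_g (- a), spin_shift p.2 a) (q.1 *m spin_g (- a), spin_shift q.2 a).
  by move/(_ _ _ H).
move=> p q; elim=> [|[x x'] [y y'] _ px xy]; first exact: steers_refl.
by apply: steers_move px _; exact: move_shift.
Qed.

End Steering.

(** * Spinning about link 0 *)

Section Screw.
Context {R : realType}.
Implicit Types (u v : 'cV[R]_3) (om t : R).

Lemma is_derive_scale_sin om t :
  is_derive t (1 : R) (fun x => sin (om * x)) (om * cos (om * t)).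
Proof.
have h : is_derive t (1 : R) (fun x => om * x) om.
  apply: (trigger_derive (is_derive_mul (is_derive_cst1 om t) (is_derive_id t (1 : R)))).
  by rewrite mul0r add0r mulr1.
by apply: (trigger_derive (is_derive_sin_comp h)); rewrite mulrC.
Qed.

Lemma is_derive_scale_cos om t :
  is_derive t (1 : R) (fun x => cos (om * x)) (- (om * sin (om * t))).
Proof.
have h : is_derive t (1 : R) (fun x => om * x) om.
  apply: (trigger_derive (is_derive_mul (is_derive_cst1 om t) (is_derive_id t (1 : R)))).
  by rewrite mul0r add0r mulr1.
by apply: (trigger_derive (is_derive_cos_comp h)); rewrite mulNr mulrC.
Qed.

(** The integral of [rot u (om * r) *m v] for [r] from 0 to [t]: uniform advance along the axis plus
    a circular part. *)
Definition screw_translation u om v t : 'cV[R]_3 :=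
  (t * dot u v) *: u + (sin (om * t) / om) *: (v - dot u v *: u)
  + ((1 - cos (om * t)) / om) *: cross u v.

Definition screw u om v t : 'M[R]_(3 + 1) :=
  se3 (rot u (om * t)) (screw_translation u om v t).

Lemma is_dmx_rot u om t : dot u u = 1 ->
  is_dmx (fun x => rot u (om * x)) t (rot u (om * t) *m cross_mx (om *: u)).
Proof.
move=> u1; have hs := is_derive_scale_sin om t; have hc := is_derive_scale_cos om t.
have := is_dmxD (is_dmxD (is_dmxZ hc (is_dmx_cst 1%:M t)) (is_dmxZ hs (is_dmx_cst (cross_mx u) t)))
  (is_dmxZ (is_deriveB (is_derive_cst1 1 t) hc) (is_dmx_cst (tensor u u) t)).
congr (is_dmx _ _ _); rewrite /rot cross_mxZ -scalemxAr !mulmxDl -!scalemxAl mul1mx.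
rewrite cross_mxM u1 tensor_cross_mx !scaler0 !addr0 sub0r opprK scale1r.
by apply/matrixP => i j; rewrite !mxE; ring.
Qed.

Lemma is_dmx_screw_translation u om v t : om != 0 ->
  is_dmx (screw_translation u om v) t (rot u (om * t) *m v).
Proof.
move=> om0; have hs := is_derive_scale_sin om t; have hc := is_derive_scale_cos om t.
have k1 := is_derive_cst1 (dot u v) t; have k2 := is_derive_cst1 om^-1 t.
have := is_dmxD (is_dmxD
  (is_dmxZ (is_derive_mul (is_derive_id t (1 : R)) k1) (is_dmx_cst u t))
  (is_dmxZ (is_derive_mul hs k2) (is_dmx_cst (v - dot u v *: u) t)))
  (is_dmxZ (is_derive_mul (is_deriveB (is_derive_cst1 1 t) hc) k2) (is_dmx_cst (cross u v) t)).
congr (is_dmx _ _ _); rewrite rotE !scaler0 !addr0 !mulr0 !addr0 sub0r opprK mul1r.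
by rewrite [RHS]addrAC; apply/matrixP => i j; rewrite !mxE; field.
Qed.

Lemma is_dmx_screw u om v t : dot u u = 1 -> om != 0 ->
  is_dmx (screw u om v) t (screw u om v t *m hat (col_mx v (om *: u))).
Proof.
move=> u1 om0; rewrite se3_hat col_mxKu col_mxKd.
apply: is_dmx_block; [exact: is_dmx_rot|exact: is_dmx_screw_translation| |]; exact: is_dmx_cst.
Qed.

Lemma SE3_screw u om v t : dot u u = 1 -> SE3 (screw u om v t).
Proof. by move=> u1; apply: SE3_se3; exact: rot_SO3. Qed.

Lemma screw0 u om v : screw u om v 0 = 1%:M.
Proof.
rewrite /screw /screw_translation mulr0 rot0 sin0 cos0 subrr !mul0r !scale0r !addr0.
exact: se3_1.
Qed.

Lemma lipschitz_C1 (f df : R -> R) : (forall t, is_derive t (1 : R) f (df t)) ->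
  (forall t, {for t, continuous df}) -> lipschitz_itv 0 1 f.
Proof.
move=> fd cd; have [c _ hc] : exists2 c, c \in `[0, 1]%R &
    forall t : R, t \in `[0, 1]%R -> `|df t| <= `|df c|.
  apply: (@EVT_max _ (fun t => `|df t|)) => //.
  apply: continuous_subspaceT => t.
  by apply: (continuous_comp (cd t)); exact: norm_continuous.
exists (`|df c| + 1) => [|x y hx hy]; first by rewrite ltr_wpDl.
wlog xy : x y hx hy / x <= y.
  move=> h; have [xy|/ltW yx] := leP x y; first exact: h.
  by rewrite distrC [X in _ * X]distrC; exact: h.
have [z zxy ->] := mean_value xy (fun z _ => fd z).
rewrite normrM ler_wpM2r//; apply: ler_wpDr => //; apply: hc.
case/andP: zxy hx hy => xz zy /andP[x0 _] /andP[_ y1].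
by rewrite in_itv/= (le_trans x0) ?(le_trans zy).
Qed.

Lemma smx_usub m n p (A : R -> 'M[R]_(m + n, p)) : smx A -> smx (fun t => usubmx (A t)).
Proof.
move=> hA t; have [d hd] := hA t; exists (usubmx d) => i j.
by rewrite !mxE; apply: is_derive_ext (hd _ _) => x; rewrite !mxE.
Qed.

Lemma smx_hat (xi : R -> 'cV[R]_(3 + 3)) : smx xi -> smx (fun t => hat (xi t)).
Proof.
move=> hx; apply: smx_block; [|exact: smx_usub|exact: smx_cst|exact: smx_cst].
apply: smx_cross_mx => t; have [d hd] := hx t.
by exists (dsubmx d); exact: is_dmx_dsub.
Qed.

Lemma hatN (xi : 'cV[R]_(3 + 3)) : hat (- xi) = - hat xi.
Proof. by rewrite -scaleN1r hatZ scaleN1r. Qed.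

Lemma spin_gE (a : R) : spin_g a = screw ez 1 0 a.
Proof.
rewrite /spin_g /screw /screw_translation mul1r; congr se3.
have -> : dot ez 0 = 0 :> R by rewrite -[0]/(0 : 'cV[R]_3) /dot !mxE; ring.
have -> : cross ez 0 = 0 :> 'cV[R]_3 by vec3.
by rewrite mulr0 !scale0r subr0 !scaler0 !addr0.
Qed.

Lemma spin_gV (a : R) : spin_g (- a) = se3 (rot ez a)^T 0.
Proof. by rewrite rot_tr. Qed.

Lemma spin_g_hat (a : R) xi :
  hat (diag2 (rot ez a) *m xi) = spin_g a *m hat xi *m spin_g (- a).
Proof. by rewrite hat_conj ?spin_gV//; exact: rot_ez_SO3. Qed.

Lemma is_dmx_spin_g (k t : R) : is_dmx (fun x => spin_g (- (k * x))) t
  (- (k *: (hat (col_mx 0 ez) *m spin_g (- (k * t))))).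
Proof.
have h : is_dmx (screw ez 1 0) (0 + t * - k)
    (spin_g (- (k * t)) *m hat (col_mx 0 (ez : 'cV[R]_3))).
  have -> : spin_g (- (k * t)) = screw ez 1 0 (0 + t * - k).
    by rewrite spin_gE add0r mulrN mulrC.
  by rewrite -[X in col_mx 0 X]scale1r; apply: is_dmx_screw (dot_ez) (oner_neq0 _).
have := is_dmx_affine h.
have -> : (fun x => screw ez 1 0 (0 + x * - k)) = (fun x => spin_g (- (k * x))).
  by apply/funext => x; rewrite spin_gE add0r mulrN mulrC.
congr (is_dmx _ _ _); rewrite scaleNr; congr (- (k *: _)).
have := spin_g_hat (- (k * t)) (col_mx 0 (ez : 'cV[R]_3)).
rewrite diag2_col mulmx0 rot_axis ?dot_ez// => {2}->.
by rewrite -mulmxA spin_gM addNr spin_g0 mulmx1.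
Qed.

End Screw.

Section Spin.
Context {R : realType} (Cpar Cperp Ctau : R) {N : nat} (ell : N.-tuple R).
Local Notation resistance := (resistance_mx Cpar Cperp Ctau ell).
Local Notation angles := (mobile N -> R * R).
Local Notation twist := (shape_twist Cpar Cperp Ctau ell).
Local Notation curve := (curve Cpar Cperp Ctau ell).
Local Notation steers := (steers Cpar Cperp Ctau ell).
Local Notation load := (shape_load Cpar Cperp ell).
Implicit Types (al be : angles) (c d : angles) (s : swimmer_shape R N).

Hypothesis unitM : forall s, resistance s \in unitmx.
Variable i0 : 'I_N.
Hypothesis i0_eq0 : (i0 == 0 :> nat)%N.

Lemma curve_C1 al c X : (forall t, SE3 (X t)) ->
  (forall t, is_dmx X t (X t *m hat (twist (line al c t) c))) -> curve al c X.
Proof.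
move=> sX dX; split=> // i j; apply: (lipschitz_C1 (fun t => dX t i j)) => t.
have sXt : smx X by move=> x; eexists; exact: dX.
have [d hd] := smxM sXt (smx_hat (smx_twist unitM al c)) t.
exact: is_dmx_continuous hd i j.
Qed.

(* Turning every other link about link 0 acts as a rigid rotation, which the swimmer
   compensates by a constant twist in the frame turning along. *)
Definition spin_rate (k : R) : angles := fun _ => (k, 0).

Definition spinning_twist s : 'cV[R]_(3 + 3) :=
  invmx (resistance s) *m col_mx 0 ((tnth ell i0 * Ctau) *: ez).

Lemma line_spin al k t : line al (spin_rate k) t = spin_shift al (k * t).
Proof. by apply/funext => j; rewrite /line /spin_shift /= mulr0 addr0 mulrC. Qed.

Lemma ddir_spin al k (i : 'I_N) : (0 < i)%N ->
  ddir al (spin_rate k) i = cross (k *: ez) (link_dir (shape_of al) i).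
Proof.
move=> lt0i; rewrite link_dirE /ddir; case: insubP => [j _ _|]; last by rewrite lt0i.
by rewrite /udir /dudir /ez !vec3S /=; apply: col3P; rewrite !vec3E; ring.
Qed.

(** The load is [rest_mx], that is the resistance minus [base_mx], applied to a multiple of (0; ez).
    The resistance cancels against its inverse, and [base_mx_ez] identifies what is left. *)
Lemma twist_spin al k :
  twist al (spin_rate k) = k *: (spinning_twist (shape_of al) - col_mx 0 ez).
Proof.
rewrite /shape_twist /shape_load (shape_rigid _ _ Ctau ell (dot_link_dir _) (k := k *: ez)); last first.
  exact: ddir_spin.
have -> : rest_mx Cpar Cperp Ctau ell (shape_of al) =
    resistance (shape_of al) - base_mx Cpar Cperp Ctau ell (shape_of al).
  by rewrite resistance_split addrK.
rewrite (_ : col_mx 0 (k *: ez) = k *: col_mx 0 ez); last by rewrite scale_col_mx scaler0.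
by rewrite -!scalemxAr mulmxBl (base_mx_ez _ _ _ _ i0_eq0) mulmxBr mulKmx// -scalerN opprB.
Qed.

(** In the frame turning with the links the twist is constant and the motion a screw; the factor
    [spin_g (- t)] returns to the frame fixed to link 0. *)
Lemma spin_steers al u om v t : dot u u = 1 -> om != 0 ->
  spinning_twist (shape_of al) = col_mx v (om *: u) ->
  steers (1%:M, al) (screw u om v t *m spin_g (- t), spin_shift al t).
Proof.
move=> u1 om0 eta; apply: steers_of_move.
exists (spin_rate t), (fun x => screw u om v (t * x) *m spin_g (- (t * x))).
split; rewrite /= ?mulr0 ?mulr1 ?screw0 ?oppr0 ?spin_g0 ?mulmx1//; last first.
  by rewrite line_spin mulr1.
apply: curve_C1 => x; first by apply: SE3M; [exact: SE3_screw|exact: SE3_spin_g].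
rewrite line_spin twist_shift//.
have h : is_dmx (fun x => screw u om v (t * x)) x
    (t *: (screw u om v (t * x) *m hat (col_mx v (om *: u)))).
  have e y : t * y = 0 + y * t by rewrite add0r mulrC.
  rewrite (e x) (_ : (fun x => _) = fun x => screw u om v (0 + x * t)).
    by apply: is_dmx_affine; exact: is_dmx_screw.
  by apply/funext => y; rewrite e.
have := is_dmxM h (is_dmx_spin_g t x); congr (is_dmx _ _ _).
rewrite spin_g_hat !mulmxA -(mulmxA (screw _ _ _ _)) spin_gM addNr spin_g0 mulmx1.
rewrite twist_spin eta hatZ hatD hatN.
rewrite -scalemxAl mulmxN -scalemxAr mulmxA -scalerBr -scalemxAr -scalemxAl.
by rewrite mulmxBr mulmxBl.
Qed.

End Spin.

(** * Loops of shapes closing up to a spin *)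

Section Holonomy.
Context {R : realType} (Cpar Cperp Ctau : R) {N : nat} (ell : N.-tuple R).
Local Notation resistance := (resistance_mx Cpar Cperp Ctau ell).
Local Notation angles := (mobile N -> R * R).
Local Notation twist := (shape_twist Cpar Cperp Ctau ell).
Local Notation curve := (curve Cpar Cperp Ctau ell).
Local Notation steers := (steers Cpar Cperp Ctau ell).
Local Notation spin_twist := (spinning_twist Cpar Cperp Ctau ell).
Implicit Types (al be : angles) (c : angles) (P Q : 'M[R]_3) (x y u v k : 'cV[R]_3).

Hypothesis unitM : forall s, resistance s \in unitmx.
Variable i0 : 'I_N.
Hypothesis i0_eq0 : (i0 == 0 :> nat)%N.

(* Shapes differing by [spin_shift] are the same up to a rotation of the co-moving frame,
   namely [spin_g]; loops are only required to close up to this symmetry. *)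
Definition hol al P x (a : R) :=
  SO3 P /\ steers (1%:M, al) (se3 P x *m spin_g (- a), spin_shift al a).

Lemma spin_shiftD al a b : spin_shift (spin_shift al a) b = spin_shift al (a + b).
Proof. by apply/funext => j; rewrite /spin_shift /= addrA. Qed.

Lemma spin_shift0 al : spin_shift al 0 = al.
Proof. by apply/funext => j; rewrite /spin_shift addr0; case: (al j). Qed.

Lemma se3V P x : SO3 P -> se3 P^T (- (P^T *m x)) *m se3 P x = 1%:M.
Proof. by move=> [PP _]; rewrite se3M PP addrN se3_1. Qed.

Lemma holM al P x r Q y s : hol al P x r -> hol al Q y s ->
  hol al (P *m Q) (P *m y + x) (r + s).
Proof.
move=> [sP hP] [sQ hQ]; split; first exact: SO3_mul.
apply: (steers_trans hP); have := steers_left (SE3_se3 x sP) (steers_shift unitM r hQ).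
by rewrite mul1mx -(mulmxA (se3 Q y)) spin_gM mulmxA se3M spin_shiftD -opprD [s + r]addrC.
Qed.

Lemma holV al P x r : hol al P x r -> hol al P^T (- (P^T *m x)) (- r).
Proof.
move=> [sP hP]; split; first exact: SO3_trmx.
have := steers_left (SE3_se3 (- (P^T *m x)) (SO3_trmx sP))
  (steers_shift unitM (- r) (steers_sym hP)).
by rewrite -mulmxA spin_gM !opprK addNr spin_g0 mulmx1 se3V// mul1mx spin_shiftD subrr spin_shift0.
Qed.

Lemma hol_SO3 al P x r : hol al P x r -> SO3 P. Proof. by case. Qed.

(** Go to [be], run the loop and return along the reversed path, shifted by the closing angle [r] of
    the loop; the linear part gets conjugated. *)
Lemma hol_transport al be P x Q y r : SO3 P -> steers (1%:M, al) (se3 P x, be) ->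
  hol be Q y r -> exists z, hol al (P *m Q *m P^T) z r.
Proof.
move=> sP h [sQ hQ]; exists (P *m Q *m (- (P^T *m x)) + (P *m y + x)).
split; first by apply: SO3_mul; [exact: SO3_mul|exact: SO3_trmx].
apply: (steers_trans h); have := steers_left (SE3_se3 x sP) hQ.
rewrite mulmx1 => h1; apply: (steers_trans h1).
have g1 : SE3 (se3 (P *m Q *m P^T) (P *m Q *m (- (P^T *m x)) + (P *m y + x))).
  by apply: SE3_se3; apply: SO3_mul; [exact: SO3_mul|exact: SO3_trmx].
have := steers_left g1 (steers_shift unitM r (steers_sym h)).
have -> : se3 (P *m Q *m P^T) (P *m Q *m (- (P^T *m x)) + (P *m y + x)) =
    se3 P x *m se3 Q y *m se3 P^T (- (P^T *m x)) by rewrite !se3M.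
rewrite mul1mx [X in steers (X, _) _]mulmxA -(mulmxA _ _ (se3 P x)) se3V// mulmx1.
by rewrite (mulmxA (se3 P x)).
Qed.

Lemma hol_full_axis al be P x u om v : dot u u = 1 -> om != 0 ->
  spin_twist i0 (shape_of be) = col_mx v (om *: u) ->
  SO3 P -> steers (1%:M, al) (se3 P x, be) -> full_axis (hol al) (P *m u).
Proof.
move=> u1 om0 eta sP h; split=> [|t]; first by rewrite dot_SO3.
have hb : hol be (rot u t) (screw_translation u om v (t / om)) (t / om).
  split; first exact: rot_SO3.
  have := spin_steers unitM i0_eq0 (t / om) u1 om0 eta.
  by rewrite /screw [om * _]mulrC divfK.
by have [z hz] := hol_transport sP h hb; exists z, (t / om); rewrite -rot_conj.
Qed.

(** A full turn of the screw has trivial rotation and advances along the axis by [r * dot u v],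
    nonzero because the pitch is. *)
Lemma hol_translation al u om v : dot u u = 1 -> om != 0 ->
  spin_twist i0 (shape_of al) = col_mx v (om *: u) -> dot v u != 0 ->
  exists y r, y != 0 /\ hol al 1%:M y r.
Proof.
move=> u1 om0 eta uv0; pose r := 2 * pi / om; exists ((r * dot u v) *: u), r; split.
  rewrite scaler_eq0 !mulf_eq0 invr_eq0 (negbTE om0) pnatr_eq0 (gt_eqF (pi_gt0 R)) dotC.
  rewrite (negbTE uv0) /=; apply/eqP => u0; move: u1; rewrite u0.
  by rewrite /dot !mxE !mul0r !addr0 => /eqP; rewrite eq_sym oner_eq0.
split; first exact: SO3_1.
have := spin_steers unitM i0_eq0 r u1 om0 eta.
rewrite /screw /screw_translation (_ : om * r = pi *+ 2); last first.
  by rewrite /r mulrC divfK// mulr_natl.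
by rewrite /rot cos2pi sin2pi subrr !mul0r !scale0r !addr0 scale1r.
Qed.

(** Places time 0 in the interior, so that derivatives at [al] are two-sided: a curve on [0, 1] is
    started at [line al c (- 2^-1)] and left-translated to the identity at its midpoint. *)
Lemma centered_curve al c : exists Y : R -> 'M[R]_(3 + 1), [/\ Y 0 = 1%:M,
  forall t : R, - 2^-1 < t < 2^-1 -> SE3 (Y t),
  forall t : R, - 2^-1 < t < 2^-1 -> is_dmx Y t (Y t *m hat (twist (line al c t) c)) &
  forall t : R, - 2^-1 < t < 2^-1 -> steers (1%:M, al) (Y t, line al c t)].
Proof.
pose be := line al c (- 2^-1); have [X [cX X0]] := curve_exists unitM be c.
have beE t : line be c (2^-1 + t * 1) = line al c t.
  by apply/funext => j; rewrite /be /line /=; congr pair; ring.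
have half01 : (0 : R) <= 2^-1 <= (1 : R) by apply/andP; split; lra.
have [_ sX dX] := cX; have [P [x [sP XE]]] := (SE3P _).1 (sX _ half01).
pose K : 'M[R]_(3 + 1) := se3 P^T (- (P^T *m x)).
have sK : SE3 K by apply: SE3_se3; exact: SO3_trmx.
have KX : K *m X 2^-1 = 1%:M by rewrite XE se3V.
exists (fun t => K *m X (2^-1 + t * 1)); split.
- by rewrite mul0r addr0.
- by move=> t /andP[? ?]; apply: SE3M => //; apply: sX; apply/andP; split; lra.
- move=> t /andP[? ?]; rewrite -mulmxA; apply: is_dmxMl.
  rewrite -[_ *m hat _]scale1r; apply: (@is_dmx_affine _ _ _ X).
  by rewrite -beE; apply: dX; apply/andP; split; lra.
- move=> t /andP[? ?]; have [->|t0] := eqVneq t 0.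
    by rewrite line0 mul0r addr0 KX; exact: steers_refl.
  have t1 : 0 <= 2^-1 + t * 1 <= 1 by apply/andP; split; lra.
  have th : 2^-1 != 2^-1 + t * 1 by rewrite mulr1 -subr_eq0 opprD addNKr oppr_eq0.
  have := steers_left sK (steers_of_move (move_sub cX half01 t1 th)).
  by rewrite KX beE; have := beE 0; rewrite mul0r addr0 line0 => ->.
Qed.

End Holonomy.

(** * Turning the spin axis *)

Lemma dsubmxD (R : nmodType) m n p (a b : 'M[R]_(m + n, p)) :
  dsubmx (a + b) = dsubmx a + dsubmx b.
Proof. by apply/matrixP => i j; rewrite !mxE. Qed.

Lemma dsubmxN (R : zmodType) m n p (a : 'M[R]_(m + n, p)) : dsubmx (- a) = - dsubmx a.
Proof. by apply/matrixP => i j; rewrite !mxE. Qed.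

Lemma dsubmxZ (R : pzSemiRingType) m n p k (a : 'M[R]_(m + n, p)) :
  dsubmx (k *: a) = k *: dsubmx a.
Proof. by apply/matrixP => i j; rewrite !mxE. Qed.

Lemma cross_scale (R : realType) (l m : R) (P : 'M[R]_3) a b :
  cross (l *: a) (P *m (m *: b)) = (l * m) *: cross a (P *m b).
Proof.
rewrite -scalemxAr; move: (P *m b) => d.
by apply: col3P; rewrite !(crossE, mxE); ring.
Qed.

Section Turning.
Context {R : realType} (Cpar Cperp Ctau : R) {N : nat} (ell : N.-tuple R).
Local Notation resistance := (resistance_mx Cpar Cperp Ctau ell).
Local Notation angles := (mobile N -> R * R).
Local Notation twist := (shape_twist Cpar Cperp Ctau ell).
Local Notation spin_twist := (spinning_twist Cpar Cperp Ctau ell).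
Local Notation rest := (rest_mx Cpar Cperp Ctau ell).
Local Notation base := (base_mx Cpar Cperp Ctau ell).

Hypothesis unitM : forall s, resistance s \in unitmx.
Variable i0 : 'I_N.
Hypothesis i0_eq0 : (i0 == 0 :> nat)%N.

Variables (al c : angles) (k : 'cV[R]_3).
Hypothesis k1 : dot k k = 1.
Local Notation sh t := (shape_of (line al c t)).
Hypothesis rigid : forall t (i : 'I_N), (0 < i)%N ->
  link_dir (sh t) i = rot k t *m link_dir (shape_of al) i.

Local Notation M := (resistance (shape_of al)).
Local Notation B := (base (shape_of al)).
Local Notation KK := (diag2 (cross_mx k)).
Let eta := invmx M *m col_mx 0 ez.

Lemma ddir_rigid (i : 'I_N) : (0 < i)%N ->
  ddir al c i = cross k (link_dir (shape_of al) i).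
Proof.
move=> lt0i; have h1 := is_dmx_link_dir al c i 0; rewrite line0 in h1.
have := is_dmxMr (link_dir (shape_of al) i) (is_dmx_rot 1 0 k1).
rewrite mulr0 rot0 mul1mx scale1r cross_mxE => h2.
apply: (is_dmx_unique h1); have -> // : (fun x => link_dir (sh x) i) =
  fun x => rot k (1 * x) *m link_dir (shape_of al) i.
by apply/funext => x; rewrite rigid// mul1r.
Qed.

Lemma twist_rigid : twist al c = invmx M *m (B *m col_mx 0 k) - col_mx 0 k.
Proof.
rewrite /shape_twist /shape_load (shape_rigid _ _ Ctau ell (dot_link_dir _) ddir_rigid).
have -> : rest (shape_of al) = M - B by rewrite resistance_split addrK.
by rewrite mulmxBl mulmxBr mulKmx// opprB.
Qed.

Lemma base_mx_cst s s' : base s = base s'.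
Proof. by rewrite !(base_mxE _ _ _ _ i0_eq0). Qed.

Lemma resistance_rigid t : resistance (sh t) =
  diag2 (rot k t) *m rest (shape_of al) *m (diag2 (rot k t))^T + B.
Proof.
by rewrite resistance_split (rest_mx_equiv _ _ _ _ (rot_SO3 t k1) (rigid t)) (base_mx_cst (sh t)
  (shape_of al)).
Qed.

Lemma is_dmx_resistance_rigid : is_dmx (fun t => resistance (sh t)) 0
  (KK *m rest (shape_of al) - rest (shape_of al) *m KK).
Proof.
have hr := is_dmx_rot 1 0 k1; rewrite mulr0 rot0 mul1mx scale1r in hr.
have h0 := is_dmx_cst (0 : 'M[R]_3) 0.
have hd := is_dmx_block hr h0 h0 hr; rewrite -/(KK) in hd.
have := is_dmxD (is_dmxM (is_dmxMr (rest (shape_of al)) hd) (is_dmx_tr hd)) (is_dmx_cst B 0).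
rewrite mulr0 rot0 -/(diag2 _) -/(diag2 _) diag2_1 trmx1 mulmx1 mul1mx addr0.
rewrite diag2_tr cross_mx_tr (_ : diag2 (- cross_mx k) = - KK); last first.
  by rewrite /diag2 opp_block_mx oppr0.
rewrite mulmxN; apply: is_dmx_ext => t.
by rewrite resistance_rigid mul1r.
Qed.

(** The resistance has derivative the commutator of [KK] with [M - B]. The part with [M] simplifies
    by [M *m eta = col_mx 0 ez] and leaves the two terms with [cross k]; the part with [B] remains
    as it is. *)
Lemma is_dmx_spin_axis : is_dmx (fun t => dsubmx (invmx (resistance (sh t)) *m col_mx 0 ez)) 0
  (dsubmx (invmx M *m ((KK *m B - B *m KK) *m eta)) - dsubmx (invmx M *m col_mx 0 (cross k ez))
   + cross k (dsubmx eta)).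
Proof.
have := is_dmx_dsub (is_dmxMr (col_mx 0 ez) (is_dmx_inv (fun t => unitM (sh t))
  is_dmx_resistance_rigid)).
congr (is_dmx _ _ _); rewrite line0 mulNmx -!mulmxA -/eta.
have -> : rest (shape_of al) = M - B by rewrite resistance_split addrK.
rewrite (_ : (KK *m (M - B) - (M - B) *m KK) *m eta =
    col_mx 0 (cross k ez) - M *m (KK *m eta) - (KK *m B - B *m KK) *m eta); last first.
  have -> : col_mx 0 (cross k ez) = KK *m (M *m eta).
    by rewrite /eta mulKVmx// diag2_col mulmx0 cross_mxE.
  rewrite mulmxBr mulmxBl !mulmxBl !mulmxA.
  by apply/matrixP => i j; rewrite !mxE; ring.
have <- : dsubmx (KK *m eta) = cross k (dsubmx eta).
  by rewrite -{1}[eta]vsubmxK diag2_col col_mxKd cross_mxE.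
move: (KK *m eta) (col_mx 0 _) (_ *m eta) => a b d.
rewrite 2!mulmxBr mulKmx// !opprB !dsubmxD dsubmxN.
by rewrite [RHS]addrAC -addrA.
Qed.

(** The bracket is the derivative of the spin axis seen from the laboratory. The term [cross k w]
    cancels against the [- k] in [twist_rigid], and clearing inverses with [\det M ^+ 2] gives
    [axis_drift]. *)
Lemma turning_axis_drift w : w = dsubmx eta ->
  turning M B k != 0 ->
  cross w (cross (dsubmx (twist al c)) w
    + (dsubmx (invmx M *m ((KK *m B - B *m KK) *m eta))
       - dsubmx (invmx M *m col_mx 0 (cross k ez)) + cross k w)) != 0.
Proof.
move=> ->; apply: contra_neq; set d := (X in cross _ X).
have adjE : \adj M = \det M *: invmx M.
  by rewrite /invmx unitM scalerA divff ?scale1r// -unitfE -unitmxE.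
have spinE : spin_vec M = \det M *: eta by rewrite /spin_vec adjE -scalemxAl.
have driftE : axis_drift M B k = (\det M ^+ 2) *: d.
  rewrite /axis_drift spinE adjE /d twist_rigid -!scalemxAl -!scalemxAr !dsubmxZ.
  rewrite dsubmxD dsubmxN col_mxKd.
  move: (dsubmx _) (dsubmx _) (dsubmx _) (dsubmx _) (\det M) => a1 a2 a3 a4 {}d.
  by apply: col3P; rewrite !(crossE, mxE); ring.
rewrite /turning driftE spinE dsubmxZ => h.
have -> : cross ((\det M ^+ 2) *: d) (\det M *: dsubmx eta) =
    - (\det M ^+ 3) *: cross (dsubmx eta) d.
  by apply: col3P; rewrite !(crossE, mxE); ring.
by rewrite h scaler0 /dot !mxE !mulr0 !addr0.
Qed.

(** If the axis carried along by the body stayed parallel to the initial one, the cross product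
    would vanish identically near 0, and so would its derivative there. *)
Lemma turning_axis (Y : R -> 'M[R]_(3 + 1)) : Y 0 = 1%:M ->
  (forall t : R, - 2^-1 < t < 2^-1 -> is_dmx Y t (Y t *m hat (twist (line al c t) c))) ->
  tnth ell i0 * Ctau != 0 -> turning M B k != 0 ->
  exists2 t : R, - 2^-1 < t < 2^-1 &
    cross (dsubmx (spin_twist i0 (shape_of al)))
      (ulsubmx (Y t) *m dsubmx (spin_twist i0 (sh t))) != 0.
Proof.
move=> Y0 dY lam0; apply: contraPP => /forall2NP noturn.
have spinE s : spin_twist i0 s =
    (tnth ell i0 * Ctau) *: (invmx (resistance s) *m col_mx 0 ez).
  by rewrite /spinning_twist scalemxAr scale_col_mx scaler0.
have par t : - 2^-1 < t < 2^-1 -> cross (dsubmx eta)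
    (ulsubmx (Y t) *m dsubmx (invmx (resistance (sh t)) *m col_mx 0 ez)) = 0.
  move=> tt; have [ntt|/negP] := noturn t; first by case: (ntt tt).
  rewrite negbK spinE dsubmxZ (spinE (sh t)) dsubmxZ.
  rewrite cross_scale scaler_eq0 mulf_eq0 (negbTE lam0) => /eqP.
  exact.
have half0 : - 2^-1 < (0 : R) < 2^-1 by apply/andP; split; lra.
have dP := is_dmx_ulsub (dY 0 half0).
rewrite Y0 line0 mul1mx block_mxKul in dP.
have := is_dmx_cross (is_dmx_cst (dsubmx eta) 0) (is_dmxM dP is_dmx_spin_axis).
have -> (b : 'cV[R]_3) : cross 0 b = 0 by vec3.
rewrite add0r line0 -/eta cross_mxE Y0 (scalar_mx_block 3 1) block_mxKul mul1mx => h.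
have z : is_dmx (fun=> 0 : 'cV[R]_3) 0 0 by exact: is_dmx_cst.
have near0 : \forall t \near (0 : R), 0 = cross (dsubmx eta)
    (ulsubmx (Y t) *m dsubmx (invmx (resistance (sh t)) *m col_mx 0 ez)).
  near=> t; rewrite par//.
  have : `|t - 0| < 2^-1 by near: t; exact: near_dist_lt.
  by rewrite subr0 ltr_norml.
have e := is_dmx_unique (is_dmx_near near0 z) h.
move/(turning_axis_drift (erefl _)); rewrite -e eqxx.
Unshelve. all: by end_near. Qed.

End Turning.

Lemma cross0v (R : realType) (v : 'cV[R]_3) : cross 0 v = 0.
Proof. by vec3. Qed.

Lemma crossv0 (R : realType) (v : 'cV[R]_3) : cross v 0 = 0.
Proof. by vec3. Qed.

Lemma cross_mul_neq0 (R : realType) (P : 'M[R]_3) (a b : 'cV[R]_3) :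
  cross a (P *m b) != 0 -> a != 0 /\ b != 0.
Proof.
by move=> h; split; apply: contra_neq h => ->; rewrite ?mulmx0 ?cross0v ?crossv0.
Qed.

Lemma unit_direction (R : realType) (w : 'cV[R]_3) : w != 0 ->
  exists u om, [/\ dot u u = 1, om != 0 & w = om *: u].
Proof.
move=> w0; have ww : 0 < dot w w.
  by rewrite lt_neqAle dot_ge0 andbT eq_sym; apply: contra_neq w0 => /dot_eq0.
have [m m0 m2] : exists2 m, 0 < m & m ^+ 2 = dot w w.
  by exists (Num.sqrt (dot w w)); rewrite ?sqrtr_gt0// sqr_sqrtr// ltW.
exists (m^-1 *: w), m; split.
- by rewrite dotZl dotZr -m2; field; rewrite gt_eqF.
- by rewrite gt_eqF.
- by rewrite scalerA divff ?scale1r// gt_eqF.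
Qed.

(** * Reaching every rigid motion at one final shape *)

Section Reach.
Context {R : realType} (Cpar Cperp Ctau : R) {N : nat} (ell : N.-tuple R).
Local Notation resistance := (resistance_mx Cpar Cperp Ctau ell).
Local Notation base := (base_mx Cpar Cperp Ctau ell).
Local Notation angles := (mobile N -> R * R).
Local Notation steers := (steers Cpar Cperp Ctau ell).
Local Notation spin_twist := (spinning_twist Cpar Cperp Ctau ell).

Hypothesis unitM : forall s, resistance s \in unitmx.
Variable i0 : 'I_N.
Hypothesis i0_eq0 : (i0 == 0 :> nat)%N.
Hypothesis lam0 : tnth ell i0 * Ctau != 0.

Section Turn.
Variables (al c : angles) (k : 'cV[R]_3).
Hypothesis k1 : dot k k = 1.
Hypothesis rigid : forall t (i : 'I_N), (0 < i)%N ->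
  link_dir (shape_of (line al c t)) i = rot k t *m link_dir (shape_of al) i.
Hypothesis pitch0 : pitch (resistance (shape_of al)) != 0.
Hypothesis turning0 : turning (resistance (shape_of al)) (base (shape_of al)) k != 0.

(** The two axes are [u], from spinning at [al], and [P1 *m u'], from spinning at the bent shape and
    travelling there and back; a full turn at [al] supplies the translation. *)
Lemma hol_all P x : SO3 P -> hol Cpar Cperp Ctau ell al P x 0.
Proof.
have [Y [Y0 sY dY hY]] := centered_curve unitM al c.
have [t tt turn] := turning_axis unitM i0_eq0 k1 rigid Y0 dY lam0 turning0.
have [P1 [x1 [sP1 YE]]] := (SE3P _).1 (sY t tt).
have stY := hY t tt; rewrite YE in stY.
rewrite YE block_mxKul in turn.
set s0 := spin_twist i0 (shape_of al) in turn *.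
set s1 := spin_twist i0 _ in turn *.
have [w0 w1] := cross_mul_neq0 turn.
have [u [om [u1 om0 s0E]]] := unit_direction w0.
have [u' [om' [u'1 om'0 s1E]]] := unit_direction w1.
have eta0 : s0 = col_mx (usubmx s0) (om *: u) by rewrite -s0E vsubmxK.
have eta1 : s1 = col_mx (usubmx s1) (om' *: u') by rewrite -s1E vsubmxK.
have pit : dot (usubmx s0) u != 0.
  apply: contra_neq pitch0 => h; set M := resistance (shape_of al).
  have e : spin_vec M = (\det M / (tnth ell i0 * Ctau)) *: s0.
    rewrite /spin_vec /s0 /spinning_twist /invmx unitM.
    rewrite (_ : col_mx 0 (_ *: ez) = (tnth ell i0 * Ctau) *: col_mx 0 ez); last first.
      by rewrite scale_col_mx scaler0.
    rewrite -scalemxAl -scalemxAr !scalerA -/M (_ : _ * _ = 1) ?scale1r//.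
    have := unitM (shape_of al); rewrite unitmxE unitfE -/M => d0.
    have /andP[l0 c0] : (tnth ell i0 != 0) && (Ctau != 0).
      by have := lam0; rewrite mulf_eq0 negb_or.
    by field; rewrite ?d0 ?l0 ?c0.
  by rewrite /pitch e eta0 !linearZ /= col_mxKu col_mxKd dotZl !dotZr h !mulr0.
have [y [r [y0 hy]]] := hol_translation unitM i0_eq0 u1 om0 eta0 pit.
have f0 : full_axis (hol Cpar Cperp Ctau ell al) u.
  have := hol_full_axis unitM i0_eq0 u1 om0 eta0 SO3_1 (x := 0).
  rewrite se3_1 mul1mx; apply; exact: steers_refl.
have f1 := hol_full_axis unitM i0_eq0 u'1 om'0 eta1 sP1 stY.
have sh Q z r' (h : hol Cpar Cperp Ctau ell al Q z r') := hol_SO3 h.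
suff uv : cross u (P1 *m u') != 0.
  move=> sP; apply: holonomy_full f0 f1 uv y0 hy sP => //.
  - exact: holM.
  - exact: holV.
apply: contra_neq turn => h.
by rewrite s0E s1E cross_scale h scaler0.
Qed.

(** Drive the angles straight to [al], wherever this takes the body; a loop at [al] then realizes
    the missing motion, the inverse of [se3 P x] times [se3 Q y]. *)
Lemma reach (g0 g1 : 'M[R]_(3 + 1)) (al0 : angles) : SE3 g0 -> SE3 g1 ->
  exists be, steers (g0, al0) (g1, be).
Proof.
move=> h0 h1; exists al.
pose d : angles := fun j => ((al j).1 - (al0 j).1, (al j).2 - (al0 j).2).
have dE : line al0 d 1 = al.
  by apply/funext => j; rewrite /line /d /= !mul1r !subrKC; case: (al j).
have [X [cX X0]] := curve_exists unitM al0 d.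
have m : move Cpar Cperp Ctau ell (1%:M, al0) (X 1, al) by exists d, X; split.
have [_ sX _] := cX.
have sX1 : SE3 (X 1) by apply: sX; rewrite ler01 lexx.
have /SE3P[P [x [sP gE]]] : SE3 (g0 *m X 1) := SE3M h0 sX1.
have /SE3P[Q [y [sQ g1E]]] := h1.
have := steers_left h0 (steers_of_move m); rewrite mulmx1 => st.
apply: (steers_trans st).
have [_ hol1] := hol_all (P^T *m (y - x)) (SO3_mul (SO3_trmx sP) sQ).
have := steers_left (SE3_se3 x sP) hol1.
rewrite oppr0 spin_g0 mulmx1 spin_shift0 mulmx1 se3M !mulmxA (mulmx1C sP.1) !mul1mx subrK.
by rewrite -gE -g1E.
Qed.

End Turn.

End Reach.

Section BentShape.
Context {R : realType} (N : nat) (phi0 : R).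

(* Link 1 is orthogonal to link 0, and the other links rotate about it. *)
Definition bent_angles : mobile N -> R * R :=
  fun j => if val (val j) == 1%N then (0, pi / 2) else (pi / 2, phi0).

Definition bend_rate : mobile N -> R * R :=
  fun j => (0, (val (val j) != 1%N)%:R).

Lemma link_dir_bent t (i : 'I_N) : (0 < i)%N ->
  link_dir (shape_of (line bent_angles bend_rate t)) i =
  if val i == 1%N then ex else vec3 0 (sin (phi0 + t)) (cos (phi0 + t)).
Proof.
move=> lt0i; rewrite link_dirE; case: insubP => [j _ <-|]; last by rewrite lt0i.
rewrite /line /bent_angles /bend_rate; case: eqP => _ /=; rewrite /udir !mulr0 ?mulr1 !addr0.
  by rewrite cos0 sin0 sin_pihalf cos_pihalf !mul0r mulr1.
by rewrite cos_pihalf sin_pihalf mul0r mul1r.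
Qed.

(** The angle phi is measured from [ez] and theta is [pi / 2], so increasing phi turns [ez] towards
    the second axis, which is a rotation about [- ex]. *)
Lemma bent_rigid t (i : 'I_N) : (0 < i)%N ->
  link_dir (shape_of (line bent_angles bend_rate t)) i =
  rot (- ex) t *m link_dir (shape_of bent_angles) i.
Proof.
move=> lt0i; rewrite -[in RHS](line0 bent_angles bend_rate) !link_dir_bent//.
rewrite addr0 rotE; case: eqP => _.
  by rewrite /ex !vec3S; apply: col3P; rewrite !vec3E; ring.
by rewrite /ex !vec3S sinD cosD; apply: col3P; rewrite !vec3E; ring.
Qed.

End BentShape.

(** * Uniqueness of solutions *)

Section Uniqueness.
Context {R : realType}.

Lemma velocity_unique (T : R) (f g v : R -> R) : has_velocity 0 T f v -> has_velocity 0 T g v ->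
  forall t, 0 <= t <= T -> f t - g t = f 0 - g 0.
Proof.
move=> [acf df] [acg dg]; apply: (@ac_derive0_cst _ 0 T (fun t => f t - g t)).
  by apply: acD => //; exact: acN.
apply: filterS2 df dg => t hf hg tT /=.
by apply: (trigger_derive (is_deriveB (hf tT) (hg tT))); rewrite subrr.
Qed.

(** The lifts differ by a constant, which is a multiple of [2 * pi] because the curves agree at
    0. *)
Lemma circle_velocity_unique (T : R) (f g : R -> circle R) (v : R -> R) :
  has_circle_velocity 0 T f v -> has_circle_velocity 0 T g v -> f 0 = g 0 ->
  forall t, 0 <= t <= T -> f t = g t.
Proof.
move=> [F fF vF] [G gG vG] fg0 t tT; have /andP[t0 t1] := tT.
have T0 : (0 : R) <= 0 <= T by rewrite lexx (le_trans t0).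
rewrite fF// gG//; apply/to_circleP; rewrite (velocity_unique vF vG tT).
by apply/to_circleP; rewrite -fF// -gG.
Qed.

Lemma SO3_entry (P : 'M[R]_3) i j : SO3 P -> `|P i j| <= 1.
Proof.
move=> [PP _]; have : (P^T *m P) j j = 1 by rewrite PP mxE eqxx.
rewrite mxE (bigD1 i)//= mxE => h.
have h0 : 0 <= \sum_(k < 3 | k != i) P^T j k * P k j.
  by apply: sumr_ge0 => k _; rewrite mxE -expr2 sqr_ge0.
by rewrite ler_norml; apply/andP; split; nra.
Qed.

Lemma cst_mx_ae n m (A : R -> 'M[R]_(n, m)) a b :
  (forall i j, absolutely_continuous a b (fun x => A x i j)) ->
  {ae lebesgue_measure, forall t : measurableTypeR R, `]a, b[%classic t -> is_dmx A t 0} ->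
  forall t, a <= t <= b -> A t = A a.
Proof.
move=> acA A0 t tab; apply/matrixP => i j.
apply: (ac_derive0_cst (acA i j) _) tab; apply: filterS A0 => s hs sab.
by have := hs sab i j; rewrite mxE.
Qed.

Context (Cpar Cperp Ctau : R) {N : nat} (ell : N.-tuple R).
Local Notation motion := (motion_equation Cpar Cperp Ctau ell).
Local Notation solution := (swimmer_solution Cpar Cperp Ctau ell).

Definition body_twist (s : R -> swimmer_shape R N) (t : R) : 'cV[R]_(3 + 3) :=
  - (invmx (resistance_mx Cpar Cperp Ctau ell (s t)) *m
     shape_load Cpar Cperp ell (s t) (fun i => derive1 (fun r : R => link_dir (s r) i) t)).

Lemma invmx_SO3 (P : 'M[R]_3) : SO3 P -> invmx P = P^T.
Proof.
move=> [PP _]; have uP : P \in unitmx by have [] := mulmx1_unit PP.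
by rewrite -[LHS]mul1mx -PP mulmxK.
Qed.

(** Eliminates the spatial angular velocity [omega], which is [P] times the angular part of the body
    twist, and leaves a linear equation in the rotation and translation blocks. *)
Lemma motion_equationP g s t : SE3 (g t) ->
  motion g s t <-> derivable g t 1 /\
    [/\ ulsubmx (derive1 g t) = ulsubmx (g t) *m cross_mx (dsubmx (body_twist s t)) &
        ursubmx (derive1 g t) = ulsubmx (g t) *m usubmx (body_twist s t)].
Proof.
move=> /SE3P[P [x [sP gE]]]; have [uP PP] := sP; have PPT := mulmx1C uP.
rewrite /motion_equation gE block_mxKul invmx_SO3//; split=> [[dg [om omE e]]|[dg [dP dx]]].
  split=> //; rewrite -[body_twist s t]/(- _ : 'cV[R]_(3 + 3)) /shape_load -e.
  rewrite col_mxKd col_mxKu mulmxA PPT mul1mx; split=> //.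
  have -> : ulsubmx (derive1 g t) = cross_mx om *m P.
    have -> : cross_mx om = ulsubmx (derive1 g t) *m P^T.
      by apply/matrixP => i j; have := omE (delta_mx j 0) => /matrixP/(_ i 0);
         rewrite -colE mxE => ->; rewrite mxE.
    by rewrite -mulmxA uP mulmx1.
  rewrite cross_mx_SO3; last exact: SO3_trmx.
  by rewrite trmxK !mulmxA PPT mul1mx.
split=> //; exists (P *m dsubmx (body_twist s t)).
  by move=> v; rewrite dP -cross_mx_SO3// cross_mxE.
rewrite dx !mulmxA uP !mul1mx vsubmxK.
by [].
Qed.

(** The controls determine the shapes, hence a common body twist. Since it acts on the right through
    a skew matrix, the product of one rotation with the transpose of the other has zero derivative
    almost everywhere; then so does the difference of the positions. *)
Lemma swimmer_unique T u1 u2 g s g' s' : solution T u1 u2 g s -> solution T u1 u2 g' s' ->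
  g' 0 = g 0 -> s' 0 = s 0 -> forall t, 0 <= t <= T -> g' t = g t /\ s' t = s t.
Proof.
move=> [sg acg hphi hth hm] [sg' acg' hphi' hth' hm'] g0 s0.
have ss t : 0 <= t <= T -> s' t = s t.
  move=> tT; apply/funext => j; rewrite [LHS]surjective_pairing [RHS]surjective_pairing.
  congr pair.
    apply/eqP; rewrite -subr_eq0 (velocity_unique (hth' j) (hth j) tT).
    by rewrite s0 subrr.
  by apply: (circle_velocity_unique (hphi' j) (hphi j)) tT; rewrite s0.
move=> t tT; split; last exact: ss.
have tw r : 0 < r < T -> body_twist s' r = body_twist s r.
  move=> /andP[r0 rT]; have rT' : 0 <= r <= T by rewrite !ltW.
  have de : (fun i => derive1 (fun q : R => link_dir (s' q) i) r) =
      (fun i => derive1 (fun q : R => link_dir (s q) i) r).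
    apply/funext => i; rewrite !derive1E; apply: near_eq_derive; near=> y; rewrite ss//.
    have yr : `|y - r| < r by near: y; exact: near_dist_lt.
    have yT : `|y - r| < T - r by near: y; apply: near_dist_lt; rewrite subr_gt0.
    by move: yr yT; rewrite !ltr_norml => /andP[? ?] /andP[? ?]; apply/andP; split; lra.
  by rewrite /body_twist de (ss r rT').
pose P r := ulsubmx (g r); pose P' r := ulsubmx (g' r).
pose x r := ursubmx (g r); pose x' r := ursubmx (g' r).
have sP r : 0 <= r <= T -> SO3 (P r).
  by move=> /sg /SE3P[Q [y [sQ e]]]; rewrite /P e block_mxKul.
have sP' r : 0 <= r <= T -> SO3 (P' r).
  by move=> /sg' /SE3P[Q [y [sQ e]]]; rewrite /P' e block_mxKul.
have sub_ac (h : R -> 'M[R]_(3 + 1)) : absolutely_continuous 0 T h ->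
    (forall i j, absolutely_continuous 0 T (fun r => ulsubmx (h r) i j)) /\
    (forall i j, absolutely_continuous 0 T (fun r => ursubmx (h r) i j)).
  move=> ach; split=> i j.
    by under [X in absolutely_continuous _ _ X]funext do rewrite !mxE; exact: ac_mx.
  by under [X in absolutely_continuous _ _ X]funext do rewrite !mxE; exact: ac_mx.
have [acP acx] := sub_ac _ acg; have [acP' acx'] := sub_ac _ acg'.
have dmx (h : R -> 'M[R]_(3 + 1)) r : derivable h r 1 -> is_dmx h r (derive1 h r).
  by move=> dh; apply/is_dmxP; rewrite derive1E; exact/derivableP.
have eqs : {ae lebesgue_measure, forall r : measurableTypeR R, `]0, T[%classic r ->
    exists w v, [/\ is_dmx P r (P r *m cross_mx w), is_dmx P' r (P' r *m cross_mx w),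
      is_dmx x r (P r *m v) & is_dmx x' r (P' r *m v)]}.
  apply: filterS2 hm hm' => r hr hr' /[dup] rT /=; rewrite in_itv/= => /[dup] rT1 /andP[r0 r1].
  have rT' : 0 <= r <= T by rewrite !ltW.
  have [dg [dP dx]] := (motion_equationP s (sg _ rT')).1 (hr rT).
  have [dg' [dP' dx']] := (motion_equationP s' (sg' _ rT')).1 (hr' rT).
  rewrite tw// in dP' dx'.
  exists (dsubmx (body_twist s r)), (usubmx (body_twist s r)); split.
  - by rewrite -dP; exact: is_dmx_ulsub (dmx _ _ dg).
  - by rewrite -dP'; exact: is_dmx_ulsub (dmx _ _ dg').
  - by rewrite -dx; exact: is_dmx_ursub (dmx _ _ dg).
  - by rewrite -dx'; exact: is_dmx_ursub (dmx _ _ dg').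
have T0 : (0 : R) <= 0 <= T by case/andP: tT => t0 /(le_trans t0) ->; rewrite lexx.
have PP r : 0 <= r <= T -> P' r = P r.
  move=> rT; have := @cst_mx_ae _ _ (fun r => P' r *m (P r)^T) 0 T _ _ r rT.
  have -> : P' 0 = P 0 by rewrite /P' g0.
  rewrite (mulmx1C (sP _ T0).1) => h.
  have {}h : P' r *m (P r)^T = 1%:M.
    apply: h => [|]; last first.
      apply: filterS eqs => q hq qT; have [w [v [d1 d2 _ _]]] := hq qT.
      have := is_dmxM d2 (is_dmx_tr d1); congr (is_dmx _ _ _).
      by rewrite trmx_mul cross_mx_tr mulNmx mulmxN mulmxA addrN.
    have acPt i j : absolutely_continuous 0 T (fun t => (P t)^T i j).
      by under [X in absolutely_continuous _ _ X]funext do rewrite mxE; exact: acP.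
    apply: (ac_mulmx (B := 1)) => // i j q qT; first exact: SO3_entry (sP' _ qT).
    by rewrite mxE; exact: SO3_entry (sP _ qT).
  by rewrite -[LHS]mulmx1 -(sP _ rT).1 mulmxA h mul1mx.
have xx : x' t = x t.
  have := @cst_mx_ae _ _ (fun r => x' r - x r) 0 T _ _ t tT.
  have -> : x' 0 = x 0 by rewrite /x' g0.
  rewrite subrr => h; apply/eqP; rewrite -subr_eq0; apply/eqP; apply: h => [i j|].
    have -> : (fun r => (x' r - x r) i j) = (fun r => x' r i j + - x r i j).
      by apply/funext => r; rewrite mxE [X in _ + X]mxE.
    exact: (acD (acx' i j) (acN (acx i j))).
  apply: filterS eqs => r hr /[dup] rT /=; rewrite in_itv/= => /andP[r0 r1].
  have [w [v [_ _ d1 d2]]] := hr rT.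
  have := is_dmxB d2 d1; congr (is_dmx _ _ _).
  by rewrite PP ?subrr// !ltW.
have /SE3P[Q [y [_ e]]] := sg _ tT; have /SE3P[Q' [y' [_ e']]] := sg' _ tT.
have := PP _ tT; move: xx; rewrite /x /x' /P /P' e e' !block_mxKul !block_mxKur.
by move=> -> ->.
Unshelve. all: by end_near. Qed.

End Uniqueness.

(** * Controls and solutions *)

Section Gluing.
Context {R : realType}.

Definition glue (V : Type) (T : R) (f h : R -> V) (t : R) : V :=
  if t <= T then f t else h (t - T).

Lemma lipschitz_glue (T : R) (f h : R -> R) : 0 <= T ->
  lipschitz_itv 0 T f -> lipschitz_itv 0 1 h -> f T = h 0 ->
  lipschitz_itv 0 (T + 1) (glue T f h).
Proof.
move=> T0 [L L0 fL] [K K0 hK] fh; exists (L + K) => [|x y hx hy]; first exact: addr_gt0.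
wlog xy : x y hx hy / x <= y.
  move=> H; have [xy|/ltW yx] := leP x y; first exact: H.
  by rewrite distrC [X in _ * X]distrC; exact: H.
move: hx hy => /andP[x0 x1] /andP[y0 y1].
have LK (a : R) : 0 <= a -> L * a <= (L + K) * a /\ K * a <= (L + K) * a.
  by move=> a0; split; rewrite ler_wpM2r// ?lerDl ?lerDr ltW.
rewrite [`|y - x|]ger0_norm ?subr_ge0//; have [|h1 h2] := LK (y - x); first by rewrite subr_ge0.
rewrite /glue; have [yT|Ty] := leP y T; have [xT|Tx] := leP x T.
- apply: (le_trans (fL _ _ _ _)); rewrite ?x0 ?y0 //.
  by rewrite ger0_norm// subr_ge0.
- by have := le_lt_trans xy (le_lt_trans yT Tx); rewrite ltxx.
- have hT : (0 : R) <= T <= T by rewrite T0 lexx.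
  have xx : 0 <= x <= T by rewrite x0.
  have z01 : (0 : R) <= 0 <= (1 : R) by rewrite lexx /= ler01.
  have yy : 0 <= y - T <= 1 by apply/andP; split; lra.
  have yT0 : 0 <= y - T by rewrite subr_ge0 ltW.
  have xT0 : 0 <= T - x by rewrite subr_ge0.
  have := fL _ _ xx hT; have := hK _ _ z01 yy; rewrite subr0 (ger0_norm yT0) (ger0_norm xT0).
  have := ler_normD (h (y - T) - h 0) (f T - f x); rewrite fh addrA subrK.
  have [? ?] := LK _ yT0.
  have [? ?] := LK _ xT0.
  by move=> *; lra.
- have xx : 0 <= x - T <= 1 by apply/andP; split; lra.
  have yy : 0 <= y - T <= 1 by apply/andP; split; lra.
  apply: (le_trans (hK _ _ xx yy)); rewrite (_ : _ - _ = y - x); last by ring.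
  by rewrite ger0_norm// subr_ge0.
Qed.

Lemma near_glue_left (V : Type) (T t : R) (f h : R -> V) : t < T ->
  \forall x \near t, f x = glue T f h x.
Proof.
move=> tT; near=> x; rewrite /glue ifT//.
have : `|x - t| < T - t by near: x; apply: near_dist_lt; rewrite subr_gt0.
by rewrite ltr_norml => /andP[? ?]; lra.
Unshelve. all: by end_near. Qed.

Lemma near_glue_right (V : Type) (T t : R) (f h : R -> V) : T < t ->
  \forall x \near t, h (- T + x * 1) = glue T f h x.
Proof.
move=> tT; near=> x; rewrite /glue ifF; first by rewrite mulr1 addrC.
have : `|x - t| < t - T by near: x; apply: near_dist_lt; rewrite subr_gt0.
by rewrite ltr_norml => /andP[? ?]; apply/negbTE; rewrite -ltNge; lra.
Unshelve. all: by end_near. Qed.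

Lemma is_dmx_glue_left m n (T t : R) (A B : R -> 'M[R]_(m, n)) dA : t < T ->
  is_dmx A t dA -> is_dmx (glue T A B) t dA.
Proof. by move=> /near_glue_left h; exact: is_dmx_near. Qed.

Lemma is_dmx_glue_right m n (T t : R) (A B : R -> 'M[R]_(m, n)) dB : T < t ->
  is_dmx B (t - T) dB -> is_dmx (glue T A B) t dB.
Proof.
move=> /(@near_glue_right _ _ _ A B) h dBt; apply: (is_dmx_near h).
by rewrite -[dB]scale1r; apply: is_dmx_affine; rewrite mulr1 addrC.
Qed.

Lemma Linfty_bounded (T : R) (v : R -> R) (B : R) :
  measurable_fun setT (v : measurableTypeR R -> measurableTypeR R) ->
  (forall t, `|v t| <= B) -> Linfty 0 T v.
Proof.
move=> mv vB; have B0 : 0 <= B by apply: le_trans (vB 0).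
apply/andP; split; rewrite inE /=.
  apply: (measurable_restrictT v (measurable_itv `[0, T])).1.
  exact: (measurable_funTS mv).
rewrite /finite_norm unlock /Lnorm; case: ifPn => // _.
apply: (@le_lt_trans _ _ B%:E); last exact: ltry.
apply/ess_supP; apply: aeW => t /=; rewrite lee_fin patchE.
by case: ifPn => _; rewrite ?normr0.
Qed.

Lemma ae_notin (F : seq R) :
  {ae lebesgue_measure, forall t : measurableTypeR R, (t : R) \notin F}.
Proof.
have cF : countable [set x : R | x \in F] by exact/finite_set_countable/finite_seq.
exists [set x : measurableTypeR R | (x : R) \in F]; split.
- exact: countable_measurable.
- exact: countable_lebesgue_measure0.
- by move=> t /= /negP; rewrite negbK.
Qed.

End Gluing.

(** * From sequences of moves to controls and solutions *)

Section Trajectories.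
Context {R : realType} (Cpar Cperp Ctau : R) {N : nat} (ell : N.-tuple R).
Local Notation angles := (mobile N -> R * R).
Local Notation twist := (shape_twist Cpar Cperp Ctau ell).
Local Notation move := (move Cpar Cperp Ctau ell).
Local Notation steers := (steers Cpar Cperp Ctau ell).
Implicit Types (p q : 'M[R]_(3 + 1) * angles).

(** Lipschitz bounds are kept instead of absolute continuity because they glue easily; [F] holds the
    finitely many times at which the rates may switch. *)
Definition trajectory (T : R) p q (A c : R -> angles) (g : R -> 'M[R]_(3 + 1)) :=
  [/\ [/\ g 0 = p.1, A 0 = p.2, g T = q.1 & A T = q.2],
    (forall i j, lipschitz_itv 0 T (fun t => g t i j)) /\
      (forall t, 0 <= t <= T -> SE3 (g t)),
    forall j, lipschitz_itv 0 T (fun t => (A t j).1) /\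
      lipschitz_itv 0 T (fun t => (A t j).2),
    forall j, [/\ measurable_fun setT ((fun t => (c t j).1) : measurableTypeR R -> measurableTypeR R),
      measurable_fun setT ((fun t => (c t j).2) : measurableTypeR R -> measurableTypeR R) &
      exists B, forall t, `|(c t j).1| <= B /\ `|(c t j).2| <= B] &
    exists F : seq R, forall t, 0 < t < T -> t \notin F ->
      (forall j, is_derive t (1 : R) (fun r => (A r j).1) (c t j).1 /\
         is_derive t (1 : R) (fun r => (A r j).2) (c t j).2) /\
      is_dmx g t (g t *m hat (twist (A t) (c t)))].

Lemma lipschitz_cst (a b k : R) : lipschitz_itv a b (fun=> k).
Proof. by exists 1 => // x y _ _; rewrite subrr normr0 mul1r. Qed.

Lemma lipschitz_line (a b : R) : lipschitz_itv 0 1 (fun t : R => a + t * b).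
Proof.
exists (`|b| + 1) => [|x y _ _]; first by rewrite ltr_wpDl.
rewrite (_ : _ - _ = b * (y - x)); last by ring.
by rewrite normrM ler_wpM2r// lerDl.
Qed.

Lemma trajectory_refl p : SE3 p.1 -> trajectory 0 p p (fun=> p.2) (fun _ _ => (0, 0)) (fun=> p.1).
Proof.
move=> sp; split.
- by split.
- by split=> // i j; exact: lipschitz_cst.
- by move=> j; split; exact: lipschitz_cst.
- move=> j; split; [exact: measurable_cst|exact: measurable_cst|].
  by exists 0 => t /=; rewrite normr0.
- by exists [::] => t /andP[t0 /(lt_trans t0)]; rewrite ltxx.
Qed.

Lemma measurable_fun_switch (f h : R -> R) (T : R) :
  measurable_fun setT (f : measurableTypeR R -> measurableTypeR R) ->
  measurable_fun setT (h : measurableTypeR R -> measurableTypeR R) ->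
  measurable_fun setT ((fun t => if t <= T then f t else h t) :
    measurableTypeR R -> measurableTypeR R).
Proof.
by move=> mf mh; apply: measurable_fun_ifT => //; exact: measurable_fun_ler.
Qed.

Lemma trajectory_move T p q r A c g : 0 <= T -> trajectory T p q A c g -> move q r ->
  exists A' c' g', trajectory (T + 1) p r A' c' g'.
Proof.
move=> T0 [[g0 A0 gT AT] [lg sg] lA mc [F dF]] [d [X [[lX sX dX] X0 X1 rE]]].
pose L t : angles := line q.2 d t.
exists (glue T A L), (fun t => if t <= T then c t else d), (glue T g X).
have jT : T + 1 <= T = false by apply/negbTE; rewrite -ltNge ltrDl.
have Tt : T + 1 - T = 1 by ring.
split.
- by rewrite /glue T0 jT Tt; split => //; rewrite /L -rE.
- split=> [i j|t /andP[t0 t1]].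
    have -> : (fun t => glue T g X t i j) = glue T (fun t => g t i j) (fun t => X t i j).
      by apply/funext => t; rewrite /glue; case: ifP.
    by apply: lipschitz_glue => //; rewrite gT X0.
  rewrite /glue; have [tT|Tt'] := leP t T; first by apply: sg; rewrite t0.
  by apply: sX; apply/andP; split; lra.
- move=> j; have [l1 l2] := lA j; split.
    have -> : (fun t => (glue T A L t j).1) = glue T (fun t => (A t j).1) (fun t => (L t j).1).
      by apply/funext => t; rewrite /glue; case: ifP.
    by apply: lipschitz_glue => //; [exact: lipschitz_line|rewrite AT /L line0].
  have -> : (fun t => (glue T A L t j).2) = glue T (fun t => (A t j).2) (fun t => (L t j).2).
    by apply/funext => t; rewrite /glue; case: ifP.
  by apply: lipschitz_glue => //; [exact: lipschitz_line|rewrite AT /L line0].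
- move=> j; have [m1 m2 [B cB]] := mc j; split.
  + have -> : (fun t => ((if t <= T then c t else d) j).1) =
        (fun t => if t <= T then (c t j).1 else (d j).1).
      by apply/funext => t; case: ifP.
    exact: measurable_fun_switch m1 (measurable_cst _).
  + have -> : (fun t => ((if t <= T then c t else d) j).2) =
        (fun t => if t <= T then (c t j).2 else (d j).2).
      by apply/funext => t; case: ifP.
    exact: measurable_fun_switch m2 (measurable_cst _).
  + exists (`|B| + `|(d j).1| + `|(d j).2|) => t; have [c1 c2] := cB t.
    have := ler_norm B; have := normr_ge0 B.
    have := normr_ge0 (d j).1; have := normr_ge0 (d j).2.
    by case: ifP => _ *; split; lra.
(* Rates may jump at the junction [T]; at any other time the glued curves agree nearby with one of
   the two pieces. *)
- exists (T :: F) => t /andP[t0 t1]; rewrite in_cons negb_or => /andP[tT tF].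
  have [ltT|ltT|eT] := ltgtP t T; last by rewrite eT eqxx in tT.
    have t0T : 0 < t < T by rewrite t0.
    have [dA dg] := dF t t0T tF.
    have e (V : Type) (f h : R -> V) : glue T f h t = f t by rewrite /glue ltW.
    rewrite !e; split=> [j|]; last exact: is_dmx_glue_left.
    have [d1 d2] := dA j; split.
      by apply: near_eq_is_derive d1; apply: filterS (near_glue_left A L ltT) => x <-.
    by apply: near_eq_is_derive d2; apply: filterS (near_glue_left A L ltT) => x <-.
  have e (V : Type) (f h : R -> V) : glue T f h t = h (t - T) by rewrite /glue leNgt ltT.
  have t01 : 0 < t - T < 1 by apply/andP; split; lra.
  rewrite !e; split=> [j|]; last by apply: is_dmx_glue_right => //; exact: dX.
  have lj (a b : R) : is_derive t (1 : R) (fun x => a + (- T + x * 1) * b) b.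
    have := is_derive_line (a - T * b) b t; apply: is_derive_ext => x; ring.
  split.
    by apply: near_eq_is_derive (lj (q.2 j).1 (d j).1);
      apply: filterS (near_glue_right A L ltT) => x <-.
  by apply: near_eq_is_derive (lj (q.2 j).2 (d j).2);
    apply: filterS (near_glue_right A L ltT) => x <-.
Qed.

(** The leading move ensures a positive duration, since [steers] may consist of no move at all. *)
Lemma steers_trajectory p q r : SE3 p.1 -> move p q -> steers q r ->
  exists T A c g, 0 < T /\ trajectory T p r A c g.
Proof.
move=> sp pq; elim=> [|x y _ [T [A [c [g [T0 tr]]]]] xy].
  have [A [c [g tr]]] := trajectory_move (lexx 0) (trajectory_refl sp) pq.
  by rewrite add0r in tr; exists 1, A, c, g.
have [A' [c' [g' tr']]] := trajectory_move (ltW T0) tr xy.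
by exists (T + 1), A', c', g'; rewrite addr_gt0.
Qed.

Lemma trajectory_solution T p q A c g : trajectory T p q A c g ->
  [/\ forall j, Linfty 0 T (fun t => (c t j).2), forall j, Linfty 0 T (fun t => (c t j).1) &
    swimmer_solution Cpar Cperp Ctau ell T (fun j t => (c t j).2) (fun j t => (c t j).1)
      g (fun t => shape_of (A t))].
Proof.
move=> [_ [lg sg] lA mc [F dF]].
have aeF (P : R -> Prop) : (forall t, 0 < t < T -> t \notin F -> P t) ->
    {ae lebesgue_measure, forall t : measurableTypeR R, `]0, T[%classic t -> P t}.
  by move=> h; apply: filterS (ae_notin F) => t tF; rewrite /= in_itv => /h; apply.
split.
- by move=> j; have [_ m2 [B cB]] := mc j; apply: Linfty_bounded m2 (fun t => (cB t).2).
- by move=> j; have [m1 _ [B cB]] := mc j; apply: Linfty_bounded m1 (fun t => (cB t).1).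
split=> //.
- by apply: lipschitz_ac; exact: lipschitz_mx.
- move=> j; exists (fun t => (A t j).2); first by [].
  split; first by apply: lipschitz_ac; have [] := lA j.
  by apply: aeF => t tT tF; have [dA _] := dF t tT tF; have [] := dA j.
- move=> j; split; first by apply: lipschitz_ac; have [] := lA j.
  by apply: aeF => t tT tF; have [dA _] := dF t tT tF; have [] := dA j.
- apply: aeF => t tT tF; have [dA dg] := dF t tT tF.
  have [t0 t1] := andP tT.
  have tT' : 0 <= t <= T by rewrite !ltW.
  have dl : (fun i => derive1 (fun r : R => link_dir (shape_of (A r)) i) t) = ddir (A t) (c t).
    apply/funext => i; rewrite derive1E.
    have : is_dmx (fun r => link_dir (shape_of (A r)) i) t (ddir (A t) (c t) i).
      rewrite /ddir; under [X in is_dmx X]funext do rewrite link_dirE.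
      case: insub => [j|]; last exact: is_dmx_cst.
      by have [d1 d2] := dA j; exact: is_dmx_udir.
    by move=> /is_dmxP[_ ->].
  have bt : body_twist Cpar Cperp Ctau ell (fun t => shape_of (A t)) t = twist (A t) (c t).
    by rewrite /body_twist dl.
  have /is_dmxP[dgt dgE] := dg.
  apply/motion_equationP; first exact: sg.
  rewrite bt derive1E dgE; split=> //.
  have /SE3P[P [x [_ ->]]] := sg t tT'.
  by rewrite se3_hat !block_mxKul block_mxKur.
Qed.

End Trajectories.

Theorem theorem4p2 (R : realType) (Cpar Cperp Ctau : R) (N : nat)
  (hpar : 0 < Cpar) (hperp : Cpar < Cperp) (htau : 0 < Ctau) (hN : (2 < N)%N) :
  {ae @lebesgue_tuple R N, forall ell : N.-tuple (measurableTypeR R),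
     link_lengths ell ->
     (forall s : swimmer_shape R N,
        positive_definite (resistance_mx Cpar Cperp Ctau ell s)) ->
     fiber_controllable Cpar Cperp Ctau ell}.
Proof.
(* The inclination that puts link 2 along [e2], where the polynomials have been tested. *)
have [phi0 [cphi sphi]] : exists t : R, cos t = 3 / 5 /\ sin t = 4 / 5.
  by apply: polar; field.
pose al := @bent_angles R N phi0.
pose i0 : 'I_N := Ordinal (ltn_trans (ltn0Sn 1) hN).
have bent (i : 'I_N) : (0 < i)%N -> link_dir (shape_of al) i =
    if val i == 1%N then ex else vec3 0 (sin phi0) (cos phi0).
  by move=> lt0i; rewrite -[al](line0 _ (@bend_rate R N)) link_dir_bent// addr0.
have s1 : link_dir (shape_of al) (Ordinal (ltn_trans (ltnSn 1) hN)) = ex by rewrite bent.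
have s2 : link_dir (shape_of al) (Ordinal hN) = e2 by rewrite bent//= cphi sphi.
have [m em] := @lebesgue_tuple_sigma_finite R N.
have := generic_lengths Ctau hpar hperp s1 s2 i0.
rewrite em => gen; apply: filterS gen => ell [l0 pitch0 turning0] _ posM.
have unitM s : resistance_mx Cpar Cperp Ctau ell s \in unitmx.
  exact: positive_definite_unitmx (posM s).
have lam0 : tnth ell i0 * Ctau != 0 by rewrite mulf_neq0// gt_eqF.
have ex1 : dot (- ex) (- ex) = 1 :> R by rewrite /ex !vec3S; ring.
move=> g0 s0 g1 hg0 hg1; have [al0 s0E] := shape_ofP s0.
(* A move with zero rates serves as the leading move that makes the duration positive. *)
have [X [cX X0]] := curve_exists unitM al0 (fun=> (0, 0)).
have start : move Cpar Cperp Ctau ell (g0, al0) (g0 *m X 1, line al0 (fun=> (0, 0)) 1).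
  by exists (fun=> (0, 0)), (fun t => g0 *m X t); split;
    [exact: curve_left|rewrite X0 mulmx1|by []|by []].
have hX1 : SE3 (g0 *m X 1).
  by have [_ sX _] := cX; apply: SE3M => //; apply: sX; rewrite ler01 lexx.
have [be st] := reach unitM (i0 := i0) (eqxx _) lam0 ex1 (@bent_rigid R N phi0)
  pitch0 turning0 (line al0 (fun=> (0, 0)) 1) hX1 hg1.
have [T [A [c [g [T0 tr]]]]] := steers_trajectory (p := (g0, al0)) hg0 start st.
have [hu1 hu2 sol] := trajectory_solution tr.
have [[g0E A0E gTE _] _ _ _ _] := tr; rewrite /= in g0E A0E gTE.
exists T, (fun j t => (c t j).2), (fun j t => (c t j).1); split=> //.
exists g, (fun t => shape_of (A t)); split=> //; split=> //; first by rewrite A0E s0E.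
move=> g' s' sol' g'0 s'0; apply: (swimmer_unique sol sol'); first by rewrite g'0 g0E.
by rewrite s'0 A0E s0E.
Qed.
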